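(* Let $\psi\in\mathbb{C}\setminus\{0\}$ and $\beta>0$ with $\beta^3>27|\psi|^2$, let $g_2=\frac43\beta^2$, $g_3=16|\psi|^2-\frac8{27}\beta^3$, and let $$e^{u(y)}=\frac\beta6-\frac{\wp(y-\omega';g_2,g_3)}2$$ be the metric factor of a translationally equivariant minimal Lagrangian surface in $\mathbb{C}P^2$ with (constant) cubic Hopf differential coefficient $\psi$. Let $\lambda\in S^1$ and $\tilde g_3=g_3-16[\mathrm{Im}(\lambda^{-3}\psi)]^2$. Then the cubic equation $4t^3-g_2t-\tilde g_3=0$ has three distinct roots, which are ordered as $\tilde e_1>\tilde e_2>\tilde e_3$. Put $\tilde H_i^2=(\tilde e_i-\tilde e_j)(\tilde e_i-\tilde e_k)$ for distinct $i,j,k\in\{1,2,3\}$. If $\lambda^{-3}\psi$ is not real, let $\alpha_j$ be such that $\wp(\alpha_j)=\tilde e_j$ for $j=1,2,3$. Then $$\beta_1(2\omega)=2\omega i-4\,\mathrm{Im}(\lambda^{-3}\psi)\,\mathrm{Re}(\lambda^{-3}\psi)\sum_{j=1}^3\frac1{\tilde H_j^2}\,\frac{1}{\wp'(\alpha_j)}\,[4\omega\zeta(\alpha_j)-4\alpha_j\eta],$$ $$\beta_2(2\omega)=i\,\mathrm{Im}(\lambda^{-3}\psi)\sum_{j=1}^3\frac{\frac\beta3-\tilde e_j}{2\tilde H_j^2}\,\frac{1}{\wp'(\alpha_j)}\,[4\omega\zeta(\alpha_j)-4\alpha_j\eta],$$ $$G_j(2\omega)=-2\,\mathrm{Im}(\lambda^{-3}\psi)\,\frac{4\omega\zeta(\alpha_j)-4\alpha_j\eta}{\wp'(\alpha_j)},\qquad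 j=1,2,3.$$ When $\lambda^{-3}\psi$ is real, $\beta_1(2\omega)=2\omega i$, $\beta_2(2\omega)=0$ and $G_j(2\omega)=0$.
   Context: $\wp,\zeta$ are the Weierstrass functions with invariants $g_2,g_3$. The polynomial $4t^3-g_2t-g_3$ has three distinct real roots $e_1>e_2>e_3$; $\omega=\int_{e_1}^\infty\frac{dt}{\sqrt{4t^3-g_2t-g_3}}>0$ and $\omega'=i\int_{-\infty}^{e_3}\frac{dt}{\sqrt{|4t^3-g_2t-g_3|}}$ are half-periods with $\wp(\omega)=e_1$, $\wp(\omega')=e_3$; $\eta=\zeta(\omega)$. The surface is equivariant under translations in the $x$-direction of the coordinate $z=x+iy$, its induced metric is $2e^{u}dz\,d\bar z$, and its cubic Hopf differential is $\psi\,dz^3$. The function $u=u(y)$ is real, even and $2\omega$-periodic, and $u'=du/dy$. The quantities are $$\beta_1(y)=\int_0^y\frac{2i\lambda^3\bar\psi-iu'e^u}{\lambda^3\bar\psi-\lambda^{-3}\psi-e^uu'}ds,\quad \beta_2(y)=\int_0^y\frac{2e^u}{\lambda^3\bar\psi-\lambda^{-3}\psi-e^uu'}ds,\quad G_j(y)=\int_0^y\frac{d_j\,\mathrm{Im}(\lambda^{-3}\psi)}{d_je^u-\mathrm{Re}(\lambda^{-3}\psi)}ds,$$ where $d_1,d_2,d_3$ are the real roots of $d^3-\beta d+2\mathrm{Re}(\lambda^{-3}\psi)=0$, labelled so that $\tilde e_1=\frac\beta3+d_2d_3$ and similarly $\tilde e_j=\frac\beta3+d_kd_l$ for $\{j,k,l\}=\{1,2,3\}$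 (the $i d_j$ are the eigenvalues of the matrix $D(\lambda)$ for which $D(\lambda)\,dz$ is the potential generating the surface). Over a full period these integrals reduce to $\beta_1(2\omega)=2\omega i-4\,\mathrm{Im}(\lambda^{-3}\psi)\mathrm{Re}(\lambda^{-3}\psi)\int_0^{2\omega}\frac{ds}{(e^uu')^2+4[\mathrm{Im}(\lambda^{-3}\psi)]^2}$ and $\beta_2(2\omega)=4i\,\mathrm{Im}(\lambda^{-3}\psi)\int_0^{2\omega}\frac{e^u\,ds}{(e^uu')^2+4[\mathrm{Im}(\lambda^{-3}\psi)]^2}$; the values stated for real $\lambda^{-3}\psi$ are those obtained from these expressions and from $G_j$ by taking the terms with prefactor $\mathrm{Im}(\lambda^{-3}\psi)=0$ to be zero.
   Formalization: β₂(2ω) is proved with summand factor 2(β/3−ẽ_j)/H̃_j² (the printed one is 4 times too small); Re(λ⁻³ψ)≠0 is assumed (otherwise the cubic has a double root); α_j is taken with |Im α_j|<Im ω' (a shift by 2ω' breaks the formula for G_j). *)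

(* Defs.v *)
From Stdlib Require Import Reals ZArith.
From Coquelicot Require Export Coquelicot.

Open Scope C_scope.

(* Weierstrass functions of the lattice 2 w1 Z + 2 w3 Z: w1, w3 are HALF-periods. *)

Definition lattice_pt (w1 w3 : C) (m n : Z) : C :=
  2 * IZR m * w1 + 2 * IZR n * w3.

Definition in_lattice (w1 w3 z : C) : Prop :=
  exists m n : Z, z = lattice_pt w1 w3 m n.

(* Sum of f over the nonzero lattice points.  The series used below converge
   absolutely, so summing over the squares |m|, |n| <= N loses no generality. *)
Definition lattice_psum (w1 w3 : C) (f : C -> C) (N : nat) : C :=
  sum_n (fun i => sum_n (fun j =>
    let m := (Z.of_nat i - Z.of_nat N)%Z in
    let n := (Z.of_nat j - Z.of_nat N)%Z in
    if andb (m =? 0)%Z (n =? 0)%Z then RtoC 0 else f (lattice_pt w1 w3 m n))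
    (2 * N)) (2 * N).

Definition lattice_sum (w1 w3 : C) (f : C -> C) : C :=
  (real (Lim_seq (fun N => Re (lattice_psum w1 w3 f N))),
   real (Lim_seq (fun N => Im (lattice_psum w1 w3 f N)))).

Definition inv_g2 (w1 w3 : C) : C := 60 * lattice_sum w1 w3 (fun W => / W ^ 4).
Definition inv_g3 (w1 w3 : C) : C := 140 * lattice_sum w1 w3 (fun W => / W ^ 6).

Definition wp (w1 w3 z : C) : C :=
  / z ^ 2 + lattice_sum w1 w3 (fun W => / (z - W) ^ 2 - / W ^ 2).

Definition wp' (w1 w3 : C) : C -> C := C_derive (wp w1 w3).

Definition wzeta (w1 w3 z : C) : C :=
  / z + lattice_sum w1 w3 (fun W => / (z - W) + / W + z / W ^ 2).

Definition idx (j : nat) : Prop := (1 <= j <= 3)%nat.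

Definition distinct3 (i j k : nat) : Prop :=
  idx i /\ idx j /\ idx k /\ i <> j /\ j <> k /\ i <> k.

(* All complex roots of 4 t^3 - g2 t - g3 are real and simple, and they are
   e 1 > e 2 > e 3. *)
Definition ordered_roots (g2 g3 : R) (e : nat -> R) : Prop :=
  (e 1%nat > e 2%nat)%R /\ (e 2%nat > e 3%nat)%R /\
  forall t : C, 4 * t ^ 3 - g2 * t - g3 = 0 <-> exists j, idx j /\ t = e j.

(* The functions wp w w', wzeta w w' are the Weierstrass functions with
   invariants g2, g3, and w, w' are the half-periods given by the complete
   elliptic integrals; e lists the roots in decreasing order. *)
Definition half_periods (g2 g3 : R) (e : nat -> R) (w : R) (w' : C) : Prop :=
  (0 < w)%R /\
  is_RInt_gen (fun t : R => / sqrt (4 * t ^ 3 - g2 * t - g3))%R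
    (at_right (e 1%nat)) (Rbar_locally p_infty) w /\
  (exists v : R,
    is_RInt_gen (fun t : R => / sqrt (Rabs (4 * t ^ 3 - g2 * t - g3)))%R
      (Rbar_locally m_infty) (at_left (e 3%nat)) v /\
    w' = Ci * v) /\
  inv_g2 w w' = g2 /\ inv_g3 w w' = g3 /\
  wp w w' w = e 1%nat /\ wp w w' w' = e 3%nat.

Definition hopf (psi lambda : C) : C := / lambda ^ 3 * psi.

Definition denom (psi lambda : C) (u : R -> R) (s : R) : C :=
  lambda ^ 3 * Cconj psi - hopf psi lambda - RtoC (exp (u s) * Derive u s).

Definition beta1 (psi lambda : C) (u : R -> R) (y : R) : C :=
  RInt (V := C_R_CompleteNormedModule)
    (fun s : R => (2 * Ci * lambda ^ 3 * Cconj psi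
                    - Ci * RtoC (Derive u s * exp (u s))) / denom psi lambda u s) 0 y.

Definition beta2 (psi lambda : C) (u : R -> R) (y : R) : C :=
  RInt (V := C_R_CompleteNormedModule)
    (fun s : R => 2 * RtoC (exp (u s)) / denom psi lambda u s) 0 y.

(* The integral G_j; the argument d is d_j. *)
Definition Gint (psi lambda : C) (u : R -> R) (d y : R) : R :=
  RInt (fun s : R => d * Im (hopf psi lambda)
                     / (d * exp (u s) - Re (hopf psi lambda)))%R 0 y.

(* When lambda^{-3} psi is real, the integrals beta1, beta2 diverge at the zeros
   of u', and their values over the period 2 w are understood through the
   expressions below, to which they reduce otherwise.  The integrals in these
   also diverge in the real case, but they are multiplied by
   Im (lambda^{-3} psi) = 0 and such a term counts as 0.  In the other case,
   (e^u u')^2 + 4 Im^2 is the product of the wp - et j and e^u is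
   (beta / 3 - wp) / 2: this is where the constant 4 / 2 = 2 in the closed form
   of beta2 (2 w) comes from. *)
Definition beta1_reduced (psi lambda : C) (u : R -> R) (w : R) : C :=
  2 * w * Ci - RtoC (4 * Im (hopf psi lambda) * Re (hopf psi lambda) *
    RInt (fun s : R => / ((exp (u s) * Derive u s) ^ 2
                          + 4 * Im (hopf psi lambda) ^ 2)) 0 (2 * w))%R.

Definition beta2_reduced (psi lambda : C) (u : R -> R) (w : R) : C :=
  4 * Ci * RtoC (Im (hopf psi lambda) *
    RInt (fun s : R => exp (u s) / ((exp (u s) * Derive u s) ^ 2
                                    + 4 * Im (hopf psi lambda) ^ 2)) 0 (2 * w))%R.

(* d 1, d 2, d 3 are the real roots of x^3 - beta x + 2 Re(lambda^{-3} psi),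
   numbered compatibly with the roots et of the modified cubic.  This means
   et j = d j ^ 2 - 2 beta / 3; if Re (lambda^{-3} psi) = 0, the d's are
   0, sqrt beta, - sqrt beta and beta / 3 is a double root of that cubic. *)
Definition labelled_roots (beta : R) (psi lambda : C) (et d : nat -> R) : Prop :=
  (forall x : R,
     (x ^ 3 - beta * x + 2 * Re (hopf psi lambda) = 0)%R <->
     exists j, idx j /\ x = d j) /\
  (forall j k l, distinct3 j k l -> et j = (beta / 3 + d k * d l)%R).

(* 4 w zeta(a) - 4 a eta, with eta = zeta(w). *)
Definition period_term (w : R) (w' a : C) : C :=
  4 * w * wzeta w w' a - 4 * a * wzeta w w' w.

(* A value a with wp(a) = t.  The lattice points have to be excluded because
   there [wp] has a junk value.  Moreover a is taken in the fundamental strip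
   |Im a| < Im w': replacing a by a + 2 w' changes [period_term] by -4 pi i
   (Legendre), so that it is not a function of wp(a) alone, whereas a + 2 w and
   -a only change it consistently with wp'(a). *)
Definition wp_preimage (w : R) (w' : C) (t : R) (a : C) : Prop :=
  ~ in_lattice w w' a /\ (Rabs (Im a) < Im w')%R /\ wp w w' a = t.

(* Main.v *)
Require Import Defs.
From Stdlib Require Import Reals ZArith Lra Lia Classical ClassicalEpsilon.
From Coquelicot Require Import Coquelicot.

(* Everything reduces to the single integral of 1 / (wp(s - w') - wp(a)) over a
   period: (e^u u')^2 + 4 Im^2 is the product of the wp - et j, so the integrands
   of beta1, beta2 and G_j split into partial fractions, up to a part that is odd
   under s |-> 2 w - s.  That integral comes from
     (zeta(z - a) - zeta(z + a) + 2 zeta(a)) (wp z - wp a) = wp' a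
   together with the fact that shifting the line of integration of zeta by d
   changes its integral over a period by 2 eta d.  This identity and the
   equation wp'' = 6 wp^2 - g2 / 2 follow from Liouville's theorem on the torus,
   which is obtained from the mean value property on circles and the maximum
   principle.  The strip condition |Im a| < Im w' keeps the lines z - t a and
   z + t a with Im z = - Im w' and 0 <= t <= 1 away from the lattice. *)

Open Scope R_scope.

(** * Complex derivatives *)

(** Holomorphy is handled through explicit derivatives: every function that occurs is a polynomial
    in lattice series closed under differentiation, so the first and second derivatives that the
    Liouville argument asks for are written down rather than deduced from Cauchy's formula. Complex
    contour integrals are avoided as well: a complex identity of integrals is read as a family of
    real ones, for the real part of [kap * f] with an arbitrary constant [kap]. The line Im z = - Im
    w' is dictated by the surface: on it wp equals beta / 3 - 2 e^u, hence is real together with its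
    derivative, and s |-> 2 w - s is z |-> - z modulo the lattice. The condition Im (hopf psi
    lambda) <> 0 acts twice. It makes (e^u u')^2 + 4 Im^2 positive, so that wp never takes a value
    [et j] on this line; and at a preimage of [et j] the first-order equation gives wp'^2 = gt3 - g3
    = - 16 Im^2, so that dividing by wp' makes sense. *)

Lemma Cmod_minus_sym (x y : C) : Cmod (x - y) = Cmod (y - x).
Proof. rewrite <- Cmod_opp. f_equal. ring. Qed.

Lemma Cmod_split (x y : C) : Cmod x <= Cmod (x - y) + Cmod y.
Proof. replace x with ((x - y) + y)%C at 1 by ring. apply Cmod_triangle. Qed.

Lemma Cmod_tri3 (x y z : C) : Cmod (x - z) <= Cmod (x - y) + Cmod (y - z).
Proof. replace (x - z)%C with ((x - y) + (y - z))%C by ring. apply Cmod_triangle. Qed.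

Lemma Cmod_le_Re_Im (z : C) : Cmod z <= Rabs (Re z) + Rabs (Im z).
Proof.
  destruct z as [x y]. simpl.
  replace ((x, y) : C) with (RtoC x + RtoC y * Ci)%C
    by (unfold RtoC, Ci, Cmult, Cplus; simpl; f_equal; ring).
  eapply Rle_trans. apply Cmod_triangle.
  rewrite Cmod_mult, Cmod_Ci, !Cmod_R. lra.
Qed.

Lemma im_le_Cmod (z : C) : Rabs (Im z) <= Cmod z.
Proof.
  eapply Rle_trans; [|apply Rmax_Cmod]. apply Rmax_r.
Qed.

(** The increment form has no division by [h], so sums, products and compositions are estimated
    directly and [h = 0] is not a special case. *)
Definition cderiv (f : C -> C) (z l : C) : Prop :=
  forall eps, 0 < eps -> exists del, 0 < del /\
    forall h, Cmod h < del -> Cmod (f (z + h) - f z - l * h)%C <= eps * Cmod h.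

Definition ccontinuous (f : C -> C) (z : C) : Prop :=
  forall eps, 0 < eps -> exists del, 0 < del /\
    forall z', Cmod (z' - z)%C < del -> Cmod (f z' - f z)%C < eps.

(** Estimates of lattice series come with a remainder of order |h|^2; this is the form in which they
    yield derivatives. *)
Lemma cderiv_quad f z l K d :
  0 < d -> (forall h, Cmod h < d -> Cmod (f (z + h) - f z - l * h)%C <= K * (Cmod h * Cmod h)) ->
  cderiv f z l.
Proof.
  intros Hd H eps He.
  assert (HK : 0 < Rabs K + 1) by (pose proof (Rabs_pos K); lra).
  exists (Rmin d (eps / (Rabs K + 1))). split.
  - apply Rmin_pos; auto. apply Rdiv_lt_0_compat; auto.
  - intros h Hh. pose proof (Rmin_l d (eps / (Rabs K + 1))).
    pose proof (Rmin_r d (eps / (Rabs K + 1))).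
    eapply Rle_trans. apply H. lra.
    rewrite <- Rmult_assoc. apply Rmult_le_compat_r. apply Cmod_ge_0.
    assert (Cmod h * (Rabs K + 1) <= eps).
    { replace eps with (eps / (Rabs K + 1) * (Rabs K + 1)) by (field; lra).
      apply Rmult_le_compat_r; lra. }
    pose proof (Rle_abs K). pose proof (Cmod_ge_0 h). nra.
Qed.

Lemma cderiv_ext_loc f g z l d :
  0 < d -> (forall z', Cmod (z' - z)%C < d -> f z' = g z') -> cderiv f z l -> cderiv g z l.
Proof.
  intros Hd H Hf eps He. destruct (Hf eps He) as [d' [Hd' Hf']].
  exists (Rmin d d'). split. apply Rmin_pos; auto.
  intros h Hh. pose proof (Rmin_l d d'). pose proof (Rmin_r d d').
  rewrite <- !H. apply Hf'. lra.
  - replace (z - z)%C with (RtoC 0) by ring. rewrite Cmod_0; lra.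
  - replace (z + h - z)%C with h by ring. lra.
Qed.

Lemma cderiv_ext f g z l : (forall z', f z' = g z') -> cderiv f z l -> cderiv g z l.
Proof. intros H. apply (cderiv_ext_loc f g z l 1); auto. lra. Qed.

Lemma cderiv_lip f z l : cderiv f z l -> exists d, 0 < d /\
  forall h, Cmod h < d -> Cmod (f (z + h) - f z)%C <= (Cmod l + 1) * Cmod h.
Proof.
  intros H. destruct (H 1 ltac:(lra)) as [d [Hd Hf]]. exists d. split; auto.
  intros h Hh. specialize (Hf h Hh).
  pose proof (Cmod_split (f (z + h) - f z)%C (l * h)%C). rewrite Cmod_mult in H0. lra.
Qed.

Lemma cderiv_ccontinuous f z l : cderiv f z l -> ccontinuous f z.
Proof.
  intros H eps He. destruct (cderiv_lip _ _ _ H) as [d [Hd Hf]].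
  pose proof (Cmod_ge_0 l).
  exists (Rmin d (eps / (Cmod l + 1))). split.
  - apply Rmin_pos; auto. apply Rdiv_lt_0_compat; lra.
  - intros z' Hz. pose proof (Rmin_l d (eps / (Cmod l + 1))).
    pose proof (Rmin_r d (eps / (Cmod l + 1))).
    specialize (Hf (z' - z)%C ltac:(lra)).
    replace (z + (z' - z))%C with z' in Hf by ring.
    eapply Rle_lt_trans. apply Hf.
    replace eps with ((Cmod l + 1) * (eps / (Cmod l + 1))) by (field; lra).
    apply Rmult_lt_compat_l; lra.
Qed.

Lemma cderiv_const c z : cderiv (fun _ => c) z 0%C.
Proof.
  intros eps He. exists 1. split. lra. intros h _.
  replace (c - c - 0 * h)%C with (RtoC 0) by ring. rewrite Cmod_0.
  apply Rmult_le_pos. lra. apply Cmod_ge_0.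
Qed.

Lemma cderiv_id z : cderiv (fun z => z) z 1%C.
Proof.
  intros eps He. exists 1. split. lra. intros h _.
  replace (z + h - z - 1 * h)%C with (RtoC 0) by ring. rewrite Cmod_0.
  apply Rmult_le_pos. lra. apply Cmod_ge_0.
Qed.

Lemma cderiv_plus f g z l m : cderiv f z l -> cderiv g z m -> cderiv (fun z => f z + g z)%C z (l + m)%C.
Proof.
  intros Hf Hg eps He.
  destruct (Hf (eps / 2) ltac:(lra)) as [d1 [Hd1 H1]].
  destruct (Hg (eps / 2) ltac:(lra)) as [d2 [Hd2 H2]].
  exists (Rmin d1 d2). split. apply Rmin_pos; auto.
  intros h Hh. pose proof (Rmin_l d1 d2). pose proof (Rmin_r d1 d2).
  specialize (H1 h ltac:(lra)). specialize (H2 h ltac:(lra)).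
  replace (f (z + h) + g (z + h) - (f z + g z) - (l + m) * h)%C
    with ((f (z + h) - f z - l * h) + (g (z + h) - g z - m * h))%C by ring.
  eapply Rle_trans. apply Cmod_triangle. lra.
Qed.

Lemma cderiv_mult f g z l m : cderiv f z l -> cderiv g z m ->
  cderiv (fun z => f z * g z)%C z (l * g z + f z * m)%C.
Proof.
  intros Hf Hg eps He.
  pose proof (Cmod_ge_0 (f z)). pose proof (Cmod_ge_0 (g z)).
  pose proof (Cmod_ge_0 l). pose proof (Cmod_ge_0 m).
  set (A := Cmod (f z) + Cmod (g z) + Cmod l + Cmod m + 1).
  assert (HA : 0 < A) by (unfold A; lra).
  destruct (Hf (eps / (4 * A)) ltac:(apply Rdiv_lt_0_compat; lra)) as [d1 [Hd1 H1']].
  destruct (Hg (eps / (4 * A)) ltac:(apply Rdiv_lt_0_compat; lra)) as [d2 [Hd2 H2']].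
  destruct (cderiv_lip _ _ _ Hg) as [d3 [Hd3 H3']].
  destruct (cderiv_ccontinuous _ _ _ Hg (Rmin 1 (eps / (4 * A)))) as [d4 [Hd4 H4']].
  { apply Rmin_pos. lra. apply Rdiv_lt_0_compat; lra. }
  exists (Rmin (Rmin d1 d2) (Rmin d3 d4)). split.
  repeat apply Rmin_pos; auto.
  intros h Hh.
  pose proof (Rmin_l (Rmin d1 d2) (Rmin d3 d4)). pose proof (Rmin_r (Rmin d1 d2) (Rmin d3 d4)).
  pose proof (Rmin_l d1 d2). pose proof (Rmin_r d1 d2).
  pose proof (Rmin_l d3 d4). pose proof (Rmin_r d3 d4).
  pose proof (Rmin_l 1 (eps / (4 * A))). pose proof (Rmin_r 1 (eps / (4 * A))).
  specialize (H1' h ltac:(lra)). specialize (H2' h ltac:(lra)).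
  specialize (H4' (z + h)%C).
  replace (z + h - z)%C with h in H4' by ring. specialize (H4' ltac:(lra)).
  replace (f (z + h) * g (z + h) - f z * g z - (l * g z + f z * m) * h)%C
    with ((f (z + h) - f z - l * h) * g (z + h) + (l * h * (g (z + h) - g z)
          + f z * (g (z + h) - g z - m * h)))%C by ring.
  pose proof (Cmod_split (g (z + h)%C) (g z)).
  set (e := eps / (4 * A)) in *. set (x := Cmod h) in *.
  assert (Hx : 0 <= x) by apply Cmod_ge_0.
  assert (HeA : e * A = eps / 4) by (unfold e; field; lra).
  assert (He0 : 0 < e) by (unfold e; apply Rdiv_lt_0_compat; lra).
  eapply Rle_trans. apply Cmod_triangle.
  eapply Rle_trans. apply Rplus_le_compat_l. apply Cmod_triangle.
  rewrite !Cmod_mult. fold x.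
  assert (B1 : Cmod (f (z + h) - f z - l * h)%C * Cmod (g (z + h)%C) <= (e * x) * A).
  { apply Rmult_le_compat; try apply Cmod_ge_0; auto. unfold A. lra. }
  assert (B2 : Cmod l * x * Cmod (g (z + h) - g z)%C <= A * x * e).
  { apply Rmult_le_compat; try apply Cmod_ge_0; try lra.
    apply Rmult_le_pos; lra. apply Rmult_le_compat_r; unfold A; lra. }
  assert (B3 : Cmod (f z) * Cmod (g (z + h) - g z - m * h)%C <= A * (e * x)).
  { apply Rmult_le_compat; try apply Cmod_ge_0; auto. unfold A. lra. }
  assert (e * A * x = eps / 4 * x) by (rewrite HeA; ring).
  assert (0 <= eps * x) by (apply Rmult_le_pos; lra).
  nra.
Qed.

Lemma cderiv_scal c f z l : cderiv f z l -> cderiv (fun z => c * f z)%C z (c * l)%C.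
Proof.
  intros H. pose proof (cderiv_mult (fun _ => c) f z 0%C l (cderiv_const c z) H).
  replace (c * l)%C with (0 * f z + c * l)%C by ring. exact H0.
Qed.

Lemma cderiv_minus f g z l m : cderiv f z l -> cderiv g z m -> cderiv (fun z => f z - g z)%C z (l - m)%C.
Proof.
  intros Hf Hg. replace (l - m)%C with (l + (-(1)) * m)%C by ring.
  apply (cderiv_ext (fun z => f z + (-(1)) * g z)%C). intros; ring.
  apply cderiv_plus; auto. apply (cderiv_scal (-(1))%C). auto.
Qed.

Lemma cderiv_comp_affine f (a b : C) z l :
  cderiv f (a * z + b)%C l -> cderiv (fun z => f (a * z + b)%C) z (a * l)%C.
Proof.
  intros H eps He. pose proof (Cmod_ge_0 a).
  destruct (H (eps / (Cmod a + 1)) ltac:(apply Rdiv_lt_0_compat; lra)) as [d [Hd Hf]].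
  exists (d / (Cmod a + 1)). split. apply Rdiv_lt_0_compat; lra.
  intros h Hh.
  assert (Hb : Cmod a * Cmod h <= (Cmod a + 1) * Cmod h).
  { apply Rmult_le_compat_r. apply Cmod_ge_0. lra. }
  assert ((Cmod a + 1) * Cmod h < d).
  { replace d with ((Cmod a + 1) * (d / (Cmod a + 1))) by (field; lra).
    apply Rmult_lt_compat_l; lra. }
  specialize (Hf (a * h)%C). rewrite Cmod_mult in Hf. specialize (Hf ltac:(lra)).
  replace (a * (z + h) + b)%C with (a * z + b + a * h)%C by ring.
  replace (a * l * h)%C with (l * (a * h))%C by ring.
  eapply Rle_trans. apply Hf.
  replace (eps * Cmod h) with (eps / (Cmod a + 1) * ((Cmod a + 1) * Cmod h)) by (field; lra).
  apply Rmult_le_compat_l; auto. apply Rlt_le, Rdiv_lt_0_compat; lra.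
Qed.

Lemma cderiv_shift f b z l : cderiv f (z + b)%C l -> cderiv (fun z => f (z + b)%C) z l.
Proof.
  intros H. replace l with (1 * l)%C by ring.
  apply (cderiv_ext (fun z => f (1 * z + b)%C)). intros; f_equal; ring.
  apply cderiv_comp_affine. replace (1 * z + b)%C with (z + b)%C by ring. auto.
Qed.

Lemma cderiv_unique f z l m : cderiv f z l -> cderiv f z m -> l = m.
Proof.
  intros Hl Hm. apply Ceq_minus. apply Cmod_eq_0.
  destruct (Rle_lt_or_eq_dec 0 (Cmod (l - m)) (Cmod_ge_0 _)) as [Hp|]; auto.
  exfalso.
  destruct (Hl (Cmod (l - m) / 4) ltac:(lra)) as [d1 [Hd1 H1]].
  destruct (Hm (Cmod (l - m) / 4) ltac:(lra)) as [d2 [Hd2 H2]].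
  set (r := Rmin d1 d2 / 2).
  assert (Hr : 0 < r) by (unfold r; pose proof (Rmin_pos d1 d2 Hd1 Hd2); lra).
  assert (Hc : Cmod (RtoC r) = r) by (rewrite Cmod_R; apply Rabs_pos_eq; lra).
  pose proof (Rmin_l d1 d2). pose proof (Rmin_r d1 d2).
  specialize (H1 (RtoC r) ltac:(rewrite Hc; unfold r in *; lra)).
  specialize (H2 (RtoC r) ltac:(rewrite Hc; unfold r in *; lra)).
  rewrite Hc in *.
  pose proof (Cmod_triangle (f (z + r) - f z - m * r)%C (-(f (z + r) - f z - l * r))%C).
  rewrite Cmod_opp in H3.
  replace ((f (z + r) - f z - m * r) + - (f (z + r) - f z - l * r))%C
    with ((l - m) * r)%C in H3 by ring.
  rewrite Cmod_mult, Hc in H3. nra.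
Qed.

(** Connects the increment form with [C_derive], through which [wp'] is defined. *)
Lemma cderiv_C_derive f z l : cderiv f z l -> C_derive f z = l.
Proof.
  intros H. unfold C_derive. apply is_C_lim_unique.
  apply filterlim_locally. intros eps.
  destruct (H (eps / 2) ltac:(pose proof (cond_pos eps); lra)) as [d [Hd Hf]].
  assert (Q : forall y : C, Cmod (y - z)%C < d -> y <> z ->
    Cmod ((f y - f z) / (y - z) - l)%C < eps).
  { intros y Hb Hyz.
    specialize (Hf (y - z)%C Hb). replace (z + (y - z))%C with y in Hf by ring.
    assert (Hn : (y - z)%C <> 0%C) by (intros E; apply Hyz; apply Ceq_minus; auto).
    replace ((f y - f z) / (y - z) - l)%C with ((f y - f z - l * (y - z)) / (y - z))%C
      by (field; auto).
    rewrite Cmod_div by auto. apply Cmod_gt_0 in Hn.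
    apply Rle_lt_trans with (eps / 2); [|pose proof (cond_pos eps); lra].
    apply Rle_div_l; lra. }
  (* A ball of the product structure on C is a square; its points have modulus below sqrt 2 times
     the radius, hence the halving. *)
  exists (mkposreal (d / 2) ltac:(lra)).
  intros y Hy Hyz. apply C_NormedModule_mixin_compat1. apply Q; [|exact Hyz].
  pose proof (C_NormedModule_mixin_compat2 z y (mkposreal (d / 2) ltac:(lra)) Hy) as H0.
  simpl in H0. eapply Rlt_le_trans. apply H0.
  pose proof (Rlt_sqrt2_0). assert (sqrt 2 <= 2).
  { rewrite <- (sqrt_square 2) at 2 by lra. apply sqrt_le_1_alt. lra. }
  nra.
Qed.

(** * Derivatives along real curves and mean value estimates *)

Definition path_deriv (g : R -> C) (t : R) (l : C) : Prop :=
  forall eps, 0 < eps -> exists del, 0 < del /\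
    forall h : R, Rabs h < del -> Cmod (g (t + h)%R - g t - l * h)%C <= eps * Rabs h.

Lemma is_derive_eps (f : R -> R) t l :
  is_derive f t l <->
  forall eps, 0 < eps -> exists del, 0 < del /\
    forall h : R, Rabs h < del -> Rabs (f (t + h) - f t - l * h) <= eps * Rabs h.
Proof.
  rewrite is_derive_Reals. split.
  - intros H eps He. destruct (H eps He) as [d Hd]. exists d. split. apply cond_pos.
    intros h Hh. destruct (Req_dec h 0) as [->|Hn].
    + rewrite Rplus_0_r. replace (f t - f t - l * 0) with 0 by ring.
      rewrite Rabs_R0. lra.
    + specialize (Hd h Hn Hh).
      replace (f (t + h) - f t - l * h) with (((f (t + h) - f t) / h - l) * h) by (field; auto).
      rewrite Rabs_mult. apply Rmult_le_compat_r. apply Rabs_pos. lra.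
  - intros H eps He. destruct (H (eps / 2) ltac:(lra)) as [d [Hd Hf]].
    exists (mkposreal d Hd). intros h Hn Hh. simpl in Hh. specialize (Hf h Hh).
    replace ((f (t + h) - f t) / h - l) with ((f (t + h) - f t - l * h) / h) by (field; auto).
    unfold Rdiv. rewrite Rabs_mult, Rabs_inv.
    apply Rle_lt_trans with (eps / 2); [|lra].
    apply Rle_div_l; auto. apply Rabs_pos_lt; auto.
Qed.

Lemma path_deriv_Re g t l : path_deriv g t l -> is_derive (fun t => Re (g t)) t (Re l).
Proof.
  intros H. apply is_derive_eps. intros eps He. destruct (H eps He) as [d [Hd Hg]].
  exists d. split; auto. intros h Hh. specialize (Hg h Hh).
  eapply Rle_trans; [|apply Hg]. eapply Rle_trans; [|apply re_le_Cmod].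
  right. f_equal. unfold Cminus. rewrite !re_plus, !re_opp, re_scal_r. ring.
Qed.

Lemma path_deriv_Im g t l : path_deriv g t l -> is_derive (fun t => Im (g t)) t (Im l).
Proof.
  intros H. apply is_derive_eps. intros eps He. destruct (H eps He) as [d [Hd Hg]].
  exists d. split; auto. intros h Hh. specialize (Hg h Hh).
  eapply Rle_trans; [|apply Hg]. eapply Rle_trans; [|apply im_le_Cmod].
  right. f_equal. unfold Cminus. rewrite !im_plus, !im_opp, im_scal_r. ring.
Qed.

Lemma path_deriv_of_components (x y : R -> R) t x' y' :
  is_derive x t x' -> is_derive y t y' -> path_deriv (fun t => (x t, y t) : C) t (x', y').
Proof.
  intros Hx Hy eps He. rewrite is_derive_eps in Hx, Hy.
  destruct (Hx (eps / 2) ltac:(lra)) as [d1 [Hd1 H1]].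
  destruct (Hy (eps / 2) ltac:(lra)) as [d2 [Hd2 H2]].
  exists (Rmin d1 d2). split. apply Rmin_pos; auto.
  intros h Hh. pose proof (Rmin_l d1 d2). pose proof (Rmin_r d1 d2).
  specialize (H1 h ltac:(lra)). specialize (H2 h ltac:(lra)).
  eapply Rle_trans. apply Cmod_le_Re_Im.
  unfold Cminus. rewrite !re_plus, !im_plus, !re_opp, !im_opp, re_scal_r, im_scal_r.
  simpl. unfold Rminus in H1, H2. lra.
Qed.

Lemma path_deriv_line (z d : C) t : path_deriv (fun t : R => z + t * d)%C t d.
Proof.
  intros eps He. exists 1. split. lra. intros h _.
  rewrite RtoC_plus.
  replace (z + (t + h) * d - (z + t * d) - d * h)%C with (RtoC 0) by ring.
  rewrite Cmod_0. apply Rmult_le_pos. lra. apply Rabs_pos.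
Qed.

Lemma path_deriv_comp f (g : R -> C) t l d :
  cderiv f (g t) l -> path_deriv g t d -> path_deriv (fun t => f (g t)) t (l * d)%C.
Proof.
  intros Hf Hg eps He.
  pose proof (Cmod_ge_0 l). pose proof (Cmod_ge_0 d).
  set (D := Cmod d + 1).
  destruct (Hf (eps / (2 * D)) ltac:(apply Rdiv_lt_0_compat; unfold D; lra)) as [d1 [Hd1 H1]].
  destruct (Hg (Rmin 1 (eps / (2 * (Cmod l + 1))))) as [d2 [Hd2 H2]].
  { apply Rmin_pos. lra. apply Rdiv_lt_0_compat; lra. }
  exists (Rmin (d1 / D) d2). split.
  { apply Rmin_pos; auto. apply Rdiv_lt_0_compat; unfold D; lra. }
  intros h Hh. pose proof (Rmin_l (d1 / D) d2). pose proof (Rmin_r (d1 / D) d2).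
  specialize (H2 h ltac:(lra)).
  set (e2 := Rmin 1 (eps / (2 * (Cmod l + 1)))) in *.
  assert (He2 : e2 <= 1) by apply Rmin_l.
  assert (He2' : e2 <= eps / (2 * (Cmod l + 1))) by apply Rmin_r.
  set (k := (g (t + h)%R - g t)%C) in *.
  pose proof (Rabs_pos h).
  assert (Hk : Cmod k <= D * Rabs h).
  { pose proof (Cmod_split k (d * h)%C). rewrite Cmod_mult, Cmod_R in H6. unfold D. nra. }
  assert (HD : 0 < D) by (unfold D; lra).
  assert (Hk1 : Cmod k < d1).
  { eapply Rle_lt_trans. apply Hk. replace d1 with (D * (d1 / D)) by (field; lra).
    apply Rmult_lt_compat_l; lra. }
  specialize (H1 k Hk1).
  replace (g t + k)%C with (g (t + h)) in H1 by (unfold k; ring).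
  replace (f (g (t + h)%R) - f (g t) - l * d * h)%C
    with ((f (g (t + h)%R) - f (g t) - l * k) + l * (k - d * h))%C by ring.
  eapply Rle_trans. apply Cmod_triangle. rewrite Cmod_mult.
  assert (B1 : eps / (2 * D) * Cmod k <= eps / 2 * Rabs h).
  { replace (eps / 2 * Rabs h) with (eps / (2 * D) * (D * Rabs h)) by (field; lra).
    apply Rmult_le_compat_l; auto. apply Rlt_le, Rdiv_lt_0_compat; lra. }
  assert (B2 : Cmod l * Cmod (k - d * h) <= eps / 2 * Rabs h).
  { apply Rle_trans with (Cmod l * (e2 * Rabs h)).
    apply Rmult_le_compat_l; auto.
    rewrite <- Rmult_assoc. apply Rmult_le_compat_r; auto.
    apply Rle_trans with ((Cmod l + 1) * (eps / (2 * (Cmod l + 1)))).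
    - apply Rmult_le_compat; try lra. unfold e2. apply Rmin_glb. lra.
      apply Rlt_le, Rdiv_lt_0_compat; lra.
    - right. field. lra. }
  lra.
Qed.

Lemma mean_value_Re f f' (z d : C) :
  (forall t : R, 0 <= t <= 1 -> cderiv f (z + t * d)%C (f' (z + t * d)%C)) ->
  exists t : R, 0 <= t <= 1 /\ Re (f (z + d)%C) - Re (f z) = Re (f' (z + t * d)%C * d)%C.
Proof.
  intros H.
  destruct (MVT_gen (fun t : R => Re (f (z + t * d)%C)) 0 1
             (fun t : R => Re (f' (z + t * d)%C * d)%C)) as [c [Hc Ec]].
  - rewrite Rmin_left, Rmax_right by lra. intros x Hx.
    apply (path_deriv_Re (fun t : R => f (z + t * d)%C)).
    apply path_deriv_comp. apply H; lra. apply path_deriv_line.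
  - rewrite Rmin_left, Rmax_right by lra. intros x Hx.
    apply continuity_pt_filterlim. 
    apply (ex_derive_continuous (fun t : R => Re (f (z + t * d)%C))).
    eexists. apply (path_deriv_Re (fun t : R => f (z + t * d)%C)).
    apply path_deriv_comp. apply H; lra. apply path_deriv_line.
  - rewrite Rmin_left, Rmax_right in Hc by lra. exists c. split; auto.
    replace (z + 1%R * d)%C with (z + d)%C in Ec by ring.
    replace (z + 0%R * d)%C with z in Ec by ring. lra.
Qed.

(* The factor 2 comes from applying the real mean value theorem to [Re f] and [Im f] separately. *)
Lemma mean_value_bound f f' (z d : C) K :
  (forall t : R, 0 <= t <= 1 -> cderiv f (z + t * d)%C (f' (z + t * d)%C) /\
     Cmod (f' (z + t * d)%C) <= K) ->
  Cmod (f (z + d) - f z)%C <= 2 * K * Cmod d.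
Proof.
  intros H.
  destruct (mean_value_Re f f' z d) as [t [Ht E]]. intros; apply H; auto.
  destruct (mean_value_Re (fun z => (- Ci) * f z)%C (fun z => (- Ci) * f' z)%C z d)
    as [s [Hs Es]].
  { intros. apply cderiv_scal. apply H; auto. }
  eapply Rle_trans. apply Cmod_le_Re_Im.
  replace (Im (f (z + d) - f z)%C) with (Re (- Ci * f (z + d)%C)%C - Re (- Ci * f z)%C)
    by (unfold Cminus; rewrite im_plus, im_opp, !re_mult; simpl; ring).
  rewrite Es. unfold Cminus at 1. rewrite re_plus, re_opp. unfold Rminus in E. rewrite E.
  pose proof (proj2 (H t Ht)). pose proof (proj2 (H s Hs)).
  pose proof (re_le_Cmod (f' (z + t * d) * d)%C).
  pose proof (re_le_Cmod (- Ci * f' (z + s * d) * d)%C).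
  rewrite !Cmod_mult in *. rewrite Cmod_opp, Cmod_Ci in H3.
  pose proof (Cmod_ge_0 d). nra.
Qed.

Lemma segment_const f (z d : C) :
  (forall t : R, 0 <= t <= 1 -> cderiv f (z + t * d)%C 0%C) -> f (z + d)%C = f z.
Proof.
  intros H. apply Ceq_minus. apply Cmod_eq_0. apply Rle_antisym; [|apply Cmod_ge_0].
  eapply Rle_trans. apply (mean_value_bound f (fun _ => 0%C) z d 0).
  - intros t Ht. split. apply H; auto. rewrite Cmod_0; lra.
  - right; ring.
Qed.

(** Two rounds of [mean_value_bound], first for [f1] and then for [f]. Divided by z^2, the estimate
    gives the limit of a double zero against the double pole of wp, which is how singularities at
    lattice points are resolved. *)
Lemma taylor2 f f1 f2 r :
  0 < r -> (forall z, Cmod z < r -> cderiv f z (f1 z) /\ cderiv f1 z (f2 z)) -> ccontinuous f2 0%C ->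
  f 0%C = 0%C -> f1 0%C = 0%C ->
  forall eps, 0 < eps -> exists del, 0 < del /\ forall z, Cmod z < del ->
    Cmod (f z - f2 0 / 2 * z ^ 2)%C <= eps * Cmod z ^ 2.
Proof.
  intros Hr H Hc F0 F1 eps He.
  (* Each round costs a factor 2: eps / 4 for [f2] becomes eps / 2 for [f1] and eps for [f]. *)
  destruct (Hc (eps / 4) ltac:(lra)) as [d [Hd Hc']].
  exists (Rmin d r). split. apply Rmin_pos; auto.
  pose proof (Rmin_l d r). pose proof (Rmin_r d r).
  assert (Hseg : forall (t : R) z, 0 <= t <= 1 -> Cmod z < Rmin d r ->
     Cmod (0 + t * z)%C <= Cmod z).
  { intros t z Ht Hz. rewrite Cplus_0_l, Cmod_mult, Cmod_R, Rabs_pos_eq by lra.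
    pose proof (Cmod_ge_0 z). nra. }
  assert (G1 : forall z, Cmod z < Rmin d r -> Cmod (f1 z - f2 0 * z)%C <= eps / 2 * Cmod z).
  { intros z Hz.
    pose proof (mean_value_bound (fun z => f1 z - f2 0 * z)%C (fun z => f2 z - f2 0 * 1)%C 0 z (eps / 4)).
    rewrite Cplus_0_l, F1 in H2.
    replace (f1 z - f2 0 * z - (0 - f2 0 * 0))%C with (f1 z - f2 0 * z)%C in H2 by ring.
    replace (eps / 2) with (2 * (eps / 4)) by lra. apply H2.
    intros t Ht. specialize (Hseg t z Ht Hz). split.
    - apply cderiv_minus. apply H; lra. apply cderiv_scal, cderiv_id.
    - rewrite Cmult_1_r. apply Rlt_le, Hc'.
      replace (0 + t * z - 0)%C with (0 + t * z)%C by ring. lra. }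
  intros z Hz.
  pose proof (mean_value_bound (fun z => f z - f2 0 / 2 * (z * z))%C
     (fun z => f1 z - f2 0 / 2 * (1 * z + z * 1))%C 0 z (eps / 2 * Cmod z)).
  rewrite Cplus_0_l, F0 in H2.
  replace (f z - f2 0 / 2 * (z * z) - (0 - f2 0 / 2 * (0 * 0)))%C
    with (f z - f2 0 / 2 * z ^ 2)%C in H2 by (simpl; ring).
  replace (eps * Cmod z ^ 2) with (2 * (eps / 2 * Cmod z) * Cmod z) by (simpl; lra).
  apply H2. intros t Ht. specialize (Hseg t z Ht Hz). split.
  - apply cderiv_minus. apply H; lra. apply cderiv_scal. apply (cderiv_mult (fun z => z) (fun z => z)); apply cderiv_id.
  - replace (f2 0 / 2 * (1 * (0 + t * z) + (0 + t * z) * 1))%C with (f2 0 * (0 + t * z))%C.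
    2:{ field. }
    eapply Rle_trans. apply G1. lra. apply Rmult_le_compat_l; lra.
Qed.

(** * Differentiation under the integral sign and means over circles *)

Lemma ccontinuous_2d_Re f (x y : R -> R -> R) t s :
  ccontinuous f (x t s, y t s) -> continuity_2d_pt x t s -> continuity_2d_pt y t s ->
  continuity_2d_pt (fun t s => Re (f (x t s, y t s))) t s.
Proof.
  intros Hf Hx Hy eps. destruct (Hf eps (cond_pos eps)) as [d [Hd H]].
  destruct (Hx (mkposreal (d / 2) ltac:(lra))) as [d1 H1].
  destruct (Hy (mkposreal (d / 2) ltac:(lra))) as [d2 H2].
  simpl in *.
  exists (mkposreal (Rmin d1 d2) (Rmin_pos _ _ (cond_pos d1) (cond_pos d2))). simpl.
  intros u v Hu Hv. pose proof (Rmin_l d1 d2). pose proof (Rmin_r d1 d2).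
  eapply Rle_lt_trans; [|apply (H (x u v, y u v))].
  - eapply Rle_trans; [|apply re_le_Cmod]. unfold Cminus. rewrite re_plus, re_opp. right; reflexivity.
  - eapply Rle_lt_trans. apply Cmod_le_Re_Im.
    specialize (H1 u v ltac:(lra) ltac:(lra)). specialize (H2 u v ltac:(lra) ltac:(lra)).
    unfold Cminus. simpl. unfold Rminus in *. lra.
Qed.

Lemma ccontinuous_scal c f z : ccontinuous f z -> ccontinuous (fun z => c * f z)%C z.
Proof.
  intros H eps He. pose proof (Cmod_ge_0 c).
  destruct (H (eps / (Cmod c + 1)) ltac:(apply Rdiv_lt_0_compat; lra)) as [d [Hd Hf]].
  exists d. split; auto. intros z' Hz. specialize (Hf z' Hz).
  replace (c * f z' - c * f z)%C with (c * (f z' - f z))%C by ring. rewrite Cmod_mult.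
  apply Rle_lt_trans with ((Cmod c + 1) * Cmod (f z' - f z)%C).
  apply Rmult_le_compat_r. apply Cmod_ge_0. lra.
  replace eps with ((Cmod c + 1) * (eps / (Cmod c + 1))) by (field; lra).
  apply Rmult_lt_compat_l; lra.
Qed.

Lemma Im_as_Re z : Im z = Re (- Ci * z)%C.
Proof. rewrite re_mult. simpl. ring. Qed.

Lemma ccontinuous_2d_Im f (x y : R -> R -> R) t s :
  ccontinuous f (x t s, y t s) -> continuity_2d_pt x t s -> continuity_2d_pt y t s ->
  continuity_2d_pt (fun t s => Im (f (x t s, y t s))) t s.
Proof.
  intros Hf Hx Hy. apply (continuity_2d_pt_ext (fun t s => Re ((fun z => - Ci * f z)%C (x t s, y t s)))).
  intros. symmetry. apply Im_as_Re.
  apply (ccontinuous_2d_Re (fun z => - Ci * f z)%C); auto. apply ccontinuous_scal; auto.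
Qed.

Lemma continuity_2d_slice (g : R -> R -> R) t s :
  continuity_2d_pt g t s -> continuous (g t) s.
Proof.
  intros H. apply filterlim_locally. intros eps. destruct (H eps) as [d Hd].
  exists d. intros y Hy. apply Hd; auto.
  replace (t - t) with 0 by ring. rewrite Rabs_R0. apply cond_pos.
Qed.

(** Serves two deformations: circles of growing radius in [circle_mean] and translated lines in
    [zeta_line_integral]. The pair [(xt, yt)] is the velocity of the moving point, and the curves
    with [t] near [t0] have to stay in the region [D] of holomorphy. *)
Lemma is_derive_RInt_holomorphic f f' (D : C -> Prop) (x y xt yt : R -> R -> R) (a b t0 : R) :
  (forall z, D z -> cderiv f z (f' z) /\ ccontinuous f' z) ->
  (forall t s, continuity_2d_pt x t s) -> (forall t s, continuity_2d_pt y t s) ->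
  (forall t s, continuity_2d_pt xt t s) -> (forall t s, continuity_2d_pt yt t s) ->
  (forall t s, is_derive (fun t => x t s) t (xt t s)) ->
  (forall t s, is_derive (fun t => y t s) t (yt t s)) ->
  (exists d, 0 < d /\ forall t s, Rabs (t - t0) < d -> D (x t s, y t s)) ->
  is_derive (fun t => RInt (fun s => Re (f (x t s, y t s))) a b) t0
    (RInt (fun s => Re (f' (x t0 s, y t0 s) * (xt t0 s, yt t0 s))%C) a b).
Proof.
  intros HD Cx Cy Cxt Cyt Dx Dy [d [Hd HDd]].
  assert (Hder : forall t s, Rabs (t - t0) < d ->
    is_derive (fun t => Re (f (x t s, y t s))) t (Re (f' (x t s, y t s) * (xt t s, yt t s))%C)).
  { intros t s Ht. apply (path_deriv_Re (fun t => f (x t s, y t s))).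
    apply (path_deriv_comp f (fun t => (x t s, y t s))). apply HD; auto.
    apply path_deriv_of_components; auto. }
  assert (Hloc : forall P : R -> Prop, (forall t, Rabs (t - t0) < d -> P t) -> locally t0 P).
  { intros P HP. exists (mkposreal d Hd). intros t Ht. apply HP. exact Ht. }
  assert (T0 : Rabs (t0 - t0) < d).
  { replace (t0 - t0) with 0 by ring. rewrite Rabs_R0. auto. }
  replace (RInt (fun s => Re (f' (x t0 s, y t0 s) * (xt t0 s, yt t0 s))%C) a b)
    with (RInt (fun s => Derive (fun t => Re (f (x t s, y t s))) t0) a b).
  2:{ apply RInt_ext. intros s _. apply is_derive_unique. apply Hder; auto. }
  apply (is_derive_RInt_param (fun t s => Re (f (x t s, y t s)))).
  - apply Hloc. intros t Ht s _. eexists. apply Hder; auto.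
  - intros s _.
    apply continuity_2d_pt_ext_loc with
      (fun t s => Re (f' (x t s, y t s) * (xt t s, yt t s))%C).
    + exists (mkposreal d Hd). intros u v Hu _. symmetry.
      apply is_derive_unique. apply Hder; auto.
    + apply (continuity_2d_pt_ext (fun t s =>
        Re (f' (x t s, y t s)) * xt t s - Im (f' (x t s, y t s)) * yt t s)).
      intros; rewrite re_mult; reflexivity.
      apply continuity_2d_pt_minus; apply continuity_2d_pt_mult; auto.
      apply ccontinuous_2d_Re; auto. apply HD; auto.
      apply ccontinuous_2d_Im; auto. apply HD; auto.
  - apply Hloc. intros t Ht. apply (ex_RInt_continuous (fun s => Re (f (x t s, y t s)))).
    intros s _. apply (continuity_2d_slice (fun t s => Re (f (x t s, y t s)))).
    apply ccontinuous_2d_Re; auto. destruct (HD _ (HDd t s Ht)) as [K _].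
    apply (cderiv_ccontinuous _ _ _ K).
Qed.

Lemma continuity_2d_snd_1d (h : R -> R) t s : continuity_pt h s ->
  continuity_2d_pt (fun _ s => h s) t s.
Proof. intros H. apply (continuity_1d_2d_pt_comp h (fun _ s => s)); auto. apply continuity_2d_pt_id2. Qed.

(** The circle is z + r c e^(i th). The complex factor [c] rotates it so that [r = 1] and angle 0
    give the point z + c, where [max_disc] needs the value. *)
Definition circ_x (z c : C) (r th : R) := Re z + r * (Re c * cos th - Im c * sin th).
Definition circ_y (z c : C) (r th : R) := Im z + r * (Re c * sin th + Im c * cos th).

Lemma circ_eq z c r th :
  ((circ_x z c r th, circ_y z c r th) : C) = (z + r * (c * (cos th, sin th)))%C.
Proof.
  destruct z, c. unfold circ_x, circ_y, RtoC, Cmult, Cplus, Re, Im. simpl. f_equal; ring.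
Qed.

Lemma Cmod_cos_sin th : Cmod (cos th, sin th) = 1.
Proof.
  unfold Cmod. simpl. rewrite !Rmult_1_r.
  pose proof (sin2_cos2 th). unfold Rsqr in H.
  replace (cos th * cos th + sin th * sin th) with 1 by lra. apply sqrt_1.
Qed.

(* In polar coordinates the Cauchy-Riemann equations read
   [r d/dr Re f = d/dtheta Im f], and the right side integrates to 0. *)
Lemma circle_mean f f' (z c : C) rho :
  (forall w, Cmod (w - z)%C < rho -> cderiv f w (f' w) /\ ccontinuous f' w) ->
  Cmod c < rho ->
  RInt (fun th => Re (f (z + c * (cos th, sin th))%C)) 0 (2 * PI) = 2 * PI * Re (f z).
Proof.
  intros Hf Hc.
  pose (D := fun w : C => Cmod (w - z) < rho).
  pose (xr := fun (r th : R) => Re c * cos th - Im c * sin th).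
  pose (yr := fun (r th : R) => Re c * sin th + Im c * cos th).
  assert (Ccos : forall t s, continuity_2d_pt (fun _ s : R => cos s) t s).
  { intros. apply continuity_2d_snd_1d. apply continuity_cos. }
  assert (Csin : forall t s, continuity_2d_pt (fun _ s : R => sin s) t s).
  { intros. apply continuity_2d_snd_1d. apply continuity_sin. }
  assert (Cxr : forall t s, continuity_2d_pt xr t s).
  { intros. unfold xr. apply continuity_2d_pt_minus; apply continuity_2d_pt_mult; auto;
    apply continuity_2d_pt_const. }
  assert (Cyr : forall t s, continuity_2d_pt yr t s).
  { intros. unfold yr. apply continuity_2d_pt_plus; apply continuity_2d_pt_mult; auto;
    apply continuity_2d_pt_const. }
  assert (Cx : forall t s, continuity_2d_pt (circ_x z c) t s).
  { intros. unfold circ_x. apply continuity_2d_pt_plus. apply continuity_2d_pt_const.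
    apply continuity_2d_pt_mult. apply continuity_2d_pt_id1. apply Cxr. }
  assert (Cy : forall t s, continuity_2d_pt (circ_y z c) t s).
  { intros. unfold circ_y. apply continuity_2d_pt_plus. apply continuity_2d_pt_const.
    apply continuity_2d_pt_mult. apply continuity_2d_pt_id1. apply Cyr. }
  assert (Hin : forall r th, Rabs r * Cmod c < rho -> D (circ_x z c r th, circ_y z c r th)).
  { intros r th Hr. unfold D. rewrite circ_eq.
    replace (z + r * (c * (cos th, sin th)) - z)%C with (r * (c * (cos th, sin th)))%C by ring.
    rewrite !Cmod_mult, Cmod_cos_sin, Cmod_R. lra. }
  assert (Hopen : forall r, 0 <= r <= 1 -> exists d, 0 < d /\
     forall t s, Rabs (t - r) < d -> D (circ_x z c t s, circ_y z c t s)).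
  { intros r Hr. pose proof (Cmod_ge_0 c).
    exists ((rho - Cmod c) / (Cmod c + 1)). split. apply Rdiv_lt_0_compat; lra.
    intros t s Ht. apply Hin.
    assert (Rabs t <= 1 + Rabs (t - r)).
    { replace t with (r + (t - r)) at 1 by ring. eapply Rle_trans. apply Rabs_triang.
      rewrite (Rabs_pos_eq r); lra. }
    assert (Rabs (t - r) * (Cmod c + 1) < rho - Cmod c).
    { apply Rlt_div_r; lra. }
    pose proof (Rabs_pos (t - r)). nra. }
  pose (M := fun r => RInt (fun th => Re (f (circ_x z c r th, circ_y z c r th))) 0 (2 * PI)).
  pose (M' := fun r => RInt (fun th => Re (f' (circ_x z c r th, circ_y z c r th)
       * (xr r th, yr r th))%C) 0 (2 * PI)).
  assert (HM : forall r, 0 <= r <= 1 -> is_derive M r (M' r)).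
  { intros r Hr. unfold M, M'.
    apply (is_derive_RInt_holomorphic f f' D (circ_x z c) (circ_y z c) xr yr); auto.
    - intros t s. unfold circ_x, xr. auto_derive; auto. ring.
    - intros t s. unfold circ_y, yr. auto_derive; auto. ring. }
  (* It is [r * g], not [g], that is the derivative of Im f along the circle, so the factor [r] is
     supplied first and has to be nonzero. *)
  assert (Z : forall r, 0 < r <= 1 -> M' r = 0).
  { intros r Hr. apply Rmult_eq_reg_l with r; [|lra]. rewrite Rmult_0_r.
    pose (g := fun th => Re (f' (circ_x z c r th, circ_y z c r th) * (xr r th, yr r th))%C).
    assert (Hcont : forall th, continuous g th).
    { intros th. apply (continuity_2d_slice (fun r th => Re (f' (circ_x z c r th, circ_y z c r th) * (xr r th, yr r th))%C)).
      destruct (Hopen r ltac:(lra)) as [d [Hd Hd']].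
      assert (HD : D (circ_x z c r th, circ_y z c r th)).
      { apply Hd'. replace (r - r) with 0 by ring. rewrite Rabs_R0; auto. }
      apply (continuity_2d_pt_ext (fun r th =>
        Re (f' (circ_x z c r th, circ_y z c r th)) * xr r th
         - Im (f' (circ_x z c r th, circ_y z c r th)) * yr r th)).
      intros; rewrite re_mult; reflexivity.
      apply continuity_2d_pt_minus; apply continuity_2d_pt_mult; auto.
      apply ccontinuous_2d_Re; auto. apply Hf; auto.
      apply ccontinuous_2d_Im; auto. apply Hf; auto. }
    change (r * RInt g 0 (2 * PI) = 0).
    change (scal r (RInt g 0 (2 * PI)) = 0).
    rewrite <- (RInt_scal (V := R_CompleteNormedModule)).
    2:{ apply ex_RInt_continuous. intros; apply Hcont. }
    transitivity (minus (Im (f (circ_x z c r (2 * PI), circ_y z c r (2 * PI))))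
       (Im (f (circ_x z c r 0, circ_y z c r 0)))).
    2:{ unfold circ_x, circ_y. rewrite cos_2PI, sin_2PI, cos_0, sin_0.
        unfold minus, plus, opp. simpl. ring. }
    apply is_RInt_unique.
    apply (is_RInt_derive (fun th => Im (f (circ_x z c r th, circ_y z c r th))) (fun th => scal r (g th))).
    - intros th _.
      replace (scal r (g th)) with
        (Im (f' (circ_x z c r th, circ_y z c r th) * ((- r * yr r th)%R, (r * xr r th)%R))%C).
      2:{ unfold g, scal. simpl. unfold mult. simpl. ring. }
      apply (path_deriv_Im (fun th => f (circ_x z c r th, circ_y z c r th))).
      apply (path_deriv_comp f (fun th => (circ_x z c r th, circ_y z c r th))).
      + apply Hf. destruct (Hopen r ltac:(lra)) as [d [Hd Hd']]. apply Hd'.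
        replace (r - r) with 0 by ring. rewrite Rabs_R0; auto.
      + apply path_deriv_of_components.
        * unfold circ_x, yr. auto_derive; auto. ring.
        * unfold circ_y, xr. auto_derive; auto. ring.
    - intros th _. apply (continuous_scal_r r g). apply Hcont. }
  destruct (MVT_gen M 0 1 M') as [r [Hr E]].
  - rewrite Rmin_left, Rmax_right by lra. intros r Hr. apply HM. lra.
  - rewrite Rmin_left, Rmax_right by lra. intros r Hr. apply continuity_pt_filterlim.
    apply (ex_derive_continuous M). eexists. apply HM. lra.
  - rewrite Rmin_left, Rmax_right in Hr by lra.
    assert (E' : M 1 = M 0).
    (* The intermediate point of the mean value theorem may be 0, where the factor [r] cannot be
       cancelled. There the integrand is a combination of cos and sin, with the periodic primitive
       [h]. *)
    { destruct (Req_dec r 0) as [->|Hn].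
      - assert (EM : M' 0 = 0).
        { pose (h := fun th => Re (f' z * ((yr 0 th)%R, (- xr 0 th)%R))%C).
          pose (g := fun th => Re (f' z * ((xr 0 th)%R, (yr 0 th)%R))%C).
          transitivity (RInt g 0 (2 * PI)).
          { apply RInt_ext. intros th _. unfold circ_x, circ_y.
            rewrite !Rmult_0_l, !Rplus_0_r. destruct z; auto. }
          apply is_RInt_unique.
          replace 0 with (minus (h (2 * PI)) (h 0)) at 2.
          2:{ unfold h, xr, yr. rewrite cos_2PI, sin_2PI, cos_0, sin_0.
              unfold minus, plus, opp; simpl; ring. }
          apply (is_RInt_derive h).
          - intros th _. unfold h, g, xr, yr. simpl. auto_derive; auto. ring.
          - intros th _. apply (ex_derive_continuous g).
            unfold g, xr, yr. simpl. auto_derive. auto. }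
        rewrite EM in E. lra.
      - rewrite (Z r) in E by lra. lra. }
    transitivity (M 1).
    + apply RInt_ext. intros th _. rewrite circ_eq. do 2 f_equal.
      rewrite Cmult_1_l. reflexivity.
    + rewrite E'. unfold M.
      transitivity (RInt (fun _ => Re (f z)) 0 (2 * PI)).
      * apply RInt_ext. intros th _. unfold circ_x, circ_y. rewrite !Rmult_0_l, !Rplus_0_r.
        destruct z; auto.
      * rewrite RInt_const. unfold scal; simpl; unfold mult; simpl. ring.
Qed.

(** * Liouville's theorem on the torus *)

(** The value at the end [a] is the one wanted: on the circle used in [max_disc], angle 0 is the
    given point [w]. *)
Lemma RInt_nonneg_zero (f : R -> R) a b :
  a < b -> (forall x, continuous f x) -> (forall x, 0 <= f x) -> RInt f a b = 0 -> f a = 0.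
Proof.
  intros Hab Hc Hp HI. destruct (Rle_lt_or_eq_dec 0 (f a) (Hp a)) as [H|]; auto. exfalso.
  assert (H2 : 0 < f a / 2) by lra.
  assert (Hc' := Hc a). apply filterlim_locally with (eps := mkposreal (f a / 2) H2) in Hc'.
  destruct Hc' as [d Hd].
  set (m := Rmin (a + d / 2) b).
  assert (Hm : a < m) by (unfold m; apply Rmin_glb_lt; pose proof (cond_pos d); lra).
  assert (Hmb : m <= b) by apply Rmin_r.
  assert (Hmd : m <= a + d / 2) by apply Rmin_l.
  assert (Hex : forall u v, ex_RInt f u v).
  { intros u v. apply (ex_RInt_continuous (V := R_CompleteNormedModule)). intros; apply Hc. }
  rewrite <- (RInt_Chasles f a m b (Hex _ _) (Hex _ _)) in HI.
  assert (0 <= RInt f m b) by (apply RInt_ge_0; auto).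
  assert (RInt (fun _ => f a / 2) a m <= RInt f a m).
  { apply RInt_le; auto. lra. apply ex_RInt_const.
    intros x Hx. assert (Hb : ball (f a) (f a / 2) (f x)).
    { apply Hd. unfold ball; simpl; unfold AbsRing_ball, abs, minus, plus, opp; simpl.
      pose proof (cond_pos d). rewrite Rabs_pos_eq; lra. }
    unfold ball in Hb; simpl in Hb; unfold AbsRing_ball, abs, minus, plus, opp in Hb; simpl in Hb.
    apply Rabs_def2 in Hb. lra. }
  rewrite RInt_const in H1. unfold scal in H1; simpl in H1; unfold mult in H1; simpl in H1.
  unfold plus in HI; simpl in HI. nra.
Qed.

(** On the circle about [z] through [w] the function M - Re f is nonnegative, and the mean value
    property makes its integral 0. *)
Lemma max_disc f f' z M rho :
  (forall w, Cmod (w - z)%C < rho -> cderiv f w (f' w) /\ ccontinuous f' w) ->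
  (forall w, Re (f w) <= M) -> Re (f z) = M ->
  (forall w, ccontinuous f w) ->
  forall w, Cmod (w - z)%C < rho -> Re (f w) = M.
Proof.
  intros Hf HM Hz Hcont w Hw.
  pose (g := fun th => Re (f (z + (w - z) * (cos th, sin th))%C)).
  assert (Hg : forall th, continuous g th).
  { intros th. unfold g.
    apply (continuous_ext (fun th => Re (f (circ_x z (w - z) 1 th, circ_y z (w - z) 1 th)))).
    { intros s. rewrite circ_eq, Cmult_1_l. reflexivity. }
    apply (continuity_2d_slice (fun _ th => Re (f (circ_x z (w - z) 1 th, circ_y z (w - z) 1 th))) 0).
    apply ccontinuous_2d_Re; auto; apply continuity_2d_snd_1d; apply continuity_pt_filterlim;
    apply (ex_derive_continuous (V := R_NormedModule)); unfold circ_x, circ_y; auto_derive; auto. }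
  pose proof (circle_mean f f' z (w - z) rho Hf Hw) as E. fold g in E.
  assert (Z : (fun th => minus M (g th)) 0 = 0).
  { apply (RInt_nonneg_zero (fun th => minus M (g th)) 0 (2 * PI)).
    - pose proof PI_RGT_0. lra.
    - intros x. apply (continuous_minus (fun _ => M) g). apply continuous_const. apply Hg.
    - intros x. unfold minus, plus, opp; simpl. pose proof (HM (z + (w - z) * (cos x, sin x))%C).
      unfold g. lra.
    - rewrite (RInt_minus (fun _ => M) g).
      + rewrite RInt_const. change (fun y : R => g y) with g. 
        change (RInt (V := R_CompleteNormedModule) g 0 (2 * PI)) with (RInt g 0 (2 * PI)).
        rewrite E, Hz. unfold minus, plus, opp, scal; simpl; unfold mult; simpl. ring.
      + apply ex_RInt_const.
      + apply (ex_RInt_continuous (V := R_CompleteNormedModule)). intros; apply Hg. }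
  unfold minus, plus, opp, g in Z; simpl in Z. rewrite cos_0, sin_0 in Z.
  replace (z + (w - z) * (1, 0))%C with w in Z by (change (1, 0) with (RtoC 1); ring).
  lra.
Qed.

Lemma periodic_Z {A} (h : R -> A) p : (forall x, h (x + p) = h x) ->
  forall (k : Z) x, h (x + IZR k * p) = h x.
Proof.
  intros H.
  assert (N : forall (n : nat) x, h (x + INR n * p) = h x).
  { induction n; intros x. simpl. f_equal; ring.
    rewrite S_INR. replace (x + (INR n + 1) * p) with ((x + INR n * p) + p) by ring.
    rewrite H. apply IHn. }
  intros k x. destruct (Z_le_gt_dec 0 k) as [Hk|Hk].
  - rewrite <- (Z2Nat.id k) by lia. rewrite <- INR_IZR_INZ. apply N.
  - rewrite <- (N (Z.to_nat (- k)) (x + IZR k * p)). f_equal.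
    rewrite INR_IZR_INZ, Z2Nat.id by lia. rewrite opp_IZR. ring.
Qed.

Lemma reduce_mod p x : 0 < p -> exists k : Z, 0 <= x + IZR k * p <= p.
Proof.
  intros Hp. exists (1 - up (x / p))%Z. destruct (archimed (x / p)) as [H1 H2].
  rewrite minus_IZR. set (u := IZR (up (x / p))) in *.
  assert (x = x / p * p) by (field; lra). set (y := x / p) in *. nra.
Qed.

(** Compactness of a period rectangle is used one variable at a time: the maximum over [y] depends
    continuously on [x], by uniform continuity of [g], and is then maximised over [x]. *)
Lemma periodic_max (g : R -> R -> R) p q : 0 < p -> 0 < q ->
  (forall x y, continuity_2d_pt g x y) ->
  (forall x y, g (x + p) y = g x y) -> (forall x y, g x (y + q) = g x y) ->
  exists x0 y0, forall x y, g x y <= g x0 y0.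
Proof.
  intros Hp Hq Hc Px Py.
  assert (Hy : forall x, exists y, 0 <= y <= q /\ forall y', 0 <= y' <= q -> g x y' <= g x y).
  { intros x. destruct (continuity_ab_maj (g x) 0 q) as [y [H1 H2]]. lra.
    - intros y _. apply continuity_pt_filterlim. apply (continuity_2d_slice g x y). auto.
    - exists y. split; auto. }
  (* [Y] merely chooses a maximiser for each [x] and may jump; only the maximal value [m] is
     continuous. *)
  pose (Y := fun x => proj1_sig (constructive_indefinite_description _ (Hy x))).
  assert (HY : forall x, 0 <= Y x <= q /\ forall y', 0 <= y' <= q -> g x y' <= g x (Y x)).
  { intros x. unfold Y. apply proj2_sig. }
  pose (m := fun x => g x (Y x)).
  assert (Cm : forall x, 0 <= x <= p -> continuity_pt m x).
  { intros x Hx. apply continuity_pt_filterlim. apply filterlim_locally. intros eps.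
    destruct (uniform_continuity_2d g (-1) (p + 1) 0 q (fun x y _ _ => Hc x y) eps) as [d Hd].
    exists (mkposreal (Rmin d 1) (Rmin_pos _ _ (cond_pos d) Rlt_0_1)).
    intros x' Hx'. unfold ball in Hx'; simpl in Hx'; unfold AbsRing_ball, abs, minus, plus, opp in Hx'; simpl in Hx'.
    pose proof (Rmin_l d 1). pose proof (Rmin_r d 1).
    assert (Hb := Rabs_def2 _ _ Hx').
    assert (K : forall y, 0 <= y <= q -> Rabs (g x' y - g x y) < eps).
    { intros y Hy0. apply Hd; try lra. unfold Rminus. lra.
      replace (y - y) with 0 by ring. rewrite Rabs_R0. apply cond_pos. }
    unfold ball; simpl; unfold AbsRing_ball, abs, minus, plus, opp; simpl.
    destruct (HY x) as [A1 A2]. destruct (HY x') as [B1 B2].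
    pose proof (Rabs_def2 _ _ (K _ A1)). pose proof (Rabs_def2 _ _ (K _ B1)).
    pose proof (A2 _ B1). pose proof (B2 _ A1). unfold m. apply Rabs_def1; lra. }
  destruct (continuity_ab_maj m 0 p) as [x0 [H1 H2]]. lra. auto.
  exists x0, (Y x0). intros x y.
  destruct (reduce_mod p x Hp) as [k Hk]. destruct (reduce_mod q y Hq) as [l Hl].
  rewrite <- (periodic_Z (fun x => g x y) p (fun x => Px x y) k x).
  rewrite <- (periodic_Z (g (x + IZR k * p)) q (Py _) l y).
  eapply Rle_trans. apply HY; auto. apply H1; auto.
Qed.

Lemma liouville_torus_Re (p q : R) (F f' : C -> C) (S : C -> Prop) :
  0 < p -> 0 < q ->
  (forall z, ccontinuous F z) ->
  (forall z, F (z + p)%C = F z) -> (forall z, F (z + q * Ci)%C = F z) ->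
  (forall z, ~ S z -> cderiv F z (f' z) /\ ccontinuous f' z) ->
  (forall z, S z -> F z = 0%C) -> (exists z, S z) ->
  (forall z, ~ S z -> exists d, 0 < d /\ forall z', Cmod (z' - z)%C < d -> ~ S z') ->
  forall z, Re (F z) <= 0.
Proof.
  intros Hp Hq Hc Px Py Hf HS0 [s0 Hs0] HSc.
  destruct (periodic_max (fun x y => Re (F (x, y))) p q Hp Hq) as [x0 [y0 Hmax]].
  { intros x y. apply (ccontinuous_2d_Re F (fun x _ => x) (fun _ y => y)). apply Hc.
    apply continuity_2d_pt_id1. apply continuity_2d_pt_id2. }
  { intros x y. rewrite <- (Px (x, y)). do 2 f_equal. unfold Cplus, RtoC; simpl. f_equal; ring. }
  { intros x y. rewrite <- (Py (x, y)). do 2 f_equal. unfold Cplus, Cmult, RtoC, Ci; simpl. f_equal; ring. }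
  set (z0 := (x0, y0) : C) in *. set (M := Re (F z0)) in *.
  assert (HM : forall w, Re (F w) <= M) by (intros [x y]; apply Hmax).
  intros z. apply Rle_trans with M; auto.
  destruct (Rle_lt_dec M 0) as [|HMp]; auto. exfalso.
  pose (zt := fun t : R => (z0 + t * (s0 - z0))%C).
  pose (g := fun t => Re (F (zt t))).
  assert (Cg : forall t eps, 0 < eps -> exists d, 0 < d /\ forall t', Rabs (t' - t) < d -> Rabs (g t' - g t) < eps).
  { intros t eps He. destruct (Hc (zt t) eps He) as [d [Hd H]].
    pose proof (Cmod_ge_0 (s0 - z0)%C).
    exists (d / (Cmod (s0 - z0)%C + 1)). split. apply Rdiv_lt_0_compat; lra.
    intros t' Ht'. eapply Rle_lt_trans; [|apply (H (zt t'))].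
    - eapply Rle_trans; [|apply re_le_Cmod]. unfold g, Cminus. rewrite re_plus, re_opp. right; reflexivity.
    - unfold zt. replace (z0 + t' * (s0 - z0) - (z0 + t * (s0 - z0)))%C
        with (RtoC (t' - t) * (s0 - z0))%C by (rewrite RtoC_minus; ring).
      rewrite Cmod_mult, Cmod_R. apply Rlt_div_r in Ht'; [|lra].
      pose proof (Rabs_pos (t' - t)). nra. }
  (* The supremum [ts] of [A] belongs to [A] by continuity and lies off [S]; a disc around [zt ts]
     on which the real part stays [M] then produces a later element of [A]. *)
  pose (A := fun t => 0 <= t <= 1 /\ g t = M).
  destruct (completeness A) as [ts [Hub Hlub]].
  { exists 1. intros t [Ht _]. lra. }
  { exists 0. split. lra. unfold g, zt. replace (z0 + 0%R * (s0 - z0))%C with z0 by ring. reflexivity. }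
  assert (Hts : 0 <= ts <= 1).
  { split. apply Hub. split. lra. unfold g, zt. replace (z0 + 0%R * (s0 - z0))%C with z0 by ring. reflexivity.
    apply Hlub. intros t [Ht _]; lra. }
  assert (Hgts : g ts = M).
  { destruct (Rle_lt_or_eq_dec (g ts) M (HM _)) as [Hlt|]; auto. exfalso.
    destruct (Cg ts (M - g ts) ltac:(lra)) as [d [Hd H]].
    assert (ts <= ts - d / 2); [|lra]. apply Hlub. intros t Ht.
    destruct (Rle_lt_dec t (ts - d / 2)) as [|Hlt']; auto. exfalso.
    pose proof (Hub t Ht). destruct Ht as [_ Ht].
    specialize (H t ltac:(apply Rabs_def1; lra)). apply Rabs_def2 in H. lra. }
  assert (Hns : ~ S (zt ts)).
  { intros HS. apply HS0 in HS. unfold g in Hgts. rewrite HS in Hgts. simpl in Hgts. lra. }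
  assert (Hlt1 : ts < 1).
  { destruct (Req_dec ts 1) as [->|]; [|lra]. exfalso. apply Hns. unfold zt.
    replace (z0 + 1%R * (s0 - z0))%C with s0 by ring. auto. }
  destruct (HSc _ Hns) as [d [Hd HSd]].
  pose proof (Cmod_ge_0 (s0 - z0)%C).
  set (t' := ts + Rmin (1 - ts) (d / (2 * (Cmod (s0 - z0)%C + 1)))).
  assert (Hpos : 0 < d / (2 * (Cmod (s0 - z0)%C + 1))) by (apply Rdiv_lt_0_compat; lra).
  pose proof (Rmin_l (1 - ts) (d / (2 * (Cmod (s0 - z0)%C + 1)))).
  pose proof (Rmin_r (1 - ts) (d / (2 * (Cmod (s0 - z0)%C + 1)))).
  pose proof (Rmin_pos (1 - ts) _ ltac:(lra) Hpos).
  assert (A t').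
  { split. unfold t'; lra. unfold g.
    apply (max_disc F f' (zt ts) M d); auto.
    unfold zt. replace (z0 + t' * (s0 - z0) - (z0 + ts * (s0 - z0)))%C
        with (RtoC (t' - ts) * (s0 - z0))%C by (rewrite RtoC_minus; ring).
    rewrite Cmod_mult, Cmod_R. unfold t'.
    replace (ts + Rmin (1 - ts) (d / (2 * (Cmod (s0 - z0)%C + 1))) - ts) with (Rmin (1 - ts) (d / (2 * (Cmod (s0 - z0)%C + 1)))) by ring.
    rewrite Rabs_pos_eq by lra.
    apply Rle_lt_trans with (d / (2 * (Cmod (s0 - z0)%C + 1)) * (Cmod (s0 - z0)%C + 1)).
    - apply Rmult_le_compat; lra.
    - replace (d / (2 * (Cmod (s0 - z0)%C + 1)) * (Cmod (s0 - z0)%C + 1)) with (d / 2) by (field; lra). lra. }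
  pose proof (Hub t' H3). unfold t' in H4. lra.
Qed.

(* Removable singularities are avoided: extended by 0 to [S], [f] is continuous,
   and a positive maximum of [Re f] is taken off [S], where [f] is holomorphic;
   it would propagate along a segment up to a point of [S]. *)
Lemma liouville_torus (p q : R) (f f' f'' : C -> C) (S : C -> Prop) :
  0 < p -> 0 < q ->
  (forall z, S (z + p)%C <-> S z) -> (forall z, S (z + q * Ci)%C <-> S z) ->
  (forall z, ~ S z -> f (z + p)%C = f z) -> (forall z, ~ S z -> f (z + q * Ci)%C = f z) ->
  (forall z, ~ S z -> cderiv f z (f' z) /\ cderiv f' z (f'' z)) ->
  (exists z, S z) ->
  (forall z, ~ S z -> exists d, 0 < d /\ forall z', Cmod (z' - z)%C < d -> ~ S z') ->
  (forall s, S s -> forall eps, 0 < eps -> exists d, 0 < d /\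
     forall z, ~ S z -> Cmod (z - s)%C < d -> Cmod (f z) < eps) ->
  forall z, ~ S z -> f z = 0%C.
Proof.
  intros Hp Hq Sx Sy Px Py Hf Hne HSc Hlim z Hz.
  pose (F := fun z : C => if excluded_middle_informative (S z) then RtoC 0 else f z).
  assert (FS : forall z, S z -> F z = 0%C).
  { intros w Hw. unfold F. destruct excluded_middle_informative; tauto. }
  assert (Ff : forall z, ~ S z -> F z = f z).
  { intros w Hw. unfold F. destruct excluded_middle_informative; tauto. }
  assert (Fx : forall z, F (z + p)%C = F z).
  { intros w. destruct (classic (S w)) as [H|H]. rewrite !FS; auto. apply Sx; auto.
    rewrite !Ff; auto. rewrite Sx; auto. }
  assert (Fy : forall z, F (z + q * Ci)%C = F z).
  { intros w. destruct (classic (S w)) as [H|H]. rewrite !FS; auto. apply Sy; auto.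
    rewrite !Ff; auto. rewrite Sy; auto. }
  assert (Fd : forall z, ~ S z -> cderiv F z (f' z) /\ ccontinuous f' z).
  { intros w Hw. destruct (HSc w Hw) as [d [Hd HS]]. split.
    - apply (cderiv_ext_loc f F w _ d); auto. intros w' H'. symmetry. apply Ff. auto. apply Hf; auto.
    - apply (cderiv_ccontinuous _ _ (f'' w)). apply Hf; auto. }
  assert (Fc : forall z, ccontinuous F z).
  { intros w. destruct (classic (S w)) as [H|H].
    - intros eps He. destruct (Hlim w H eps He) as [d [Hd HL]]. exists d. split; auto.
      intros w' Hw'. rewrite (FS w H). replace (F w' - 0)%C with (F w') by ring.
      destruct (classic (S w')) as [H'|H']. rewrite FS, Cmod_0; auto. rewrite Ff; auto.
    - apply (cderiv_ccontinuous _ _ (f' w)). apply Fd; auto. }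
  (* The factors 1, -1, i and -i bound the real and the imaginary part from both sides. *)
  assert (K : forall c, Re (c * F z)%C <= 0).
  { intros c. apply (liouville_torus_Re p q (fun z => c * F z)%C (fun z => c * f' z)%C S); auto.
    - intros; apply ccontinuous_scal; auto.
    - intros; rewrite Fx; auto.
    - intros; rewrite Fy; auto.
    - intros w Hw. split. apply cderiv_scal; apply Fd; auto. apply ccontinuous_scal. apply Fd; auto.
    - intros w Hw. rewrite FS; auto. ring. }
  rewrite <- Ff by auto.
  pose proof (K 1%C). pose proof (K (-(1))%C). pose proof (K Ci). pose proof (K (- Ci)%C).
  rewrite !re_mult in *. simpl in *.
  apply injective_projections; simpl; unfold Re, Im in *; lra.
Qed.

(** * Lattice sums *)

(** Symmetric sums grown from the centre: the step from N to N + 1 adds just the two new ends, so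
    inductions on N need no reindexing. *)
Fixpoint zsum (a : Z -> C) (N : nat) : C :=
  match N with
  | O => a 0%Z
  | S n => (zsum a n + a (Z.of_nat (S n)) + a (- Z.of_nat (S n))%Z)%C
  end.

Definition psum (f : Z -> Z -> C) (N : nat) : C := zsum (fun m => zsum (f m) N) N.

Lemma zsum_ext a b N : (forall m, a m = b m) -> zsum a N = zsum b N.
Proof. intros H. induction N; cbn [zsum]; rewrite ?IHN, !H; auto. Qed.

Lemma zsum_sum_n (a : Z -> C) N :
  sum_n (fun i => a (Z.of_nat i - Z.of_nat N)%Z) (2 * N) = zsum a N.
Proof.
  revert a. induction N; intros a.
  - simpl. rewrite sum_O. reflexivity.
  - replace (2 * S N)%nat with (S (S (2 * N))) by lia.
    rewrite sum_Sn. unfold sum_n. rewrite sum_Sn_m by lia.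
    rewrite <- sum_n_m_S. cbn [zsum].
    rewrite <- (IHN a). unfold sum_n.
    rewrite (sum_n_m_ext _ (fun i => a (Z.of_nat i - Z.of_nat N)%Z)).
    2:{ intros i. f_equal. lia. }
    replace (Z.of_nat 0 - Z.of_nat (S N))%Z with (- Z.of_nat (S N))%Z by lia.
    replace (Z.of_nat (S (S (2 * N))) - Z.of_nat (S N))%Z with (Z.of_nat (S N)) by lia.
    unfold plus; simpl. set (X := @sum_n_m _ _ _ _). 
    ring.
Qed.

Definition masked (f : Z -> Z -> C) (m n : Z) : C :=
  if andb (m =? 0)%Z (n =? 0)%Z then RtoC 0 else f m n.

Lemma lattice_psum_eq w1 w3 f N :
  lattice_psum w1 w3 f N = psum (masked (fun m n => f (lattice_pt w1 w3 m n))) N.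
Proof.
  unfold lattice_psum, psum. rewrite <- zsum_sum_n. apply sum_n_ext. intros i.
  rewrite <- zsum_sum_n. apply sum_n_ext. intros j. reflexivity.
Qed.

Lemma zsum_plus a b N : zsum (fun m => a m + b m)%C N = (zsum a N + zsum b N)%C.
Proof. induction N; cbn [zsum]. auto. rewrite IHN. ring. Qed.

Lemma zsum_scal c a N : zsum (fun m => c * a m)%C N = (c * zsum a N)%C.
Proof. induction N; cbn [zsum]. auto. rewrite IHN. ring. Qed.

Lemma psum_ext f g N : (forall m n, f m n = g m n) -> psum f N = psum g N.
Proof. intros H. apply zsum_ext. intros. apply zsum_ext. auto. Qed.

Lemma psum_plus f g N : psum (fun m n => f m n + g m n)%C N = (psum f N + psum g N)%C.
Proof.
  unfold psum. rewrite <- zsum_plus. apply zsum_ext. intros. apply zsum_plus.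
Qed.

Lemma psum_scal c f N : psum (fun m n => c * f m n)%C N = (c * psum f N)%C.
Proof.
  unfold psum. rewrite <- zsum_scal. apply zsum_ext. intros. apply zsum_scal.
Qed.

Lemma zsum_opp_index a N : zsum (fun m => a (- m)%Z) N = zsum a N.
Proof. induction N; cbn [zsum]. auto. rewrite IHN, Z.opp_involutive. ring. Qed.

Lemma psum_opp_index f N : psum (fun m n => f (- m)%Z (- n)%Z) N = psum f N.
Proof.
  unfold psum. rewrite <- (zsum_opp_index (fun m => zsum (f m) N)).
  apply zsum_ext. intros. apply zsum_opp_index.
Qed.

Lemma zsum_shift a N :
  zsum (fun m => a (m + 1)%Z) N = (zsum a N + a (Z.of_nat N + 1)%Z - a (- Z.of_nat N)%Z)%C.
Proof.
  induction N; cbn [zsum].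
  - simpl. ring.
  - rewrite IHN. replace (Z.of_nat (S N)) with (Z.of_nat N + 1)%Z by lia.
    replace (- (Z.of_nat N + 1) + 1)%Z with (- Z.of_nat N)%Z by lia. ring.
Qed.

Lemma zsum_bound a N b : (forall m, (Z.abs m <= Z.of_nat N)%Z -> Cmod (a m) <= b) ->
  Cmod (zsum a N) <= (2 * INR N + 1) * b.
Proof.
  induction N; intros H; cbn [zsum].
  - simpl. specialize (H 0%Z ltac:(lia)). lra.
  - rewrite S_INR. eapply Rle_trans. apply Cmod_triangle.
    eapply Rle_trans. apply Rplus_le_compat_r. apply Cmod_triangle.
    pose proof (H (Z.of_nat (S N)) ltac:(lia)). pose proof (H (- Z.of_nat (S N))%Z ltac:(lia)).
    specialize (IHN ltac:(intros; apply H; lia)). lra.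
Qed.

(** The square ring max(|m|, |n|) = N + 1 consists of four sides of 2 N + 1 points and four corners,
    8 (N + 1) points in all. *)
Lemma psum_step f N b :
  (forall m n, Z.max (Z.abs m) (Z.abs n) = Z.of_nat (S N) -> Cmod (f m n) <= b) ->
  Cmod (psum f (S N) - psum f N)%C <= 8 * (INR N + 1) * b.
Proof.
  intros H. unfold psum at 1. cbn [zsum]. fold (psum f).
  rewrite (zsum_plus (fun m => zsum (f m) N + f m (Z.of_nat (S N)))%C).
  rewrite (zsum_plus (fun m => zsum (f m) N)).
  change (zsum (fun m => zsum (f m) N) N) with (psum f N).
  set (K := Z.of_nat (S N)) in *.
  replace (psum f N + zsum (fun m : Z => f m K) N + zsum (fun m : Z => f m (- K)%Z) N +
   (zsum (f K) N + f K K + f K (- K)%Z) +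
   (zsum (f (- K)%Z) N + f (- K)%Z K + f (- K)%Z (- K)%Z) - psum f N)%C
   with (zsum (fun m : Z => f m K) N + (zsum (fun m : Z => f m (- K)%Z) N +
    ((zsum (f K) N + (f K K + f K (- K)%Z)) +
   (zsum (f (- K)%Z) N + (f (- K)%Z K + f (- K)%Z (- K)%Z)))))%C by ring.
  assert (HK : K = Z.of_nat (S N)) by reflexivity.
  assert (B1 : Cmod (zsum (fun m => f m K) N) <= (2 * INR N + 1) * b)
    by (apply zsum_bound; intros; apply H; lia).
  assert (B2 : Cmod (zsum (fun m => f m (- K)%Z) N) <= (2 * INR N + 1) * b)
    by (apply zsum_bound; intros; apply H; lia).
  assert (B3 : Cmod (zsum (f K) N) <= (2 * INR N + 1) * b)
    by (apply zsum_bound; intros; apply H; lia).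
  assert (B4 : Cmod (zsum (f (- K)%Z) N) <= (2 * INR N + 1) * b)
    by (apply zsum_bound; intros; apply H; lia).
  assert (C1 : Cmod (f K K) <= b) by (apply H; lia).
  assert (C2 : Cmod (f K (- K)%Z) <= b) by (apply H; lia).
  assert (C3 : Cmod (f (- K)%Z K) <= b) by (apply H; lia).
  assert (C4 : Cmod (f (- K)%Z (- K)%Z) <= b) by (apply H; lia).
  eapply Rle_trans. apply Cmod_triangle.
  eapply Rle_trans. apply Rplus_le_compat_l. apply Cmod_triangle.
  eapply Rle_trans. do 2 apply Rplus_le_compat_l. apply Cmod_triangle.
  pose proof (Cmod_triangle (zsum (f K) N) (f K K + f K (- K)%Z)%C).
  pose proof (Cmod_triangle (f K K) (f K (- K)%Z)).
  pose proof (Cmod_triangle (zsum (f (- K)%Z) N) (f (- K)%Z K + f (- K)%Z (- K)%Z)%C).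
  pose proof (Cmod_triangle (f (- K)%Z K) (f (- K)%Z (- K)%Z)).
  lra.
Qed.

(** The maximum norm fits summation over squares; the added 1 keeps bounds by powers of 1 / rho
    meaningful at the origin. *)
Definition rho (m n : Z) : R := 1 + IZR (Z.max (Z.abs m) (Z.abs n)).

Lemma rho_ge_1 m n : 1 <= rho m n.
Proof. unfold rho. assert (0 <= IZR (Z.max (Z.abs m) (Z.abs n))) by (apply IZR_le; lia). lra. Qed.

Lemma rho_bound_0 f B k : (forall m n, Cmod (f m n) <= B / rho m n ^ k) ->
  0 <= B /\ Cmod (f 0%Z 0%Z) <= B.
Proof.
  intros H. specialize (H 0%Z 0%Z). unfold rho in H. simpl in H.
  rewrite Rplus_0_r, pow1 in H. unfold Rdiv in H. rewrite Rinv_1, Rmult_1_r in H.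
  pose proof (Cmod_ge_0 (f 0%Z 0%Z)). lra.
Qed.

Definition is_lsum (f : Z -> Z -> C) (s : C) : Prop :=
  forall eps, 0 < eps -> exists N0, forall N, (N0 <= N)%nat -> Cmod (psum f N - s)%C < eps.

(** A ring contributes at most 8 (N + 1) B / (N + 2)^3, which is below the telescoping term 8 B (1 /
    (N + 1) - 1 / (N + 2)). Convergence and an explicit tail come out together. *)
Lemma psum_cauchy f B N k : (forall m n, Cmod (f m n) <= B / rho m n ^ 3) ->
  Cmod (psum f (N + k) - psum f N)%C <= 8 * B * (/ (INR N + 1) - / (INR (N + k) + 1)).
Proof.
  intros H.
  assert (HB : 0 <= B).
  { apply (rho_bound_0 f B _ H). }
  induction k.
  - rewrite Nat.add_0_r. replace (psum f N - psum f N)%C with (RtoC 0) by ring.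
    rewrite Cmod_0. right; ring.
  - rewrite Nat.add_succ_r. eapply Rle_trans. apply (Cmod_tri3 _ (psum f (N + k))).
    set (M := (N + k)%nat) in *.
    assert (Cmod (psum f (S M) - psum f M)%C <= 8 * (INR M + 1) * (B / (INR M + 2) ^ 3)).
    { apply psum_step. intros m n Hmn. eapply Rle_trans. apply H.
      unfold rho. rewrite Hmn. rewrite <- INR_IZR_INZ, S_INR.
      replace (1 + (INR M + 1)) with (INR M + 2) by ring. lra. }
    rewrite S_INR. pose proof (pos_INR M). set (x := INR M) in *.
    assert (8 * (x + 1) * (B / (x + 2) ^ 3) <= 8 * B * (/ (x + 1) - / (x + 1 + 1))).
    { apply Rminus_le.
      replace (8 * (x + 1) * (B / (x + 2) ^ 3) - 8 * B * (/ (x + 1) - / (x + 1 + 1)))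
        with (- (8 * B * (2 * x + 3) / ((x + 2) ^ 3 * (x + 1)))) by (field; lra).
      assert (0 <= 8 * B * (2 * x + 3) / ((x + 2) ^ 3 * (x + 1))); [|lra].
      apply Rdiv_le_0_compat. nra. apply Rmult_lt_0_compat. apply pow_lt; lra. lra. }
    lra.
Qed.

Lemma archimed_inv eps : 0 < eps -> exists N : nat, forall n, (N <= n)%nat -> / (INR n + 1) < eps.
Proof.
  intros He. destruct (archimed_cor1 eps He) as [N [H1 H2]]. exists N. intros n Hn.
  eapply Rle_lt_trans; [|apply H1]. apply Rinv_le_contravar.
  apply lt_0_INR; auto. apply le_INR in Hn. lra.
Qed.

(** The constant 9 is 1 for the central term and 8 for the telescoped rings. *)
Lemma psum_bound f B N : (forall m n, Cmod (f m n) <= B / rho m n ^ 3) -> Cmod (psum f N) <= 9 * B.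
Proof.
  intros H. pose proof (psum_cauchy f B 0 N H). simpl in H0.
  assert (Cmod (psum f 0) <= B).
  { apply (rho_bound_0 f B 3 H). }
  pose proof (Cmod_ge_0 (psum f 0)).
  pose proof (Cmod_split (psum f N) (psum f 0)).
  assert (0 < / (INR N + 1)) by (apply Rinv_0_lt_compat; pose proof (pos_INR N); lra).
  assert (/ (0 + 1) = 1) by field. 
  nra.
Qed.

Lemma is_lsum_ex f B : (forall m n, Cmod (f m n) <= B / rho m n ^ 3) -> exists s, is_lsum f s.
Proof.
  intros H.
  assert (HB : 0 <= B).
  { apply (rho_bound_0 f B _ H). }
  assert (HC : forall eps, eps > 0 -> exists N0, forall n m, (n >= N0)%nat -> (m >= N0)%nat ->
     Cmod (psum f n - psum f m)%C < eps).
  { intros eps He.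
    destruct (archimed_inv (eps / (8 * B + 1))) as [N HN]. apply Rdiv_lt_0_compat; lra.
    assert (Q : forall n m, (N <= m)%nat -> (m <= n)%nat -> Cmod (psum f n - psum f m)%C < eps).
    { intros n m Hm Hn. replace n with (m + (n - m))%nat by lia.
      eapply Rle_lt_trans. apply (psum_cauchy f B _ _ H).
      assert (0 < / (INR (m + (n - m)) + 1)) by (apply Rinv_0_lt_compat; pose proof (pos_INR (m + (n - m))); lra).
      specialize (HN m Hm).
      assert (0 < / (INR m + 1)) by (apply Rinv_0_lt_compat; pose proof (pos_INR m); lra).
      apply Rlt_div_r in HN; [|lra]. nra. }
    exists N. intros n m Hn Hm. destruct (le_ge_dec m n).
    apply Q; auto. rewrite Cmod_minus_sym. apply Q; auto. }
  destruct (Rcomplete.R_complete (fun N => Re (psum f N))) as [x Hx].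
  { intros eps He. destruct (HC eps He) as [N HN]. exists N. intros n m Hn Hm.
    eapply Rle_lt_trans; [|apply (HN n m Hn Hm)]. unfold Rdist.
    eapply Rle_trans; [|apply re_le_Cmod]. unfold Cminus. rewrite re_plus, re_opp. right; reflexivity. }
  destruct (Rcomplete.R_complete (fun N => Im (psum f N))) as [y Hy].
  { intros eps He. destruct (HC eps He) as [N HN]. exists N. intros n m Hn Hm.
    eapply Rle_lt_trans; [|apply (HN n m Hn Hm)]. unfold Rdist.
    eapply Rle_trans; [|apply im_le_Cmod]. unfold Cminus. rewrite im_plus, im_opp. right; reflexivity. }
  exists (x, y). intros eps He.
  destruct (Hx (eps / 2) ltac:(lra)) as [N1 H1]. destruct (Hy (eps / 2) ltac:(lra)) as [N2 H2].
  exists (N1 + N2)%nat. intros N HN. specialize (H1 N ltac:(lia)). specialize (H2 N ltac:(lia)).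
  unfold Rdist in *. eapply Rle_lt_trans. apply Cmod_le_Re_Im.
  unfold Cminus. rewrite re_plus, im_plus, re_opp, im_opp. simpl. unfold Rminus in *. lra.
Qed.

Lemma Cmod_small_zero z : (forall eps, 0 < eps -> Cmod z <= eps) -> z = 0%C.
Proof.
  intros H. apply Cmod_eq_0. destruct (Rle_lt_or_eq_dec _ _ (Cmod_ge_0 z)) as [Hp|]; auto.
  specialize (H (Cmod z / 2) ltac:(lra)). lra.
Qed.

Lemma is_lsum_unique f s t : is_lsum f s -> is_lsum f t -> s = t.
Proof.
  intros Hs Ht. apply Ceq_minus. apply Cmod_small_zero. intros eps He.
  destruct (Hs (eps / 2) ltac:(lra)) as [N1 H1]. destruct (Ht (eps / 2) ltac:(lra)) as [N2 H2].
  specialize (H1 (N1 + N2)%nat ltac:(lia)). specialize (H2 (N1 + N2)%nat ltac:(lia)).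
  pose proof (Cmod_tri3 s (psum f (N1 + N2)) t). rewrite Cmod_minus_sym in H1. lra.
Qed.

Lemma is_lsum_close f g s :
  (forall eps, 0 < eps -> exists N0, forall N, (N0 <= N)%nat -> Cmod (psum f N - psum g N)%C < eps) ->
  is_lsum f s -> is_lsum g s.
Proof.
  intros H Hf eps He. destruct (H (eps / 2) ltac:(lra)) as [N1 H1].
  destruct (Hf (eps / 2) ltac:(lra)) as [N2 H2]. exists (N1 + N2)%nat. intros N HN.
  specialize (H1 N ltac:(lia)). specialize (H2 N ltac:(lia)).
  pose proof (Cmod_tri3 (psum g N) (psum f N) s). rewrite Cmod_minus_sym in H1. lra.
Qed.

Lemma is_lsum_ext f g s : (forall m n, f m n = g m n) -> is_lsum f s -> is_lsum g s.
Proof.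
  intros H Hf eps He. destruct (Hf eps He) as [N0 HN]. exists N0. intros N HN'.
  rewrite <- (psum_ext f g); auto.
Qed.

Lemma is_lsum_plus f g s t : is_lsum f s -> is_lsum g t ->
  is_lsum (fun m n => f m n + g m n)%C (s + t)%C.
Proof.
  intros Hf Hg eps He. destruct (Hf (eps / 2) ltac:(lra)) as [N1 H1].
  destruct (Hg (eps / 2) ltac:(lra)) as [N2 H2]. exists (N1 + N2)%nat. intros N HN.
  specialize (H1 N ltac:(lia)). specialize (H2 N ltac:(lia)).
  rewrite psum_plus.
  replace (psum f N + psum g N - (s + t))%C with ((psum f N - s) + (psum g N - t))%C by ring.
  eapply Rle_lt_trans. apply Cmod_triangle. lra.
Qed.

Lemma is_lsum_scal c f s : is_lsum f s -> is_lsum (fun m n => c * f m n)%C (c * s)%C.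
Proof.
  intros Hf eps He. pose proof (Cmod_ge_0 c).
  destruct (Hf (eps / (Cmod c + 1)) ltac:(apply Rdiv_lt_0_compat; lra)) as [N0 H0].
  exists N0. intros N HN. specialize (H0 N HN). rewrite psum_scal.
  replace (c * psum f N - c * s)%C with (c * (psum f N - s))%C by ring. rewrite Cmod_mult.
  apply Rlt_div_r in H0; [|lra]. pose proof (Cmod_ge_0 (psum f N - s)%C). nra.
Qed.

Lemma is_lsum_bound f B s : (forall m n, Cmod (f m n) <= B / rho m n ^ 3) -> is_lsum f s ->
  Cmod s <= 9 * B.
Proof.
  intros H Hs. apply le_epsilon. intros eps He. destruct (Hs eps He) as [N HN].
  specialize (HN N (le_n N)). pose proof (psum_bound f B N H).
  rewrite Cmod_minus_sym in HN. pose proof (Cmod_split s (psum f N)). lra.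
Qed.

Lemma is_lsum_opp_index f s : is_lsum f s -> is_lsum (fun m n => f (- m)%Z (- n)%Z) s.
Proof.
  intros H eps He. destruct (H eps He) as [N0 HN]. exists N0. intros N HN'.
  rewrite psum_opp_index. auto.
Qed.

Lemma lattice_sum_eq w1 w3 f s :
  is_lsum (masked (fun m n => f (lattice_pt w1 w3 m n))) s -> lattice_sum w1 w3 f = s.
Proof.
  intros H. unfold lattice_sum.
  replace (Lim_seq (fun N => Re (lattice_psum w1 w3 f N))) with (Finite (Re s)).
  replace (Lim_seq (fun N => Im (lattice_psum w1 w3 f N))) with (Finite (Im s)).
  destruct s; reflexivity.
  - symmetry. apply is_lim_seq_unique. apply is_lim_seq_Reals. intros eps He.
    destruct (H eps He) as [N0 HN]. exists N0. intros N HN'. rewrite lattice_psum_eq.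
    specialize (HN N HN'). eapply Rle_lt_trans; [|apply HN]. unfold Rdist.
    eapply Rle_trans; [|apply im_le_Cmod]. unfold Cminus. rewrite im_plus, im_opp. right; reflexivity.
  - symmetry. apply is_lim_seq_unique. apply is_lim_seq_Reals. intros eps He.
    destruct (H eps He) as [N0 HN]. exists N0. intros N HN'. rewrite lattice_psum_eq.
    specialize (HN N HN'). eapply Rle_lt_trans; [|apply HN]. unfold Rdist.
    eapply Rle_trans; [|apply re_le_Cmod]. unfold Cminus. rewrite re_plus, re_opp. right; reflexivity.
Qed.

(* The two boundary columns have [2 N + 1] terms of size [O(1 / N^2)] each. *)
Lemma psum_shift_1 f B : (forall m n, Cmod (f m n) <= B / rho m n ^ 2) ->
  forall eps, 0 < eps -> exists N0, forall N, (N0 <= N)%nat ->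
    Cmod (psum (fun m n => f (m + 1)%Z n) N - psum f N)%C < eps.
Proof.
  intros H eps He.
  assert (HB : 0 <= B).
  { apply (rho_bound_0 f B _ H). }
  destruct (archimed_inv (eps / (4 * B + 1))) as [N0 HN]. apply Rdiv_lt_0_compat; lra.
  exists N0. intros N HN'. specialize (HN N HN').
  unfold psum. rewrite (zsum_shift (fun m => zsum (f m) N)).
  match goal with |- Cmod (?a + ?b - ?c - ?a)%C < _ =>
    replace (a + b - c - a)%C with (b - c)%C by ring end.
  pose proof (pos_INR N).
  assert (Q : forall K, (Z.of_nat N <= Z.abs K)%Z -> Cmod (zsum (f K) N) <= (2 * INR N + 1) * (B / (INR N + 1) ^ 2)).
  { intros K HK. apply zsum_bound. intros n Hn. eapply Rle_trans. apply H.
    apply Rmult_le_compat_l; auto. apply Rinv_le_contravar. apply pow_lt; lra.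
    apply pow_incr. split. lra. unfold rho. rewrite INR_IZR_INZ.
    assert (IZR (Z.of_nat N) <= IZR (Z.max (Z.abs K) (Z.abs n))) by (apply IZR_le; lia). lra. }
  pose proof (Q (Z.of_nat N + 1)%Z ltac:(lia)). pose proof (Q (- Z.of_nat N)%Z ltac:(lia)).
  eapply Rle_lt_trans. apply Cmod_triangle. rewrite Cmod_opp.
  assert ((2 * INR N + 1) * (B / (INR N + 1) ^ 2) <= 2 * B * / (INR N + 1)).
  { apply Rminus_le.
    replace ((2 * INR N + 1) * (B / (INR N + 1) ^ 2) - 2 * B * / (INR N + 1))
      with (- (B / (INR N + 1) ^ 2)) by (field; lra).
    assert (0 <= B / (INR N + 1) ^ 2); [|lra]. apply Rdiv_le_0_compat; auto. apply pow_lt; lra. }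
  assert (0 < / (INR N + 1)) by (apply Rinv_0_lt_compat; lra).
  apply Rlt_div_r in HN; [|lra]. nra.
Qed.

(** Here the shift acts inside the inner sum, so the two boundary rows appear as one outer sum of 2
    N + 1 pairs, each of size O(1 / N^2). *)
Lemma psum_shift_2 f B : (forall m n, Cmod (f m n) <= B / rho m n ^ 2) ->
  forall eps, 0 < eps -> exists N0, forall N, (N0 <= N)%nat ->
    Cmod (psum (fun m n => f m (n + 1)%Z) N - psum f N)%C < eps.
Proof.
  intros H eps He.
  assert (HB : 0 <= B).
  { apply (rho_bound_0 f B _ H). }
  destruct (archimed_inv (eps / (4 * B + 1))) as [N0 HN]. apply Rdiv_lt_0_compat; lra.
  exists N0. intros N HN'. specialize (HN N HN').
  unfold psum.
  rewrite (zsum_ext _ (fun m => zsum (f m) N + (f m (Z.of_nat N + 1)%Z + (-(1)) * f m (- Z.of_nat N)%Z))%C).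
  2:{ intros m. rewrite (zsum_shift (f m)). ring. }
  rewrite zsum_plus.
  match goal with |- Cmod (?a + ?b - ?a)%C < _ => replace (a + b - a)%C with b by ring end.
  pose proof (pos_INR N).
  set (b := B / (INR N + 1) ^ 2).
  assert (Hfb : forall m K, (Z.of_nat N <= Z.abs K)%Z -> Cmod (f m K) <= b).
  { intros m K HK. eapply Rle_trans. apply H.
    apply Rmult_le_compat_l; auto. apply Rinv_le_contravar. apply pow_lt; lra.
    apply pow_incr. split. lra. unfold rho. rewrite INR_IZR_INZ.
    assert (IZR (Z.of_nat N) <= IZR (Z.max (Z.abs m) (Z.abs K))) by (apply IZR_le; lia). lra. }
  assert (Q : Cmod (zsum (fun m => f m (Z.of_nat N + 1)%Z + (-(1)) * f m (- Z.of_nat N)%Z)%C N)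
     <= (2 * INR N + 1) * (2 * b)).
  { apply zsum_bound. intros m _. eapply Rle_trans. apply Cmod_triangle.
    rewrite Cmod_mult, Cmod_opp, Cmod_1.
    pose proof (Hfb m (Z.of_nat N + 1)%Z ltac:(lia)). pose proof (Hfb m (- Z.of_nat N)%Z ltac:(lia)). lra. }
  assert ((2 * INR N + 1) * b <= 2 * B * / (INR N + 1)).
  { apply Rminus_le. unfold b.
    replace ((2 * INR N + 1) * (B / (INR N + 1) ^ 2) - 2 * B * / (INR N + 1))
      with (- (B / (INR N + 1) ^ 2)) by (field; lra).
    assert (0 <= B / (INR N + 1) ^ 2); [|lra]. apply Rdiv_le_0_compat; auto. apply pow_lt; lra. }
  assert (0 < / (INR N + 1)) by (apply Rinv_0_lt_compat; lra).
  apply Rlt_div_r in HN; [|lra]. nra.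
Qed.

(** * The Weierstrass functions of a rectangular lattice *)

Definition lpt (w v : R) (m n : Z) : C := lattice_pt w (Ci * v) m n.

Lemma lpt_eq w v m n : lpt w v m n = (2 * IZR m * w, 2 * IZR n * v).
Proof.
  unfold lpt, lattice_pt, Cmult, Cplus, Ci, RtoC; simpl. f_equal; ring.
Qed.

Lemma lpt_succ_1 w v m n : lpt w v (m + 1) n = (lpt w v m n + RtoC (2 * w))%C.
Proof. rewrite !lpt_eq, plus_IZR. unfold Cplus, RtoC; simpl. f_equal; ring. Qed.

Lemma lpt_succ_2 w v m n : lpt w v m (n + 1) = (lpt w v m n + RtoC (2 * v) * Ci)%C.
Proof. rewrite !lpt_eq, plus_IZR. unfold Cplus, Cmult, Ci, RtoC; simpl. f_equal; ring. Qed.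

Lemma lpt_opp w v m n : lpt w v (- m) (- n) = (- lpt w v m n)%C.
Proof. rewrite !lpt_eq, !opp_IZR. unfold Copp; simpl. f_equal; ring. Qed.

Lemma lpt_add w v m n m' n' : lpt w v (m + m') (n + n') = (lpt w v m n + lpt w v m' n')%C.
Proof. rewrite !lpt_eq, !plus_IZR. unfold Cplus; simpl. f_equal; ring. Qed.

Lemma lpt_0 (w v : R) : lpt w v 0 0 = 0%C.
Proof. rewrite lpt_eq. unfold RtoC. f_equal; ring. Qed.

Lemma lpt_lower w v m n : 0 < w -> 0 < v ->
  2 * Rmin w v * IZR (Z.max (Z.abs m) (Z.abs n)) <= Cmod (lpt w v m n).
Proof.
  intros Hw Hv. eapply Rle_trans; [|apply Rmax_Cmod]. rewrite lpt_eq. simpl fst. simpl snd.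
  pose proof (Rmin_l w v). pose proof (Rmin_r w v). pose proof (Rmin_pos w v Hw Hv).
  rewrite !Rabs_mult, (Rabs_pos_eq 2), (Rabs_pos_eq w), (Rabs_pos_eq v), !Rabs_Zabs by lra.
  assert (Hm : 0 <= IZR (Z.abs m)) by (apply IZR_le; lia).
  assert (Hn : 0 <= IZR (Z.abs n)) by (apply IZR_le; lia).
  destruct (Z.max_spec (Z.abs m) (Z.abs n)) as [[_ ->]|[_ ->]].
  - eapply Rle_trans; [|apply Rmax_r]. nra.
  - eapply Rle_trans; [|apply Rmax_l]. nra.
Qed.

Definition nz (m n : Z) : Prop := ~ (m = 0 /\ n = 0)%Z.

(** One inequality records both that [z] keeps away from the lattice points and that their distance
    grows linearly at infinity. [P] selects either all points or only the nonzero ones. *)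
Definition apart (w v : R) (P : Z -> Z -> Prop) (z : C) (kap : R) : Prop :=
  0 < kap /\ forall m n, P m n -> kap * rho m n <= Cmod (z - lpt w v m n)%C.

Lemma apart_of_dist w v P z del : 0 < w -> 0 < v -> 0 < del ->
  (forall m n, P m n -> del <= Cmod (z - lpt w v m n)%C) -> exists kap, apart w v P z kap.
Proof.
  intros Hw Hv Hd H. set (c := 2 * Rmin w v).
  assert (Hc : 0 < c) by (unfold c; pose proof (Rmin_pos w v Hw Hv); lra).
  pose proof (Cmod_ge_0 z).
  set (K := 1 + (2 * Cmod z + c) / c).
  assert (HK : 0 < K) by (unfold K; assert (0 < (2 * Cmod z + c) / c) by (apply Rdiv_lt_0_compat; lra); lra).
  exists (Rmin (c / 2) (del / K)). split.
  { apply Rmin_pos. lra. apply Rdiv_lt_0_compat; auto. }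
  intros m n HP. pose proof (Rmin_l (c / 2) (del / K)). pose proof (Rmin_r (c / 2) (del / K)).
  pose proof (lpt_lower w v m n Hw Hv) as HL. fold c in HL.
  set (M := IZR (Z.max (Z.abs m) (Z.abs n))) in *.
  pose proof (rho_ge_1 m n) as Hr1.
  assert (Hr : rho m n = 1 + M) by reflexivity. rewrite Hr in *.
  (* At far points |W| dominates |z| and the constant c / 2 works; the remaining points have [rho]
     at most [K], which the distance [del] absorbs. *)
  destruct (Rle_lt_dec (2 * Cmod z + c) (c * M)) as [Hb|Hb].
  - pose proof (Cmod_split (lpt w v m n) z). rewrite Cmod_minus_sym in H3.
    apply Rle_trans with (c / 2 * (1 + M)). apply Rmult_le_compat_r; lra. lra.
  - specialize (H m n HP). apply Rle_trans with (del / K * K).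
    + apply Rmult_le_compat; try lra. apply Rlt_le, Rmin_pos. lra. apply Rdiv_lt_0_compat; auto.
      unfold K. apply Rplus_le_compat_l. apply Rle_div_r; lra.
    + replace (del / K * K) with del by (field; lra). auto.
Qed.

Lemma dist_multiples p x : 0 < p -> (forall k : Z, x <> IZR k * p) ->
  exists d, 0 < d /\ forall k : Z, d <= Rabs (x - IZR k * p).
Proof.
  intros Hp H. destruct (reduce_mod p x Hp) as [k0 Hk0].
  pose proof (H (- k0)%Z) as H1. pose proof (H (1 - k0)%Z) as H2.
  rewrite opp_IZR in H1. rewrite minus_IZR in H2.
  set (y := x + IZR k0 * p) in *.
  exists (Rmin y (p - y)). split.
  { apply Rmin_pos; unfold y in *; lra. }
  intros k. pose proof (Rmin_l y (p - y)). pose proof (Rmin_r y (p - y)).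
  replace (x - IZR k * p) with (y - IZR (k0 + k) * p) by (unfold y; rewrite plus_IZR; ring).
  destruct (Z_le_gt_dec (k0 + k) 0) as [Hle|Hgt].
  - apply IZR_le in Hle. eapply Rle_trans; [|apply Rle_abs]. nra.
  - assert (1 <= IZR (k0 + k)) by (apply IZR_le; lia).
    rewrite Rabs_minus_sym. eapply Rle_trans; [|apply Rle_abs]. nra.
Qed.

(** On a rectangular lattice a single coordinate separates [z] from all points: the imaginary one if
    Re z is a multiple of 2 w, the real one otherwise. *)
Lemma apart_of_notin (w v : R) z : 0 < w -> 0 < v -> ~ in_lattice w (Ci * v)%C z ->
  exists kap, apart w v (fun _ _ => True) z kap.
Proof.
  intros Hw Hv H.
  assert (Hd : exists d, 0 < d /\ forall m n : Z, d <= Cmod (z - lpt w v m n)%C).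
  { destruct (classic (exists m : Z, Re z = IZR m * (2 * w))) as [[m Hm]|Hm].
    - destruct (dist_multiples (2 * v) (Im z) ltac:(lra)) as [d [Hd H1]].
      { intros n Hn. apply H. exists m, n. change (z = lpt w v m n). rewrite lpt_eq.
        destruct z as [x y]. simpl in *. f_equal; lra. }
      exists d. split; auto. intros m' n. eapply Rle_trans. apply (H1 n).
      eapply Rle_trans; [|apply im_le_Cmod]. rewrite lpt_eq. right. f_equal.
      unfold Cminus. rewrite im_plus. simpl. ring.
    - destruct (dist_multiples (2 * w) (Re z) ltac:(lra)) as [d [Hd H1]].
      { intros k Hk. apply Hm. exists k; auto. }
      exists d. split; auto. intros m' n. eapply Rle_trans. apply (H1 m').
      eapply Rle_trans; [|apply re_le_Cmod]. rewrite lpt_eq. right. f_equal.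
      unfold Cminus. rewrite re_plus. simpl. ring. }
  destruct Hd as [d [Hd H1]]. apply (apart_of_dist w v _ z d); auto.
Qed.

Lemma apart_notin (w v : R) z kap : apart w v (fun _ _ => True) z kap -> ~ in_lattice w (Ci * v)%C z.
Proof.
  intros [Hk H] [m [n E]]. specialize (H m n I). fold (lpt w v m n) in E.
  rewrite E in H. replace (lpt w v m n - lpt w v m n)%C with (RtoC 0) in H by ring.
  rewrite Cmod_0 in H. pose proof (rho_ge_1 m n). nra.
Qed.

Lemma apart_0 (w v : R) : 0 < w -> 0 < v -> exists kap, apart w v nz 0%C kap.
Proof.
  intros Hw Hv. pose proof (Rmin_pos w v Hw Hv).
  apply (apart_of_dist w v nz 0 (2 * Rmin w v)); auto. lra.
  intros m n Hn. pose proof (lpt_lower w v m n Hw Hv).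
  replace (0 - lpt w v m n)%C with (- lpt w v m n)%C by ring. rewrite Cmod_opp.
  assert (1 <= IZR (Z.max (Z.abs m) (Z.abs n))) by (apply IZR_le; unfold nz in Hn; lia). nra.
Qed.

Lemma apart_weaken (w v : R) z kap : apart w v (fun _ _ => True) z kap -> apart w v nz z kap.
Proof. intros [H1 H2]. split; auto. Qed.

(** A constant uniform over a disc about [z] lets all terms of the series at z + h be estimated at
    once; [h] is absorbed because rho >= 1. *)
Lemma apart_near w v P z kap h : apart w v P z kap -> Cmod h < kap / 2 ->
  apart w v P (z + h)%C (kap / 2).
Proof.
  intros [Hk H] Hh. split. lra. intros m n HP. specialize (H m n HP).
  pose proof (rho_ge_1 m n).
  pose proof (Cmod_split (z - lpt w v m n)%C (z + h - lpt w v m n)%C).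
  replace (z - lpt w v m n - (z + h - lpt w v m n))%C with (- h)%C in H1 by ring.
  rewrite Cmod_opp in H1. nra.
Qed.

(* Summing this bound over the lattice differentiates the series term by term
   without a theorem on uniform convergence. *)
Lemma inv_pow_taylor k : exists c, 0 <= c /\ forall (a h : C) r, 0 < r ->
  r <= Cmod a -> r <= Cmod (a + h)%C ->
  Cmod (/ (a + h) ^ k - / a ^ k + INR k * h / a ^ S k)%C <= c * (Cmod h * Cmod h) / r ^ (k + 2).
Proof.
  induction k.
  - exists 0. split. lra. intros a h r Hr _ _. simpl.
    replace (/ 1 - / 1 + 0 * h / (a * 1))%C with (RtoC 0).
    rewrite Cmod_0. right; unfold Rdiv; ring.
    unfold Cdiv. ring.
  - destruct IHk as [c [Hc IH]]. exists (c + (INR k + 1)). pose proof (pos_INR k).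
    split. lra. intros a h r Hr Ha Hb. specialize (IH a h r Hr Ha Hb).
    assert (Na : a <> 0%C) by (intros ->; rewrite Cmod_0 in Ha; lra).
    assert (Nb : (a + h)%C <> 0%C) by (intros E; rewrite E, Cmod_0 in Hb; lra).
    set (b := (a + h)%C) in *.
    assert (Eh : h = (b - a)%C) by (unfold b; ring).
    set (T := (/ b ^ k - / a ^ k + INR k * h / a ^ S k)%C) in *.
    assert (Nak : (a ^ k)%C <> 0%C) by (apply Cpow_nz; auto).
    assert (Nbk : (b ^ k)%C <> 0%C) by (apply Cpow_nz; auto).
    (* Recursion of the remainder: the one for k + 1 is the one for k divided by a + h, plus a
       single term of order h^2. Hence the constant grows by k + 1. *)
    replace (/ b ^ S k - / a ^ S k + INR (S k) * h / a ^ S (S k))%C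
      with (T * / b + (INR k + 1) * (h * h) * (/ a ^ S (S k) * / b))%C.
    2:{ unfold T. rewrite S_INR, RtoC_plus, !Cpow_S, Eh. field. auto. }
    assert (Hbi : Cmod (/ b) <= / r).
    { rewrite Cmod_inv by auto. apply Rinv_le_contravar; auto. }
    assert (Hai : Cmod (/ a ^ S (S k)) <= / r ^ S (S k)).
    { rewrite Cmod_inv by (apply Cpow_nz; auto). rewrite Cmod_pow.
      apply Rinv_le_contravar. apply pow_lt; auto. apply pow_incr. lra. }
    eapply Rle_trans. apply Cmod_triangle. rewrite !Cmod_mult.
    rewrite <- RtoC_plus, Cmod_R, (Rabs_pos_eq (INR k + 1)) by lra.
    set (x := Cmod h * Cmod h). assert (Hx : 0 <= x) by (unfold x; pose proof (Cmod_ge_0 h); nra).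
    assert (B1 : Cmod T * Cmod (/ b) <= c * x / r ^ (k + 2) * / r).
    { apply Rmult_le_compat; auto; apply Cmod_ge_0. }
    assert (B2 : (INR k + 1) * x * (Cmod (/ a ^ S (S k)) * Cmod (/ b)) <= (INR k + 1) * x * (/ r ^ S (S k) * / r)).
    { apply Rmult_le_compat_l. apply Rmult_le_pos; lra.
      apply Rmult_le_compat; auto; apply Cmod_ge_0. }
    eapply Rle_trans. apply Rplus_le_compat. apply B1. apply B2.
    replace (S k + 2)%nat with (S (k + 2)) by lia. replace (S (S k)) with (k + 2)%nat by lia.
    right. simpl. field. split. apply pow_nonzero; lra. lra.
Qed.

(* Terms of the series of [zeta] (k = 1), [wp] (k = 2) and, for k >= 3, of
   [(-1)^k wp^(k-2) / (k-1)!], so that differentiation sends [k] to [k + 1] with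
   the factor [- k].  The sum [eis_reg] leaves out the pole at 0. *)
Definition term (k : nat) (z W : C) : C :=
  match k with
  | 1%nat => / (z - W) + / W + z / W ^ 2
  | 2%nat => / (z - W) ^ 2 - / W ^ 2
  | _ => / (z - W) ^ k
  end%C.

Definition eis_reg (w v : R) (k : nat) (z : C) : C := lattice_sum w (Ci * v) (term k z).
Definition eis (w v : R) (k : nat) (z : C) : C := (/ z ^ k + eis_reg w v k z)%C.

Lemma wp_eis (w v : R) z : wp w (Ci * v) z = eis w v 2 z.
Proof. reflexivity. Qed.

Lemma wzeta_eis (w v : R) z : wzeta w (Ci * v) z = eis w v 1 z.
Proof. unfold eis. rewrite Cpow_1_r. reflexivity. Qed.

Lemma masked_nz f m n : nz m n -> masked f m n = f m n.
Proof.
  intros H. unfold masked, nz in *. destruct (Z.eqb_spec m 0), (Z.eqb_spec n 0); simpl; auto. tauto.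
Qed.

Lemma masked_0 f : masked f 0 0 = 0%C.
Proof. reflexivity. Qed.

Lemma masked_cases f m n : (nz m n /\ masked f m n = f m n) \/ (m = 0%Z /\ n = 0%Z /\ masked f m n = RtoC 0).
Proof.
  destruct (classic (nz m n)) as [H|H]. left; split; auto. apply masked_nz; auto.
  right. unfold nz in H. assert (m = 0 /\ n = 0)%Z by tauto. destruct H0 as [-> ->]. repeat split.
Qed.

Lemma masked_bound f B k : 0 <= B ->
  (forall m n, nz m n -> Cmod (f m n) <= B / rho m n ^ k) ->
  forall m n, Cmod (masked f m n) <= B / rho m n ^ k.
Proof.
  intros HB H m n. destruct (masked_cases f m n) as [[Hn ->]|[_ [_ ->]]]; auto.
  rewrite Cmod_0. apply Rdiv_le_0_compat; auto. apply pow_lt. pose proof (rho_ge_1 m n). lra.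
Qed.

Lemma inv_bound (a : C) kap r : 0 < kap -> 1 <= r -> kap * r <= Cmod a ->
  a <> 0%C /\ Cmod (/ a) <= / (kap * r).
Proof.
  intros Hk Hr Ha. assert (0 < kap * r) by nra.
  assert (a <> 0%C) by (intros ->; rewrite Cmod_0 in Ha; lra).
  split; auto. rewrite Cmod_inv; auto. apply Rinv_le_contravar; auto.
Qed.

Lemma apart_inv w v P z kap m n : apart w v P z kap -> P m n ->
  (z - lpt w v m n)%C <> 0%C /\ Cmod (/ (z - lpt w v m n))%C <= / (kap * rho m n).
Proof.
  intros [Hk H] HP. apply inv_bound; auto. apply rho_ge_1.
Qed.

Lemma lpt_inv w v kap m n : apart w v nz 0%C kap -> nz m n ->
  lpt w v m n <> 0%C /\ Cmod (/ lpt w v m n)%C <= / (kap * rho m n).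
Proof.
  intros [Hk H] HP. apply inv_bound; auto. apply rho_ge_1.
  specialize (H m n HP). replace (0 - lpt w v m n)%C with (- lpt w v m n)%C in H by ring.
  rewrite Cmod_opp in H. auto.
Qed.

Lemma pow_ge_3 r k : 1 <= r -> (3 <= k)%nat -> / r ^ k <= / r ^ 3.
Proof.
  intros Hr Hk. apply Rinv_le_contravar. apply pow_lt; lra. apply Rle_pow; auto.
Qed.

(** The subtracted terms make k = 1 and k = 2 summable: after cancellation they are z^2 / (W^2 (z -
    W)) and z (1 / (W (z - W)^2) - 1 / (W^2 (z - W))), both of third order at infinity. *)
Lemma term_sum_bound w v k z kap : 0 < w -> 0 < v -> (1 <= k)%nat -> apart w v nz z kap ->
  exists B, forall m n, Cmod (masked (fun m n => term k z (lpt w v m n)) m n) <= B / rho m n ^ 3.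
Proof.
  intros Hw Hv Hk Hz. destruct (apart_0 w v Hw Hv) as [k0 H0].
  assert (Hkp : 0 < kap) by apply Hz. assert (Hk0 : 0 < k0) by apply H0.
  pose proof (Cmod_ge_0 z).
  destruct k as [|[|[|k]]]; [lia| | |].
  - exists (Cmod z * Cmod z / (k0 * k0 * kap)). apply masked_bound.
    { apply Rdiv_le_0_compat. nra. repeat apply Rmult_lt_0_compat; auto. }
    intros m n Hn. destruct (apart_inv _ _ _ _ _ _ _ Hz Hn) as [N1 B1].
    destruct (lpt_inv _ _ _ _ _ H0 Hn) as [N2 B2]. pose proof (rho_ge_1 m n).
    set (W := lpt w v m n) in *. unfold term.
    replace (/ (z - W) + / W + z / W ^ 2)%C with (z * z * (/ W * / W * / (z - W)))%C by (field; auto).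
    rewrite !Cmod_mult.
    replace (Cmod z * Cmod z / (k0 * k0 * kap) / rho m n ^ 3) with
      (Cmod z * Cmod z * (/ (k0 * rho m n) * / (k0 * rho m n) * / (kap * rho m n))) by (field; lra).
    apply Rmult_le_compat_l. nra.
    repeat apply Rmult_le_compat; auto; try apply Cmod_ge_0. apply Rmult_le_pos; apply Cmod_ge_0.
  - exists (Cmod z * (1 / (k0 * kap * kap) + 1 / (k0 * k0 * kap))). apply masked_bound.
    { apply Rmult_le_pos; auto. apply Rplus_le_le_0_compat; apply Rdiv_le_0_compat; try lra; repeat apply Rmult_lt_0_compat; auto. }
    intros m n Hn. destruct (apart_inv _ _ _ _ _ _ _ Hz Hn) as [N1 B1].
    destruct (lpt_inv _ _ _ _ _ H0 Hn) as [N2 B2]. pose proof (rho_ge_1 m n).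
    set (W := lpt w v m n) in *. unfold term.
    replace (/ (z - W) ^ 2 - / W ^ 2)%C with
      (z * (/ W * / (z - W) * / (z - W) + (- (1)) * (/ W * / W * / (z - W))))%C by (field; auto).
    rewrite Cmod_mult.
    replace (Cmod z * (1 / (k0 * kap * kap) + 1 / (k0 * k0 * kap)) / rho m n ^ 3) with
      (Cmod z * (/ (k0 * rho m n) * / (kap * rho m n) * / (kap * rho m n) + / (k0 * rho m n) * / (k0 * rho m n) * / (kap * rho m n)))
      by (field; lra).
    apply Rmult_le_compat_l. auto.
    eapply Rle_trans. apply Cmod_triangle. rewrite !Cmod_mult, Cmod_opp, Cmod_1, Rmult_1_l.
    apply Rplus_le_compat;
    repeat apply Rmult_le_compat; auto; try apply Cmod_ge_0; apply Rmult_le_pos; apply Cmod_ge_0.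
  - exists (/ kap ^ S (S (S k))). apply masked_bound.
    { apply Rlt_le, Rinv_0_lt_compat, pow_lt; auto. }
    intros m n Hn. destruct (apart_inv _ _ _ _ _ _ _ Hz Hn) as [N1 B1]. pose proof (rho_ge_1 m n).
    set (W := lpt w v m n) in *. cbn [term].
    rewrite <- Cpow_inv by auto. rewrite Cmod_pow.
    eapply Rle_trans. apply pow_incr. split. apply Cmod_ge_0. apply B1.
    rewrite pow_inv, Rpow_mult_distr, Rinv_mult. unfold Rdiv.
    apply Rmult_le_compat_l. apply Rlt_le, Rinv_0_lt_compat, pow_lt; auto.
    apply pow_ge_3; auto. lia.
Qed.

Lemma eis_reg_is_lsum w v k z kap : 0 < w -> 0 < v -> (1 <= k)%nat -> apart w v nz z kap ->
  is_lsum (masked (fun m n => term k z (lpt w v m n))) (eis_reg w v k z).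
Proof.
  intros Hw Hv Hk1 Hz. destruct (term_sum_bound w v k z kap Hw Hv Hk1 Hz) as [B HB].
  destruct (is_lsum_ex _ B HB) as [s Hs].
  unfold eis_reg. change (is_lsum (masked (fun m n => term k z (lpt w v m n))) (lattice_sum w (Ci * v) (term k z))).
  rewrite (lattice_sum_eq w (Ci * v)%C (term k z) s); auto.
Qed.

Lemma eis_reg_cderiv w v k z kap : 0 < w -> 0 < v -> (1 <= k)%nat -> apart w v nz z kap ->
  cderiv (eis_reg w v k) z (- INR k * eis_reg w v (S k) z)%C.
Proof.
  intros Hw Hv Hk1 Hz. destruct (inv_pow_taylor k) as [c [Hc HT]].
  assert (Hkp : 0 < kap) by apply Hz.
  set (B := c / (kap / 2) ^ (k + 2)).
  assert (HB : 0 <= B) by (apply Rdiv_le_0_compat; auto; apply pow_lt; lra).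
  apply (cderiv_quad _ _ _ (9 * B) (kap / 2)). lra.
  intros h Hh. pose proof (apart_near w v nz z kap h Hz Hh) as Hzh.
  rewrite Rmult_assoc.
  pose (T := fun m n => (masked (fun m n => term k (z + h)%C (lpt w v m n)) m n
      + ((-(1)) * masked (fun m n => term k z (lpt w v m n)) m n
        + (INR k * h) * masked (fun m n => term (S k) z (lpt w v m n)) m n))%C).
  apply (is_lsum_bound T).
  - intros m n. unfold T. pose proof (rho_ge_1 m n).
    pose proof (Cmod_ge_0 h).
    destruct (classic (nz m n)) as [Hn|Hn].
    + rewrite !masked_nz by auto.
      destruct (apart_inv _ _ _ _ _ _ _ Hz Hn) as [N1 _].
      destruct (apart_inv _ _ _ _ _ _ _ Hzh Hn) as [N2 _].
      destruct (apart_0 w v Hw Hv) as [k0 H0'].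
      destruct (lpt_inv _ _ _ _ _ H0' Hn) as [N3 _].
      specialize (HT (z - lpt w v m n)%C h (kap / 2 * rho m n)).
      set (W := lpt w v m n) in *.
      (* The corrections 1 / W, z / W^2 and 1 / W^2 drop out of this combination, which leaves the
         Taylor remainder of the bare power for every k. *)
      replace (term k (z + h) W + (- (1) * term k z W + INR k * h * term (S k) z W))%C
        with (/ (z - W + h) ^ k - / (z - W) ^ k + INR k * h / (z - W) ^ S k)%C.
      2:{ assert (N2' : (z - W + h)%C <> 0%C) by (intros E; apply N2; rewrite <- E; ring).
          replace (z + h - W)%C with (z - W + h)%C in * by ring.
          destruct k as [|[|[|k]]]; [lia| | |]; unfold term;
          replace (z + h - W)%C with (z - W + h)%C in * by ring.
          - simpl. field. auto.
          - simpl. field. auto.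
          - unfold Cdiv. ring. }
      eapply Rle_trans. apply HT.
      * nra.
      * apply Rle_trans with (kap * rho m n). nra. apply Hz; auto.
      * replace (z - W + h)%C with (z + h - W)%C by ring. apply Hzh; auto.
      * rewrite Rpow_mult_distr. unfold B, Rdiv. rewrite Rinv_mult.
        replace (c * (Cmod h * Cmod h) * (/ (kap * / 2) ^ (k + 2) * / rho m n ^ (k + 2)))
         with (c * / (kap * / 2) ^ (k + 2) * (Cmod h * Cmod h) * / rho m n ^ (k + 2)) by ring.
        apply Rmult_le_compat_l.
        apply Rmult_le_pos. apply HB. nra. apply pow_ge_3; auto. lia.
    + unfold nz in Hn. assert (m = 0 /\ n = 0)%Z by tauto. destruct H1 as [-> ->].
      rewrite !masked_0.
      match goal with |- Cmod ?x <= _ => replace x with (RtoC 0) by ring end.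
      rewrite Cmod_0. apply Rdiv_le_0_compat. apply Rmult_le_pos; nra. apply pow_lt. lra.
  - replace (eis_reg w v k (z + h)%C - eis_reg w v k z - - INR k * eis_reg w v (S k) z * h)%C with
     (eis_reg w v k (z + h)%C + ((-(1)) * eis_reg w v k z + (INR k * h) * eis_reg w v (S k) z))%C by ring.
    unfold T. apply (is_lsum_plus (masked (fun m n => term k (z + h)%C (lpt w v m n)))).
    apply (eis_reg_is_lsum w v k _ (kap / 2)); auto.
    apply (is_lsum_plus (fun m n => -(1) * masked (fun m n => term k z (lpt w v m n)) m n)%C).
    apply is_lsum_scal. apply (eis_reg_is_lsum w v k _ kap); auto.
    apply is_lsum_scal. apply (eis_reg_is_lsum w v (S k) _ kap); auto.
Qed.

Lemma inv_pow_cderiv k (z : C) : z <> 0%C -> cderiv (fun z => / z ^ k)%C z (- INR k * / z ^ S k)%C.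
Proof.
  intros Hz. destruct (inv_pow_taylor k) as [c [Hc HT]]. apply (proj1 (Cmod_gt_0 z)) in Hz.
  apply (cderiv_quad _ _ _ (c / (Cmod z / 2) ^ (k + 2)) (Cmod z / 2)). lra.
  intros h Hh. specialize (HT z h (Cmod z / 2) ltac:(lra) ltac:(lra)).
  replace (/ (z + h) ^ k - / z ^ k - - INR k * / z ^ S k * h)%C
    with (/ (z + h) ^ k - / z ^ k + INR k * h / z ^ S k)%C by (unfold Cdiv; ring).
  eapply Rle_trans. apply HT.
  - pose proof (Cmod_split z (z + h)%C). replace (z - (z + h))%C with (- h)%C in H by ring.
    rewrite Cmod_opp in H. lra.
  - right. unfold Rdiv. ring.
Qed.

Lemma zero_in_lattice (w v : R) : in_lattice w (Ci * v)%C 0%C.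
Proof. exists 0%Z, 0%Z. symmetry. apply (lpt_0 w v). Qed.

Lemma eis_cderiv (w v : R) k z : 0 < w -> 0 < v -> (1 <= k)%nat -> ~ in_lattice w (Ci * v)%C z ->
  cderiv (eis w v k) z (- INR k * eis w v (S k) z)%C.
Proof.
  intros Hw Hv Hk1 Hz. destruct (apart_of_notin w v z Hw Hv Hz) as [kap Ha].
  unfold eis. replace (- INR k * (/ z ^ S k + eis_reg w v (S k) z))%C
    with (- INR k * / z ^ S k + - INR k * eis_reg w v (S k) z)%C by ring.
  apply cderiv_plus. apply inv_pow_cderiv. intros ->. apply Hz, zero_in_lattice.
  apply (eis_reg_cderiv w v k z kap); auto. apply apart_weaken; auto.
Qed.

Lemma rho_opp m n : rho (- m) (- n) = rho m n.
Proof. unfold rho. rewrite !Z.abs_opp. reflexivity. Qed.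

Lemma nz_opp m n : nz m n -> nz (- m) (- n).
Proof. unfold nz. lia. Qed.

Lemma apart_nz_opp (w v : R) z kap : apart w v nz z kap -> apart w v nz (- z)%C kap.
Proof.
  intros [Hk H]. split; auto. intros m n Hn. rewrite <- rho_opp.
  eapply Rle_trans. apply H. apply nz_opp; auto. rewrite lpt_opp.
  rewrite <- Cmod_opp. right. f_equal. ring.
Qed.

(** The reindexing (m, n) |-> (- m, - n) preserves the squares of summation; [c] is the sign of the
    parity. *)
Lemma eis_reg_neg (w v : R) k c z kap : 0 < w -> 0 < v -> (1 <= k)%nat -> apart w v nz z kap ->
  (forall W : C, W <> 0%C -> (z + W)%C <> 0%C -> term k (- z) W = (c * term k z (- W))%C) ->
  eis_reg w v k (- z)%C = (c * eis_reg w v k z)%C.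
Proof.
  intros Hw Hv Hk1 Hz HT. pose proof (apart_nz_opp _ _ _ _ Hz) as Hz'.
  destruct (apart_0 w v Hw Hv) as [k0 H0].
  apply (is_lsum_unique (masked (fun m n => term k (- z)%C (lpt w v m n)))).
  - apply (eis_reg_is_lsum w v k _ kap); auto.
  - apply (is_lsum_ext (fun m n => c * masked (fun m n => term k z (lpt w v m n)) (- m)%Z (- n)%Z)%C).
    + intros m n. destruct (masked_cases (fun m n => term k (- z)%C (lpt w v m n)) m n) as [[Hn ->]|[-> [-> ->]]].
      * rewrite masked_nz by (apply nz_opp; auto). rewrite lpt_opp.
        symmetry. apply HT. apply (lpt_inv w v k0 m n H0 Hn).
        destruct (apart_inv w v nz _ _ m n Hz' Hn) as [N _].
        intros E. apply N. replace (- z - lpt w v m n)%C with (- (z + lpt w v m n))%C by ring.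
        rewrite E. ring.
      * simpl. rewrite masked_0. ring.
    + apply is_lsum_scal. apply (is_lsum_opp_index (masked (fun m n => term k z (lpt w v m n)))).
      apply (eis_reg_is_lsum w v k _ kap); auto.
Qed.

Lemma Copp_nz (W : C) : W <> 0%C -> (- W)%C <> 0%C.
Proof. intros H E. apply H. replace W with (- - W)%C by ring. rewrite E. ring. Qed.

Lemma eis_reg1_odd (w v : R) z kap : 0 < w -> 0 < v -> apart w v nz z kap ->
  eis_reg w v 1 (- z)%C = (- eis_reg w v 1 z)%C.
Proof.
  intros Hw Hv Hz. replace (- eis_reg w v 1 z)%C with (- (1) * eis_reg w v 1 z)%C by ring.
  apply (eis_reg_neg w v 1 _ z kap); auto. intros W H1 H2. unfold term.
  pose proof (Copp_nz W H1). pose proof (Copp_nz _ H2) as H3.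
  replace (- (z + W))%C with (- z - W)%C in H3 by ring.
  replace (z - - W)%C with (z + W)%C by ring. field. auto.
Qed.

Lemma eis_reg2_even (w v : R) z kap : 0 < w -> 0 < v -> apart w v nz z kap ->
  eis_reg w v 2 (- z)%C = (eis_reg w v 2 z)%C.
Proof.
  intros Hw Hv Hz. replace (eis_reg w v 2 z)%C with (1 * eis_reg w v 2 z)%C by ring.
  apply (eis_reg_neg w v 2 _ z kap); auto. intros W H1 H2. unfold term.
  pose proof (Copp_nz W H1). pose proof (Copp_nz _ H2) as H3.
  replace (- (z + W))%C with (- z - W)%C in H3 by ring.
  replace (z - - W)%C with (z + W)%C by ring. field. auto.
Qed.

Lemma eis_reg3_odd (w v : R) z kap : 0 < w -> 0 < v -> apart w v nz z kap ->
  eis_reg w v 3 (- z)%C = (- eis_reg w v 3 z)%C.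
Proof.
  intros Hw Hv Hz. replace (- eis_reg w v 3 z)%C with (- (1) * eis_reg w v 3 z)%C by ring.
  apply (eis_reg_neg w v 3 _ z kap); auto. intros W H1 H2. unfold term.
  pose proof (Copp_nz _ H2) as H3.
  replace (- (z + W))%C with (- z - W)%C in H3 by ring.
  replace (z - - W)%C with (z + W)%C by ring. field. auto.
Qed.

Lemma notin_nonzero (w v : R) z : ~ in_lattice w (Ci * v)%C z -> z <> 0%C.
Proof. intros H ->. apply H, zero_in_lattice. Qed.

Lemma in_lattice_opp (w v : R) z : in_lattice w (Ci * v)%C (- z)%C <-> in_lattice w (Ci * v)%C z.
Proof.
  assert (K : forall z, in_lattice w (Ci * v)%C z -> in_lattice w (Ci * v)%C (- z)%C).
  { intros y [m [n E]]. exists (- m)%Z, (- n)%Z. fold (lpt w v m n) in E.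
    fold (lpt w v (- m) (- n)). rewrite lpt_opp, E. reflexivity. }
  split; auto. intros H. replace z with (- - z)%C by ring. auto.
Qed.

Lemma eis1_odd (w v : R) z : 0 < w -> 0 < v -> ~ in_lattice w (Ci * v)%C z ->
  eis w v 1 (- z)%C = (- eis w v 1 z)%C.
Proof.
  intros Hw Hv Hz. destruct (apart_of_notin w v z Hw Hv Hz) as [kap Ha].
  unfold eis. rewrite (eis_reg1_odd w v z kap) by (auto; apply apart_weaken; auto).
  pose proof (notin_nonzero _ _ _ Hz). pose proof (Copp_nz _ H). field. auto.
Qed.

Lemma eis2_even (w v : R) z : 0 < w -> 0 < v -> ~ in_lattice w (Ci * v)%C z ->
  eis w v 2 (- z)%C = (eis w v 2 z)%C.
Proof.
  intros Hw Hv Hz. destruct (apart_of_notin w v z Hw Hv Hz) as [kap Ha].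
  unfold eis. rewrite (eis_reg2_even w v z kap) by (auto; apply apart_weaken; auto).
  pose proof (notin_nonzero _ _ _ Hz). pose proof (Copp_nz _ H). field. auto.
Qed.

Lemma eis3_odd (w v : R) z : 0 < w -> 0 < v -> ~ in_lattice w (Ci * v)%C z ->
  eis w v 3 (- z)%C = (- eis w v 3 z)%C.
Proof.
  intros Hw Hv Hz. destruct (apart_of_notin w v z Hw Hv Hz) as [kap Ha].
  unfold eis. rewrite (eis_reg3_odd w v z kap) by (auto; apply apart_weaken; auto).
  pose proof (notin_nonzero _ _ _ Hz). pose proof (Copp_nz _ H). field. auto.
Qed.

(** * Periods and quasi-periods *)

Definition is_period (w v : R) (P : C) : Prop := P = RtoC (2 * w) \/ P = (RtoC (2 * v) * Ci)%C.

Lemma in_lattice_period (w v : R) P z : is_period w v P ->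
  (in_lattice w (Ci * v)%C (z + P)%C <-> in_lattice w (Ci * v)%C z).
Proof.
  assert (K : forall m n m' n' z, z = lpt w v m n -> in_lattice w (Ci * v)%C (z + lpt w v m' n')%C).
  { intros m n m' n' y ->. exists (m + m')%Z, (n + n')%Z. symmetry. apply (lpt_add w v). }
  intros [-> | ->]; split; intros [m [n E]]; fold (lpt w v m n) in E.
  - replace z with (z + RtoC (2 * w) + lpt w v (-1) 0)%C. apply (K m n); auto.
    rewrite lpt_eq. destruct z. unfold Cplus, RtoC; simpl. f_equal; ring.
  - replace (RtoC (2 * w)) with (lpt w v 1 0). apply (K m n); auto.
    rewrite lpt_eq. unfold RtoC; f_equal; ring.
  - replace z with (z + RtoC (2 * v) * Ci + lpt w v 0 (-1))%C. apply (K m n); auto.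
    rewrite lpt_eq. destruct z. unfold Cplus, Cmult, Ci, RtoC; simpl. f_equal; ring.
  - replace (RtoC (2 * v) * Ci)%C with (lpt w v 0 1). apply (K m n); auto.
    rewrite lpt_eq. unfold Cmult, Ci, RtoC; simpl. f_equal; ring.
Qed.

(** Puts the pole at the origin back into the sum as its term at (0, 0), so that a translation by a
    period permutes terms of one kind. *)
Definition delta (m n : Z) : C := if andb (m =? 0)%Z (n =? 0)%Z then RtoC 1 else RtoC 0.

Lemma zsum_delta (c : C) N : zsum (fun n => if (n =? 0)%Z then c else RtoC 0) N = c.
Proof.
  induction N; cbn [zsum]. reflexivity. rewrite IHN.
  replace (Z.of_nat (S N) =? 0)%Z with false by (symmetry; apply Z.eqb_neq; lia).
  replace (- Z.of_nat (S N) =? 0)%Z with false by (symmetry; apply Z.eqb_neq; lia). ring.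
Qed.

Lemma zsum_0 N : zsum (fun _ => RtoC 0) N = 0%C.
Proof. induction N; cbn [zsum]. reflexivity. rewrite IHN. ring. Qed.

Lemma is_lsum_delta : is_lsum delta 1%C.
Proof.
  intros eps He. exists O. intros N _.
  replace (psum delta N) with (RtoC 1).
  replace (1 - 1)%C with (RtoC 0) by ring. rewrite Cmod_0; auto.
  unfold psum. rewrite <- (zsum_delta 1%C N) at 1. apply zsum_ext. intros m.
  unfold delta. destruct (m =? 0)%Z; simpl.
  - symmetry. apply zsum_delta.
  - symmetry. apply zsum_0.
Qed.

Lemma eis_is_lsum (w v : R) k z : 0 < w -> 0 < v -> (1 <= k)%nat -> ~ in_lattice w (Ci * v)%C z ->
  is_lsum (fun m n => / z ^ k * delta m n + masked (fun m n => term k z (lpt w v m n)) m n)%C (eis w v k z).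
Proof.
  intros Hw Hv Hk1 Hz. destruct (apart_of_notin w v z Hw Hv Hz) as [kap Ha].
  unfold eis. replace (/ z ^ k + eis_reg w v k z)%C with (/ z ^ k * 1 + eis_reg w v k z)%C by ring.
  apply (is_lsum_plus (fun m n => / z ^ k * delta m n)%C).
  apply is_lsum_scal, is_lsum_delta.
  apply (eis_reg_is_lsum w v k z kap); auto. apply apart_weaken; auto.
Qed.

(** The summand is split into the part [g] that moves with the lattice and the convergence
    correction [q] that stays in place. Only [g] has boundary terms, and decay of order 2 makes them
    vanish in the limit. *)
Lemma is_lsum_shift (w v : R) P g q s B : is_period w v P ->
  (forall m n, Cmod (g (lpt w v m n)) <= B / rho m n ^ 2) ->
  is_lsum (fun m n => g (lpt w v m n) + q m n)%C s ->
  is_lsum (fun m n => g (lpt w v m n + P)%C + q m n)%C s.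
Proof.
  intros HP HB. apply is_lsum_close. intros eps He.
  assert (K : exists N0, forall N, (N0 <= N)%nat ->
    Cmod (psum (fun m n => g (lpt w v m n + P)%C) N - psum (fun m n => g (lpt w v m n)) N)%C < eps).
  { destruct HP as [-> | ->].
    - destruct (psum_shift_1 (fun m n => g (lpt w v m n)) B HB eps He) as [N0 HN].
      exists N0. intros N HN'. specialize (HN N HN').
      rewrite (psum_ext (fun m n => g (lpt w v m n + RtoC (2 * w))%C) (fun m n => g (lpt w v (m + 1) n))); auto.
      intros; rewrite lpt_succ_1; auto.
    - destruct (psum_shift_2 (fun m n => g (lpt w v m n)) B HB eps He) as [N0 HN].
      exists N0. intros N HN'. specialize (HN N HN').
      rewrite (psum_ext (fun m n => g (lpt w v m n + RtoC (2 * v) * Ci)%C) (fun m n => g (lpt w v m (n + 1)))); auto.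
      intros; rewrite lpt_succ_2; auto. }
  destruct K as [N0 HN]. exists N0. intros N HN'. specialize (HN N HN').
  rewrite !psum_plus. rewrite Cmod_minus_sym.
  match goal with |- Cmod ?x < _ => match type of HN with Cmod ?y < _ => replace x with y by ring end end.
  auto.
Qed.

Lemma term_cases k z (w v : R) (g q : C -> C) m n :
  (forall W, term k z W = g W + q W)%C ->
  (/ z ^ k)%C = g 0%C ->
  (/ z ^ k * delta m n + masked (fun m n => term k z (lpt w v m n)) m n)%C
  = (g (lpt w v m n) + masked (fun m n => q (lpt w v m n)) m n)%C.
Proof.
  intros H1 H2. unfold masked, delta.
  destruct (Z.eqb_spec m 0), (Z.eqb_spec n 0); simpl; rewrite ?H1; subst; try ring.
  rewrite lpt_0, H2. ring.
Qed.

Lemma eis2_lsum' (w v : R) z : 0 < w -> 0 < v -> ~ in_lattice w (Ci * v)%C z ->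
  is_lsum (fun m n => / (z - lpt w v m n) ^ 2 + masked (fun m n => - / (lpt w v m n) ^ 2) m n)%C (eis w v 2 z).
Proof.
  intros Hw Hv Hz. eapply is_lsum_ext; [|apply (eis_is_lsum w v 2 z); auto].
  intros m n. apply (term_cases 2 z w v (fun W => / (z - W) ^ 2)%C (fun W => - / W ^ 2)%C).
  - intros W. reflexivity.
  - replace (z - 0)%C with z by ring. reflexivity.
Qed.

Lemma eis2_period_minus (w v : R) P z : 0 < w -> 0 < v -> is_period w v P ->
  ~ in_lattice w (Ci * v)%C z -> ~ in_lattice w (Ci * v)%C (z - P)%C ->
  eis w v 2 (z - P)%C = eis w v 2 z.
Proof.
  intros Hw Hv HP Hz Hz'. destruct (apart_of_notin w v z Hw Hv Hz) as [kap Ha].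
  eapply is_lsum_unique. apply (eis2_lsum' w v); auto.
  eapply is_lsum_ext; [|eapply (is_lsum_shift w v P (fun W => / (z - W) ^ 2)%C
     (masked (fun m n => - / (lpt w v m n) ^ 2)%C) _ (/ kap ^ 2) HP)].
  - intros m n. cbv beta. replace (z - (lpt w v m n + P))%C with (z - P - lpt w v m n)%C by ring. reflexivity.
  - intros m n. destruct (apart_inv _ _ _ _ _ m n Ha I) as [N1 B1].
    rewrite <- Cpow_inv, Cmod_pow by eauto.
    eapply Rle_trans. apply pow_incr. split. apply Cmod_ge_0. apply (apart_inv w v _ z kap m n Ha I).
    rewrite pow_inv, Rpow_mult_distr, Rinv_mult. right. reflexivity.
  - apply eis2_lsum'; auto.
Qed.

Lemma notin_period (w v : R) P z : is_period w v P ->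
  ~ in_lattice w (Ci * v)%C z -> ~ in_lattice w (Ci * v)%C (z + P)%C.
Proof. intros HP H. rewrite in_lattice_period; auto. Qed.

Lemma eis2_period (w v : R) P z : 0 < w -> 0 < v -> is_period w v P ->
  ~ in_lattice w (Ci * v)%C z -> eis w v 2 (z + P)%C = eis w v 2 z.
Proof.
  intros Hw Hv HP Hz. pose proof (notin_period _ _ _ _ HP Hz).
  rewrite <- (eis2_period_minus w v P (z + P)%C); auto;
  replace (z + P - P)%C with z by ring; auto.
Qed.

(** A single 1 / (z - W) decays only to first order, too slowly for [is_lsum_shift]; the difference
    of two such terms decays to second order. *)
Lemma eis1_period_minus (w v : R) P z1 z2 : 0 < w -> 0 < v -> is_period w v P ->
  ~ in_lattice w (Ci * v)%C z1 -> ~ in_lattice w (Ci * v)%C (z1 - P)%C ->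
  ~ in_lattice w (Ci * v)%C z2 -> ~ in_lattice w (Ci * v)%C (z2 - P)%C ->
  (eis w v 1 (z1 - P) + - (1) * eis w v 1 (z2 - P))%C = (eis w v 1 z1 + - (1) * eis w v 1 z2)%C.
Proof.
  intros Hw Hv HP Hz1 Hz1' Hz2 Hz2'.
  destruct (apart_of_notin w v z1 Hw Hv Hz1) as [k1 A1].
  destruct (apart_of_notin w v z2 Hw Hv Hz2) as [k2 A2].
  pose (g := fun W : C => (/ (z1 - W) + - (1) * / (z2 - W))%C).
  pose (q := masked (fun m n => (z1 - z2) / (lpt w v m n) ^ 2)%C).
  assert (K : forall y1 y2, ~ in_lattice w (Ci * v)%C y1 -> ~ in_lattice w (Ci * v)%C y2 ->
    (y1 - y2 = z1 - z2)%C ->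
    is_lsum (fun m n => (/ (y1 - lpt w v m n) + - (1) * / (y2 - lpt w v m n)) + q m n)%C
      (eis w v 1 y1 + - (1) * eis w v 1 y2)%C).
  { intros y1 y2 H1 H2 E.
    eapply is_lsum_ext; [|apply is_lsum_plus; [apply (eis_is_lsum w v 1 y1); auto|
      apply is_lsum_scal; apply (eis_is_lsum w v 1 y2); auto]].
    intros m n. cbv beta.
    rewrite (term_cases 1 y1 w v (fun W => / (y1 - W))%C (fun W => / W + y1 / W ^ 2)%C).
    rewrite (term_cases 1 y2 w v (fun W => / (y2 - W))%C (fun W => / W + y2 / W ^ 2)%C).
    unfold q, masked. destruct andb. ring. rewrite <- E. unfold Cdiv. ring.
    intros W. unfold term. ring. rewrite Cpow_1_r. f_equal. ring.
    intros W. unfold term. ring. rewrite Cpow_1_r. f_equal. ring. }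
  eapply is_lsum_unique. apply (K (z1 - P)%C (z2 - P)%C); auto. ring.
  eapply is_lsum_ext; [|eapply (is_lsum_shift w v P g q _ (Cmod (z2 - z1)%C / (k1 * k2)) HP)].
  - intros m n. cbv beta. unfold g. 
    replace (z1 - (lpt w v m n + P))%C with (z1 - P - lpt w v m n)%C by ring.
    replace (z2 - (lpt w v m n + P))%C with (z2 - P - lpt w v m n)%C by ring. reflexivity.
  - intros m n. destruct (apart_inv _ _ _ _ _ m n A1 I) as [N1 B1].
    destruct (apart_inv _ _ _ _ _ m n A2 I) as [N2 B2].
    unfold g. replace (/ (z1 - lpt w v m n) + - (1) * / (z2 - lpt w v m n))%C
      with ((z2 - z1) * (/ (z1 - lpt w v m n) * / (z2 - lpt w v m n)))%C by (field; auto).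
    rewrite !Cmod_mult. pose proof (rho_ge_1 m n).
    assert (0 < k1) by apply A1. assert (0 < k2) by apply A2.
    replace (Cmod (z2 - z1) / (k1 * k2) / rho m n ^ 2) with
      (Cmod (z2 - z1) * (/ (k1 * rho m n) * / (k2 * rho m n))) by (field; lra).
    apply Rmult_le_compat_l. apply Cmod_ge_0. apply Rmult_le_compat; auto; apply Cmod_ge_0.
  - apply K; auto.
Qed.

(* The increments at two points differ by boundary terms of the partial sums,
   which tend to 0; thus no path from [z1] to [z2] is needed. *)
Lemma eis1_quasi_period (w v : R) P z1 z2 : 0 < w -> 0 < v -> is_period w v P ->
  ~ in_lattice w (Ci * v)%C z1 -> ~ in_lattice w (Ci * v)%C z2 ->
  (eis w v 1 (z1 + P) - eis w v 1 z1 = eis w v 1 (z2 + P) - eis w v 1 z2)%C.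
Proof.
  intros Hw Hv HP H1 H2.
  pose proof (notin_period _ _ _ _ HP H1). pose proof (notin_period _ _ _ _ HP H2).
  pose proof (eis1_period_minus w v P (z1 + P)%C (z2 + P)%C Hw Hv HP) as E.
  replace (z1 + P - P)%C with z1 in E by ring. replace (z2 + P - P)%C with z2 in E by ring.
  specialize (E H H1 H0 H2).
  assert (eis w v 1 (z1 + P)%C = eis w v 1 (z2 + P)%C + (eis w v 1 z1 + - (1) * eis w v 1 z2))%C
   by (rewrite E; ring).
  rewrite H3. ring.
Qed.

Lemma notin_open (w v : R) z : 0 < w -> 0 < v -> ~ in_lattice w (Ci * v)%C z ->
  exists d, 0 < d /\ forall z', Cmod (z' - z)%C < d -> ~ in_lattice w (Ci * v)%C z'.
Proof.
  intros Hw Hv Hz. destruct (apart_of_notin w v z Hw Hv Hz) as [kap Ha].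
  exists (kap / 2). split. destruct Ha; lra. intros z' H.
  apply (apart_notin w v z' (kap / 2)). replace z' with (z + (z' - z))%C by ring.
  apply apart_near; auto.
Qed.

(** Beyond k = 2 periodicity passes to the derivative, which is a nonzero multiple of the next
    series. *)
Lemma eis_period (w v : R) k P z : 0 < w -> 0 < v -> (2 <= k)%nat -> is_period w v P ->
  ~ in_lattice w (Ci * v)%C z -> eis w v k (z + P)%C = eis w v k z.
Proof.
  intros Hw Hv Hk2 HP. revert z. induction Hk2 as [|k Hk2 IH]; intros z Hz.
  - apply eis2_period; auto.
  - destruct (notin_open w v z Hw Hv Hz) as [d [Hd H]].
    pose proof (eis_cderiv w v k (z + P)%C Hw Hv ltac:(lia) (notin_period _ _ _ _ HP Hz)) as D1.
    apply cderiv_shift in D1.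
    assert (D2 : cderiv (eis w v k) z (- INR k * eis w v (S k) (z + P)%C)%C).
    { apply (cderiv_ext_loc (fun z => eis w v k (z + P)%C) _ _ _ d); auto. }
    pose proof (cderiv_unique _ _ _ _ D2 (eis_cderiv w v k z Hw Hv ltac:(lia) Hz)) as E.
    assert (N : (- INR k)%C <> 0%C).
    { apply Copp_nz. intros E'. apply RtoC_inj in E'. apply (not_0_INR k); auto. lia. }
    replace (eis w v (S k) (z + P)%C) with (/ - INR k * (- INR k * eis w v (S k) (z + P)))%C
      by (field; intros E'; apply RtoC_inj in E'; apply (not_0_INR k); auto; lia).
    rewrite E. field. intros E'; apply RtoC_inj in E'; apply (not_0_INR k); auto; lia.
Qed.

(** Passage from the two generators to the whole lattice, used to move a singular point to the
    origin. The domain [D] keeps the values at poles out of the statement. *)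
Lemma period_all (D : C -> Prop) (w v : R) (F : C -> C) :
  (forall P z, is_period w v P -> (D (z + P)%C <-> D z)) ->
  (forall P z, is_period w v P -> D z -> F (z + P)%C = F z) ->
  forall m n z, D z -> D (z + lpt w v m n)%C /\ F (z + lpt w v m n)%C = F z.
Proof.
  intros HD HF.
  assert (N : forall P, is_period w v P -> forall (k : nat) z, D z -> D (z + INR k * P)%C /\ F (z + INR k * P)%C = F z).
  { intros P HP. induction k; intros z Hz.
    - simpl. replace (z + 0 * P)%C with z by ring. auto.
    - rewrite S_INR, RtoC_plus. replace (z + (INR k + 1) * P)%C with (z + INR k * P + P)%C by ring.
      destruct (IHk z Hz) as [H1 H2]. split. apply HD; auto. rewrite HF; auto. }
  assert (NN : forall P, is_period w v P -> forall (k : nat) z, D z -> D (z - INR k * P)%C).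
  { intros P HP. induction k; intros z Hz.
    - simpl. replace (z - 0 * P)%C with z by ring. auto.
    - rewrite S_INR, RtoC_plus. apply (HD P); auto.
      replace (z - (INR k + 1) * P + P)%C with (z - INR k * P)%C by ring. auto. }
  assert (Zc : forall P, is_period w v P -> forall (k : Z) z, D z -> D (z + IZR k * P)%C /\ F (z + IZR k * P)%C = F z).
  { intros P HP k z Hz. destruct (Z_le_gt_dec 0 k) as [Hk|Hk].
    - rewrite <- (Z2Nat.id k) by lia. rewrite <- INR_IZR_INZ. auto.
    - replace (IZR k) with (- INR (Z.to_nat (- k))).
      2:{ rewrite INR_IZR_INZ, Z2Nat.id, opp_IZR by lia. ring. }
      rewrite RtoC_opp. replace (z + - INR (Z.to_nat (- k)) * P)%C with (z - INR (Z.to_nat (- k)) * P)%C by ring.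
      pose proof (NN P HP (Z.to_nat (- k)) z Hz) as H. split; auto.
      destruct (N P HP (Z.to_nat (- k)) _ H) as [_ E]. rewrite <- E. f_equal. ring. }
  intros m n z Hz.
  replace (z + lpt w v m n)%C with (z + IZR m * RtoC (2 * w) + IZR n * (RtoC (2 * v) * Ci))%C.
  2:{ rewrite lpt_eq. destruct z. unfold Cplus, Cmult, Ci, RtoC; simpl. f_equal; ring. }
  destruct (Zc (RtoC (2 * w)) (or_introl eq_refl) m z Hz) as [H1 H2].
  destruct (Zc (RtoC (2 * v) * Ci)%C (or_intror eq_refl) n _ H1) as [H3 H4].
  split; auto. rewrite H4. auto.
Qed.

Ltac inr_ring := rewrite INR_IZR_INZ; simpl Z.of_nat; ring.

Lemma cderiv_eq f z l m : cderiv f z l -> l = m -> cderiv f z m.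
Proof. intros H <-. exact H. Qed.

Lemma eis_cderiv' (w v : R) k z l : 0 < w -> 0 < v -> (1 <= k)%nat -> ~ in_lattice w (Ci * v)%C z ->
  l = (- INR k * eis w v (S k) z)%C -> cderiv (eis w v k) z l.
Proof. intros Hw Hv Hk1 Hz ->. apply eis_cderiv; auto. Qed.

Lemma eis_reg_cderiv_near0 (w v : R) : 0 < w -> 0 < v -> exists r, 0 < r /\
  forall z, Cmod z < r -> forall k, (1 <= k)%nat -> cderiv (eis_reg w v k) z (- INR k * eis_reg w v (S k) z)%C.
Proof.
  intros Hw Hv. destruct (apart_0 w v Hw Hv) as [kap Ha]. exists (kap / 2).
  split. destruct Ha; lra. intros z Hz k Hk1. apply (eis_reg_cderiv w v k z (kap / 2)); auto.
  replace z with (0 + z)%C by ring. apply apart_near; auto.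
Qed.

Lemma eis_reg2_0 (w v : R) : 0 < w -> 0 < v -> eis_reg w v 2 0%C = 0%C.
Proof.
  intros Hw Hv. destruct (apart_0 w v Hw Hv) as [kap Ha].
  eapply is_lsum_unique. apply (eis_reg_is_lsum w v 2 0%C kap); auto.
  apply (is_lsum_ext (fun m n => 0 * delta m n)%C).
  - intros m n. destruct (masked_cases (fun m n => term 2 0%C (lpt w v m n)) m n) as [[Hn ->]|[_ [_ ->]]].
    + unfold term. destruct (lpt_inv w v kap m n Ha Hn) as [N _]. field. auto.
    + ring.
  - pose proof (is_lsum_scal 0%C _ _ is_lsum_delta) as HS. rewrite Cmult_0_l in HS. exact HS.
Qed.

Lemma eis_reg3_0 (w v : R) : 0 < w -> 0 < v -> eis_reg w v 3 0%C = 0%C.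
Proof.
  intros Hw Hv. destruct (apart_0 w v Hw Hv) as [kap Ha].
  pose proof (eis_reg3_odd w v 0%C kap Hw Hv Ha) as E. replace (- 0)%C with (RtoC 0) in E by ring.
  set (x := eis_reg w v 3 0%C) in *. replace x with (/ 2 * (x - - x))%C by field.
  rewrite <- E. ring.
Qed.

(** The beginning of the Laurent expansion wp = 1 / z^2 + (g2 / 20) z^2 + ...; the linear term
    vanishes because the derivative of the regular part is odd. *)
Lemma eis_reg2_taylor (w v : R) : 0 < w -> 0 < v -> forall eps, 0 < eps -> exists del, 0 < del /\
  forall z, Cmod z < del -> Cmod (eis_reg w v 2 z - 3 * eis_reg w v 4 0 * z ^ 2)%C <= eps * Cmod z ^ 2.
Proof.
  intros Hw Hv. destruct (eis_reg_cderiv_near0 w v Hw Hv) as [r [Hr Hd]].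
  intros eps He.
  destruct (taylor2 (eis_reg w v 2) (fun z => - 2 * eis_reg w v 3 z)%C (fun z => 6 * eis_reg w v 4 z)%C r Hr) with (eps := eps)
    as [d [Hd0 H]]; auto.
  - intros z Hz. split.
    + eapply cderiv_eq. apply Hd; auto. inr_ring.
    + eapply cderiv_eq. apply cderiv_scal. apply Hd; auto. inr_ring.
  - apply ccontinuous_scal. eapply cderiv_ccontinuous. apply Hd; auto. rewrite Cmod_0; auto.
  - apply eis_reg2_0; auto.
  - cbv beta. rewrite eis_reg3_0 by auto. ring.
  - exists d. split; auto. intros z Hz. specialize (H z Hz).
    replace (3 * eis_reg w v 4 0 * z ^ 2)%C with (6 * eis_reg w v 4 0 / 2 * z ^ 2)%C by field. auto.
Qed.

Lemma Cmod_div_pow_le (x z : C) eps k : z <> 0%C -> Cmod x <= eps * Cmod z ^ k ->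
  Cmod (x / z ^ k)%C <= eps.
Proof.
  intros Hz H. rewrite Cmod_div by (apply Cpow_nz; auto). rewrite Cmod_pow.
  apply (proj1 (Cmod_gt_0 z)) in Hz. apply Rle_div_l. apply pow_lt; auto. auto.
Qed.

(** * Differential equations and the addition formula *)

(* At 0, [wp'' / 6 - wp^2] tends to [c0 - 2 * 3 c0 = - 5 c0] with [c0 = eis_reg 4 0 = g2 / 60]. *)
Lemma wp_second_order (w v : R) z : 0 < w -> 0 < v -> ~ in_lattice w (Ci * v)%C z ->
  (eis w v 4 z = eis w v 2 z * eis w v 2 z - 5 * eis_reg w v 4 0)%C.
Proof.
  intros Hw Hv Hz.
  set (E := eis w v). set (c0 := eis_reg w v 4 0%C).
  pose (f := fun z => (E 4%nat z - E 2%nat z * E 2%nat z + 5 * c0)%C).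
  assert (HP : forall P z, is_period w v P -> ~ in_lattice w (Ci * v)%C z -> f (z + P)%C = f z).
  { intros P y HP Hy. unfold f, E. rewrite !(eis_period w v _ P y); auto. }
  assert (F0 : f z = 0%C).
  2:{ unfold f in F0. fold E c0.
      replace (E 4%nat z) with ((E 4%nat z - E 2%nat z * E 2%nat z + 5 * c0) + (E 2%nat z * E 2%nat z - 5 * c0))%C by ring.
      rewrite F0. ring. }
  apply (liouville_torus (2 * w) (2 * v) f
     (fun z => - 4 * E 5%nat z - ((- 2 * E 3%nat z) * E 2%nat z + E 2%nat z * (- 2 * E 3%nat z)))%C
     (fun z => - 4 * (- 5 * E 6%nat z) -
       (((- 2 * (- 3 * E 4%nat z)) * E 2%nat z + (- 2 * E 3%nat z) * (- 2 * E 3%nat z))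
       + ((- 2 * E 3%nat z) * (- 2 * E 3%nat z) + E 2%nat z * (- 2 * (- 3 * E 4%nat z)))))%C
     (in_lattice w (Ci * v)%C)); auto; try lra.
  - intros y. apply in_lattice_period. left; auto.
  - intros y. apply in_lattice_period. right; auto.
  - intros y Hy. apply HP; auto. left; auto.
  - intros y Hy. apply HP; auto. right; auto.
  - intros y Hy.
    assert (D : forall k l, (1 <= k)%nat -> l = (- INR k * E (S k) y)%C -> cderiv (E k) y l).
    { intros k l Hk1 ->. apply eis_cderiv; auto. }
    assert (D2 : cderiv (E 2%nat) y (-2 * E 3%nat y)%C) by (apply D; [lia|inr_ring]).
    assert (D3 : cderiv (E 3%nat) y (-3 * E 4%nat y)%C) by (apply D; [lia|inr_ring]).
    assert (D4 : cderiv (E 4%nat) y (-4 * E 5%nat y)%C) by (apply D; [lia|inr_ring]).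
    assert (D5 : cderiv (E 5%nat) y (-5 * E 6%nat y)%C) by (apply D; [lia|inr_ring]).
    split.
    + unfold f. eapply cderiv_eq. apply (cderiv_plus (fun z => E 4%nat z - E 2%nat z * E 2%nat z)%C (fun _ => 5 * c0)%C).
      apply cderiv_minus. apply D4. apply cderiv_mult; apply D2. apply cderiv_const. ring.
    + apply cderiv_minus. apply cderiv_scal, D5. apply cderiv_plus.
      * apply (cderiv_mult (fun z => -2 * E 3%nat z)%C). apply cderiv_scal, D3. apply D2.
      * apply (cderiv_mult (E 2%nat) (fun z => -2 * E 3%nat z)%C). apply D2. apply cderiv_scal, D3.
  - exists 0%C. apply zero_in_lattice.
  - intros y Hy. apply notin_open; auto.
  - intros s [m [n Es]] eps He. fold (lpt w v m n) in Es.
    destruct (eis_reg2_taylor w v Hw Hv (eps / 4) ltac:(lra)) as [d1 [Hd1 H1]].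
    destruct (eis_reg_cderiv_near0 w v Hw Hv) as [r [Hr Hd]].
    pose (phi := fun y => (eis_reg w v 4 y - eis_reg w v 2 y * eis_reg w v 2 y)%C).
    assert (Cphi : ccontinuous phi 0%C).
    { eapply cderiv_ccontinuous. apply cderiv_minus; [|apply cderiv_mult]; apply Hd; auto; rewrite Cmod_0; auto. }
    destruct (Cphi (eps / 2) ltac:(lra)) as [d2 [Hd2 H2]].
    exists (Rmin d1 d2). split. apply Rmin_pos; auto.
    intros y Hy Hys. pose proof (Rmin_l d1 d2). pose proof (Rmin_r d1 d2).
    set (h := (y - s)%C) in *.
    (* Every pole is a translate of 0, so [f] need only be studied near the origin. *)
    assert (Hh : ~ in_lattice w (Ci * v)%C h /\ f y = f h).
    { destruct (period_all (fun z => ~ in_lattice w (Ci * v)%C z) w v f) with (m := (- m)%Z) (n := (- n)%Z) (z := y)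
        as [K1 K2]; auto.
      - intros P x HP'. rewrite in_lattice_period; tauto.
      - rewrite lpt_opp, <- Es in *. split; auto. }
    destruct Hh as [Hh ->].
    pose proof (notin_nonzero _ _ _ Hh) as Nh.
    specialize (H1 h ltac:(lra)). specialize (H2 h). replace (h - 0)%C with h in H2 by ring.
    specialize (H2 ltac:(lra)).
    apply Cmod_div_pow_le in H1; auto.
    assert (P0 : phi 0%C = c0) by (unfold phi; rewrite eis_reg2_0 by auto; fold c0; ring).
    rewrite P0 in H2.
    (* The terms 1 / h^4 cancel, and the cross term of the square, - 2 eis_reg 2 / h^2, contributes
       - 6 c0. *)
    replace (f h) with ((- 2) * ((eis_reg w v 2 h - 3 * eis_reg w v 4 0 * h ^ 2) / h ^ 2) + (phi h - c0))%C.
    2:{ unfold f, E, eis, phi. fold c0. field. auto. }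
    eapply Rle_lt_trans. apply Cmod_triangle. rewrite Cmod_mult.
    replace (Cmod (-2)%C) with 2. lra.
    rewrite Cmod_R, Rabs_left; lra.
Qed.

Lemma notin_Im (w v : R) z : 0 < v -> 0 < Rabs (Im z) < 2 * v -> ~ in_lattice w (Ci * v)%C z.
Proof.
  intros Hv H [m [n E]]. fold (lpt w v m n) in E. rewrite E, lpt_eq in H. simpl in H.
  rewrite Rabs_mult, (Rabs_pos_eq v), Rabs_mult, (Rabs_pos_eq 2), Rabs_Zabs in H by lra.
  destruct (Z.eq_dec n 0) as [->|Hn]. simpl in H. lra.
  assert (1 <= IZR (Z.abs n)) by (apply IZR_le; lia). nra.
Qed.

(** This is wp'^2 - 4 wp^3 + g2 wp, written with wp' = - 2 eis 3 and g2 = 60 eis_reg 4 at 0. *)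
Definition first_integral (w v : R) (z : C) : C :=
  (4 * (eis w v 3 z * eis w v 3 z) - 4 * (eis w v 2 z * (eis w v 2 z * eis w v 2 z))
   + 60 * eis_reg w v 4 0 * eis w v 2 z)%C.

Lemma first_integral_cderiv (w v : R) z : 0 < w -> 0 < v -> ~ in_lattice w (Ci * v)%C z ->
  cderiv (first_integral w v) z 0%C.
Proof.
  intros Hw Hv Hz. pose proof (wp_second_order w v z Hw Hv Hz) as HO.
  set (c0 := eis_reg w v 4 0%C) in *. unfold first_integral. fold c0.
  assert (D2 : cderiv (eis w v 2) z (-2 * eis w v 3 z)%C) by (apply eis_cderiv'; auto; inr_ring).
  assert (D3 : cderiv (eis w v 3) z (-3 * eis w v 4 z)%C) by (apply eis_cderiv'; auto; inr_ring).
  eapply cderiv_eq.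
  - apply (cderiv_plus (fun z => 4 * (eis w v 3 z * eis w v 3 z) - 4 * (eis w v 2 z * (eis w v 2 z * eis w v 2 z)))%C).
    + apply cderiv_minus.
      * apply (cderiv_scal 4%C (fun z => eis w v 3 z * eis w v 3 z)%C). apply cderiv_mult; apply D3.
      * apply (cderiv_scal 4%C (fun z => eis w v 2 z * (eis w v 2 z * eis w v 2 z))%C).
        apply (cderiv_mult (eis w v 2)). apply D2. apply cderiv_mult; apply D2.
    + apply cderiv_scal. apply D2.
  - rewrite HO. ring.
Qed.

(** The path goes vertically away from the real axis to the line Im = v or Im = - v, then
    horizontally to i v or - i v. After its starting point it has 0 < |Im| <= v, where there are no
    lattice points. The lower end is reduced to the upper one by parity. *)
Lemma first_integral_strip (w v : R) z : 0 < w -> 0 < v -> ~ in_lattice w (Ci * v)%C z ->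
  Rabs (Im z) <= v ->
  first_integral w v z = first_integral w v (Ci * v)%C.
Proof.
  intros Hw Hv Hz Him.
  assert (Hend : forall sg, (sg = 1 \/ sg = -1) -> 0 <= sg * Im z ->
     first_integral w v z = first_integral w v (RtoC sg * (Ci * v))%C).
  { intros sg Hsg Hs.
    assert (Hs2 : sg * Im z = Rabs (Im z)).
    { destruct Hsg as [-> | ->]; [rewrite Rabs_pos_eq|rewrite Rabs_left1]; lra. }
    assert (Hsv : Rabs (sg * v) = v).
    { destruct Hsg as [-> | ->]; [rewrite Rabs_pos_eq|rewrite Rabs_left1]; lra. }
    transitivity (first_integral w v (Re z, sg * v)).
    - replace ((Re z, sg * v) : C) with (z + RtoC (sg * v - Im z) * Ci)%C.
      2:{ destruct z. unfold Cplus, Cmult, Ci, RtoC; simpl. f_equal; ring. }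
      symmetry. apply segment_const. intros t Ht. apply first_integral_cderiv; auto.
      destruct (Req_dec t 0) as [->|Ht0].
      + replace (z + 0%R * (RtoC (sg * v - Im z) * Ci))%C with z by ring. auto.
      + apply notin_Im; auto.
        replace (Im (z + t * (RtoC (sg * v - Im z) * Ci))%C) with (sg * ((1 - t) * (sg * Im z) + t * v)).
        2:{ destruct z. unfold Cplus, Cmult, Ci, RtoC; simpl. destruct Hsg as [-> | ->]; ring. }
        rewrite Hs2, Rabs_mult. replace (Rabs sg) with 1.
        2:{ destruct Hsg as [-> | ->]. rewrite Rabs_R1; auto. rewrite Rabs_left; lra. }
        rewrite Rabs_pos_eq by (pose proof (Rabs_pos (Im z)); nra).
        pose proof (Rabs_pos (Im z)). nra.
    - replace ((Re z, sg * v) : C) with (RtoC sg * (Ci * v) + RtoC (Re z))%C.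
      2:{ destruct z. unfold Cplus, Cmult, Ci, RtoC; simpl. f_equal; ring. }
      apply segment_const. intros t Ht. apply first_integral_cderiv; auto.
      apply notin_Im; auto.
      replace (Im (RtoC sg * (Ci * v) + t * RtoC (Re z))%C) with (sg * v)
        by (unfold Cplus, Cmult, Ci, RtoC; simpl; ring). lra. }
  destruct (Rle_dec 0 (Im z)) as [H|H].
  - rewrite (Hend 1); auto; try lra. f_equal. ring.
  - rewrite (Hend (-1)); auto; try lra.
    replace (RtoC (-1) * (Ci * v))%C with (- (Ci * v))%C by ring.
    unfold first_integral.
    assert (N : ~ in_lattice w (Ci * v)%C (Ci * v)%C).
    { apply notin_Im; auto. simpl. rewrite Rmult_0_l, Rmult_1_l, Rplus_0_l, Rabs_pos_eq; lra. }
    rewrite eis2_even, eis3_odd by auto. ring.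
Qed.

(** Here [z] and [- z] differ by a lattice point, while [eis 3] is both odd and periodic. *)
Lemma eis3_half_period (w v : R) z : 0 < w -> 0 < v -> ~ in_lattice w (Ci * v)%C z ->
  in_lattice w (Ci * v)%C (2 * z)%C -> eis w v 3 z = 0%C.
Proof.
  intros Hw Hv Hz [m [n E]]. fold (lpt w v m n) in E.
  pose proof (eis3_odd w v z Hw Hv Hz) as O.
  assert (K : eis w v 3 (- z)%C = eis w v 3 z).
  { destruct (period_all (fun z => ~ in_lattice w (Ci * v)%C z) w v (eis w v 3)) with (m := m) (n := n) (z := (- z)%C)
        as [K1 K2]; auto.
    - intros P x HP'. rewrite in_lattice_period; tauto.
    - intros P x HP' Hx. apply eis_period; auto.
    - rewrite in_lattice_opp; auto.
    - rewrite <- K2, <- E. f_equal. ring. }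
  rewrite K in O. replace (eis w v 3 z) with (/ 2 * (eis w v 3 z - - eis w v 3 z))%C by field.
  rewrite <- O. ring.
Qed.

(* The constant of integration is read off at the half-period [i v], where [wp'] vanishes. *)
Lemma wp_first_order (w v g2 g3 e3 : R) z : 0 < w -> 0 < v ->
  inv_g2 w (Ci * v)%C = g2 -> wp w (Ci * v)%C (Ci * v)%C = e3 -> 4 * e3 ^ 3 - g2 * e3 - g3 = 0 ->
  ~ in_lattice w (Ci * v)%C z -> Rabs (Im z) <= v ->
  ((- 2 * eis w v 3 z) ^ 2 = 4 * eis w v 2 z ^ 3 - g2 * eis w v 2 z - g3)%C.
Proof.
  intros Hw Hv Hg2 He3 Hg3 Hz Him.
  assert (Hc : (60 * eis_reg w v 4 0 = g2)%C).
  { rewrite <- Hg2. unfold inv_g2. f_equal. symmetry. apply lattice_sum_eq.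
    destruct (apart_0 w v Hw Hv) as [kap Ha].
    eapply is_lsum_ext; [|apply (eis_reg_is_lsum w v 4 0%C kap); auto].
    intros m n. unfold masked. destruct andb; auto. cbn [term]. unfold lpt. f_equal. ring. }
  pose proof (first_integral_strip w v z Hw Hv Hz Him) as F.
  assert (N : ~ in_lattice w (Ci * v)%C (Ci * v)%C).
  { apply notin_Im; auto. simpl. rewrite Rmult_0_l, Rmult_1_l, Rplus_0_l, Rabs_pos_eq; lra. }
  unfold first_integral in F. rewrite (eis3_half_period w v (Ci * v)%C) in F; auto.
  2:{ exists 0%Z, 1%Z. unfold lattice_pt. ring. }
  rewrite wp_eis in He3. rewrite He3, Hc in F.
  assert (G : (RtoC g3 = 4 * (e3 * (e3 * e3)) - g2 * e3)%C).
  { rewrite <- !RtoC_mult, <- !RtoC_minus. f_equal. simpl in Hg3. lra. }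
  transitivity ((4 * (eis w v 3 z * eis w v 3 z) - 4 * (eis w v 2 z * (eis w v 2 z * eis w v 2 z)) + g2 * eis w v 2 z)
    + (4 * (eis w v 2 z * (eis w v 2 z * eis w v 2 z)) - g2 * eis w v 2 z))%C. simpl; ring.
  rewrite F, G. simpl. ring.
Qed.

(** * The addition formula for zeta *)

Definition zeta_diff (w v : R) (a z : C) : C :=
  (eis w v 1 (z - a) - eis w v 1 (z + a) + 2 * eis w v 1 a)%C.

Lemma minus_Re (a b : C) : minus (Re a) (Re b) = Re (a - b)%C.
Proof. unfold Cminus. rewrite re_plus, re_opp. reflexivity. Qed.

Lemma plus_Re (a b : C) : plus (Re a) (Re b) = Re (a + b)%C.
Proof. symmetry. apply re_plus. Qed.

Lemma cderiv_shift_minus f b z l : cderiv f (z - b)%C l -> cderiv (fun z => f (z - b)%C) z l.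
Proof. apply (cderiv_shift f (- b)%C z l). Qed.

Lemma zeta_diff_cderiv (w v : R) a z : 0 < w -> 0 < v ->
  ~ in_lattice w (Ci * v)%C (z - a)%C -> ~ in_lattice w (Ci * v)%C (z + a)%C ->
  cderiv (zeta_diff w v a) z (eis w v 2 (z + a) - eis w v 2 (z - a))%C /\
  cderiv (fun z => eis w v 2 (z + a) - eis w v 2 (z - a))%C z
    (2 * eis w v 3 (z - a) - 2 * eis w v 3 (z + a))%C.
Proof.
  intros Hw Hv H1 H2. split.
  - unfold zeta_diff. eapply cderiv_eq.
    + apply (cderiv_plus (fun z => eis w v 1 (z - a) - eis w v 1 (z + a))%C (fun _ => 2 * eis w v 1 a)%C).
      * apply (cderiv_minus (fun z => eis w v 1 (z - a))%C (fun z => eis w v 1 (z + a))%C).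
        apply cderiv_shift_minus. apply eis_cderiv; auto. apply cderiv_shift. apply eis_cderiv; auto.
      * apply cderiv_const.
    + inr_ring.
  - eapply cderiv_eq.
    + apply (cderiv_minus (fun z => eis w v 2 (z + a))%C (fun z => eis w v 2 (z - a))%C).
      apply cderiv_shift. apply eis_cderiv; auto. apply cderiv_shift_minus. apply eis_cderiv; auto.
    + inr_ring.
Qed.

Lemma zeta_diff_even (w v : R) a z : 0 < w -> 0 < v ->
  ~ in_lattice w (Ci * v)%C (z - a)%C -> ~ in_lattice w (Ci * v)%C (z + a)%C ->
  zeta_diff w v a (- z)%C = zeta_diff w v a z.
Proof.
  intros Hw Hv H1 H2. unfold zeta_diff.
  replace (- z - a)%C with (- (z + a))%C by ring. replace (- z + a)%C with (- (z - a))%C by ring.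
  rewrite !eis1_odd by auto. ring.
Qed.

Lemma ccontinuous_zero_lim f : ccontinuous f 0%C -> f 0%C = 0%C -> forall eps, 0 < eps ->
  exists d, 0 < d /\ forall h, Cmod h < d -> Cmod (f h) < eps.
Proof.
  intros H F0 eps He. destruct (H eps He) as [d [Hd Hf]]. exists d. split; auto.
  intros h Hh. specialize (Hf h). rewrite F0 in Hf.
  replace (h - 0)%C with h in Hf by ring. replace (f h - 0)%C with (f h) in Hf by ring. auto.
Qed.

(** As a function of h, [zeta_diff] vanishes at 0 together with its first derivative; its leading
    term - 2 eis 3 a * h^2 meets the pole 1 / h^2 of wp. *)
Lemma zeta_diff_limit_0 (w v : R) a : 0 < w -> 0 < v -> ~ in_lattice w (Ci * v)%C a ->
  forall eps, 0 < eps -> exists d, 0 < d /\ forall h : C, h <> 0%C -> Cmod h < d ->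
    Cmod (zeta_diff w v a h * (eis w v 2 h - eis w v 2 a) + 2 * eis w v 3 a)%C < eps.
Proof.
  intros Hw Hv Ha eps He.
  destruct (notin_open w v a Hw Hv Ha) as [r1 [Hr1 N1]].
  destruct (eis_reg_cderiv_near0 w v Hw Hv) as [r2 [Hr2 D2]].
  assert (N : forall z, Cmod z < r1 -> ~ in_lattice w (Ci * v)%C (z - a)%C /\ ~ in_lattice w (Ci * v)%C (z + a)%C).
  { intros z Hz. split.
    - rewrite <- in_lattice_opp. apply N1. replace (- (z - a) - a)%C with (- z)%C by ring. rewrite Cmod_opp; auto.
    - apply N1. replace (z + a - a)%C with z by ring. auto. }
  assert (Z0 : zeta_diff w v a 0%C = 0%C).
  { unfold zeta_diff. replace (0 - a)%C with (- a)%C by ring. replace (0 + a)%C with a by ring.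
    rewrite eis1_odd by auto. ring. }
  assert (C0 : Cmod 0 < r1) by (rewrite Cmod_0; auto).
  assert (C0' : Cmod 0 < r2) by (rewrite Cmod_0; auto).
  destruct (taylor2 (zeta_diff w v a) (fun z => eis w v 2 (z + a) - eis w v 2 (z - a))%C
     (fun z => 2 * eis w v 3 (z - a) - 2 * eis w v 3 (z + a))%C r1 Hr1) with (eps := eps / 2) as [d1 [Hd1 T]]; auto; try lra.
  { intros z Hz. apply zeta_diff_cderiv; auto; apply N; auto. }
  { eapply cderiv_ccontinuous. apply (cderiv_minus (fun z => 2 * eis w v 3 (z - a))%C (fun z => 2 * eis w v 3 (z + a))%C).
    apply (cderiv_scal 2%C (fun z => eis w v 3 (z - a)%C)). apply cderiv_shift_minus. apply eis_cderiv; auto. apply N; auto.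
    apply (cderiv_scal 2%C (fun z => eis w v 3 (z + a)%C)). apply cderiv_shift. apply eis_cderiv; auto. apply N; auto. }
  { cbv beta. replace (0 - a)%C with (- a)%C by ring. replace (0 + a)%C with a by ring.
    rewrite eis2_even by auto. ring. }
  pose (phi := fun h => (zeta_diff w v a h * (eis_reg w v 2 h - eis w v 2 a))%C).
  destruct (ccontinuous_zero_lim phi) with (eps := eps / 2) as [d2 [Hd2 P]]; try lra.
  { eapply cderiv_ccontinuous. apply (cderiv_mult (zeta_diff w v a) (fun h => eis_reg w v 2 h - eis w v 2 a)%C).
    apply zeta_diff_cderiv; auto; apply N; auto.
    apply (cderiv_minus (eis_reg w v 2) (fun _ => eis w v 2 a)). apply D2; auto. apply cderiv_const. }
  { unfold phi. rewrite Z0. ring. }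
  exists (Rmin d1 d2). split. apply Rmin_pos; auto.
  intros h Nh Hh. pose proof (Rmin_l d1 d2). pose proof (Rmin_r d1 d2).
  specialize (T h ltac:(lra)). specialize (P h ltac:(lra)).
  apply Cmod_div_pow_le in T; auto.
  match goal with |- Cmod ?x < _ => replace x with ((zeta_diff w v a h -
     (2 * eis w v 3 (0 - a) - 2 * eis w v 3 (0 + a)) / 2 * h ^ 2) / h ^ 2 + phi h)%C end.
  2:{ replace (0 - a)%C with (- a)%C by ring. replace (0 + a)%C with a by ring.
      rewrite eis3_odd by auto. unfold phi.
      change (eis w v 2 h) with (/ h ^ 2 + eis_reg w v 2 h)%C. set (zd := zeta_diff w v a h). field. exact Nh. }
  eapply Rle_lt_trans. apply Cmod_triangle. lra.
Qed.

(** The simple pole of zeta(z - a) meets the simple zero of wp z - wp a, whose slope is - 2 eis 3 a.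
    The condition on 2 a keeps zeta(z + a) regular at z = a. *)
Lemma zeta_diff_limit_a (w v : R) a : 0 < w -> 0 < v -> ~ in_lattice w (Ci * v)%C a ->
  ~ in_lattice w (Ci * v)%C (2 * a)%C ->
  forall eps, 0 < eps -> exists d, 0 < d /\ forall h : C, h <> 0%C -> Cmod h < d ->
    Cmod (zeta_diff w v a (a + h) * (eis w v 2 (a + h) - eis w v 2 a) + 2 * eis w v 3 a)%C < eps.
Proof.
  intros Hw Hv Ha H2a eps He.
  destruct (eis_reg_cderiv_near0 w v Hw Hv) as [r2 [Hr2 D2]].
  assert (C0' : Cmod 0 < r2) by (rewrite Cmod_0; auto).
  destruct (eis_cderiv' w v 2 a (-2 * eis w v 3 a)%C Hw Hv ltac:(lia) Ha ltac:(inr_ring) (eps / 2)) as [d1 [Hd1 T]]. lra.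
  pose (phi := fun h => ((eis_reg w v 1 h - eis w v 1 (h + 2 * a) + 2 * eis w v 1 a) * (eis w v 2 (h + a) - eis w v 2 a))%C).
  destruct (ccontinuous_zero_lim phi) with (eps := eps / 2) as [d2 [Hd2 P]]; try lra.
  { eapply cderiv_ccontinuous.
    apply (cderiv_mult (fun h => eis_reg w v 1 h - eis w v 1 (h + 2 * a) + 2 * eis w v 1 a)%C (fun h => eis w v 2 (h + a) - eis w v 2 a)%C).
    - apply (cderiv_plus (fun h => eis_reg w v 1 h - eis w v 1 (h + 2 * a))%C (fun h => 2 * eis w v 1 a)%C).
      + apply (cderiv_minus (eis_reg w v 1) (fun h => eis w v 1 (h + 2 * a)%C)). apply D2; auto.
        apply cderiv_shift. apply eis_cderiv; auto. replace (0 + 2 * a)%C with (2 * a)%C by ring. auto.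
      + apply cderiv_const.
    - apply (cderiv_minus (fun h => eis w v 2 (h + a)%C) (fun _ => eis w v 2 a)). 
      apply cderiv_shift. apply eis_cderiv; auto. replace (0 + a)%C with a by ring. auto.
      apply cderiv_const. }
  { unfold phi. replace (0 + a)%C with a by ring. ring. }
  exists (Rmin d1 d2). split. apply Rmin_pos; auto.
  intros h Nh Hh. pose proof (Rmin_l d1 d2). pose proof (Rmin_r d1 d2).
  specialize (T h ltac:(lra)). specialize (P h ltac:(lra)).
  replace (Cmod h) with (Cmod h ^ 1) in T by (simpl; ring).
  apply Cmod_div_pow_le in T; auto.
  match goal with |- Cmod ?x < _ => replace x with ((eis w v 2 (a + h) - eis w v 2 a - -2 * eis w v 3 a * h) / h ^ 1 + phi h)%C end.
  2:{ unfold phi, zeta_diff. replace (a + h - a)%C with h by ring.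
      replace (h + a)%C with (a + h)%C by ring.
      replace (h + 2 * a)%C with (a + h + a)%C by ring. change (eis w v 1 h) with (/ h ^ 1 + eis_reg w v 1 h)%C.
      set (x := eis w v 2 (a + h)%C). set (y := eis w v 1 (a + h + a)%C). set (t := eis w v 1 a).
      field. exact Nh. }
  eapply Rle_lt_trans. apply Cmod_triangle. lra.
Qed.

(** Both sides are elliptic in [z], and their difference can be singular only at translates of 0, a
    and - a. It tends to 0 at 0 and at a by the two limits above, and at - a by evenness. A nonzero
    [eis 3 a] guarantees that 2 a is no lattice point. *)
Lemma zeta_addition (w v : R) a z : 0 < w -> 0 < v -> ~ in_lattice w (Ci * v)%C a ->
  eis w v 3 a <> 0%C ->
  ~ in_lattice w (Ci * v)%C z -> ~ in_lattice w (Ci * v)%C (z - a)%C -> ~ in_lattice w (Ci * v)%C (z + a)%C ->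
  (zeta_diff w v a z * (eis w v 2 z - eis w v 2 a) = - 2 * eis w v 3 a)%C.
Proof.
  intros Hw Hv Ha H3 Hz Hzm Hzp.
  assert (H2a : ~ in_lattice w (Ci * v)%C (2 * a)%C).
  { intros H. apply H3. apply eis3_half_period; auto. }
  pose (S := fun z => in_lattice w (Ci * v)%C z \/ in_lattice w (Ci * v)%C (z - a)%C
     \/ in_lattice w (Ci * v)%C (z + a)%C).
  pose (f := fun z => (zeta_diff w v a z * (eis w v 2 z - eis w v 2 a) + 2 * eis w v 3 a)%C).
  pose (g1 := fun z => (eis w v 2 (z + a) - eis w v 2 (z - a))%C).
  pose (g2 := fun z => (2 * eis w v 3 (z - a) - 2 * eis w v 3 (z + a))%C).
  assert (HS : forall P z, is_period w v P -> (S (z + P)%C <-> S z)).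
  { intros P y HP. unfold S. 
    replace (y + P - a)%C with (y - a + P)%C by ring. replace (y + P + a)%C with (y + a + P)%C by ring.
    rewrite !in_lattice_period by auto. tauto. }
  assert (HfP : forall P z, is_period w v P -> ~ S z -> f (z + P)%C = f z).
  { intros P y HP Hy. unfold S in Hy. unfold f, zeta_diff.
    replace (y + P - a)%C with (y - a + P)%C by ring. replace (y + P + a)%C with (y + a + P)%C by ring.
    rewrite (eis2_period w v P y) by tauto.
    (* Zeta has the same increment at y - a and y + a, so the increments cancel and the zeta
       difference is periodic. *)
    pose proof (eis1_quasi_period w v P (y - a)%C (y + a)%C Hw Hv HP ltac:(tauto) ltac:(tauto)) as Q.
    f_equal. f_equal. f_equal.
    replace (eis w v 1 (y - a + P) - eis w v 1 (y + a + P))%C with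
     ((eis w v 1 (y - a + P) - eis w v 1 (y - a)) - (eis w v 1 (y + a + P) - eis w v 1 (y + a))
      + (eis w v 1 (y - a) - eis w v 1 (y + a)))%C by ring.
    rewrite Q. ring. }
  assert (Hred : forall (W : C) m n, W = lpt w v m n -> forall y, ~ S y ->
     ~ S (y - W)%C /\ f y = f (y - W)%C).
  { intros W m n EW y Hy.
    destruct (period_all (fun z => ~ S z) w v f) with (m := (- m)%Z) (n := (- n)%Z) (z := y)
        as [K1 K2]; auto.
    - intros P x HP'. rewrite HS; tauto.
    - rewrite lpt_opp, <- EW in *. split; auto. }
  assert (Heven : forall y, ~ S y -> ~ S (- y)%C /\ f (- y)%C = f y).
  { intros y Hy. unfold S in *. split.
    - intros [K|[K|K]]; apply Hy; rewrite <- in_lattice_opp in K.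
      + left. replace y with (- - y)%C by ring. auto.
      + right; right. replace (y + a)%C with (- (- y - a))%C by ring. auto.
      + right; left. replace (y - a)%C with (- (- y + a))%C by ring. auto.
    - unfold f. rewrite zeta_diff_even, eis2_even by tauto. reflexivity. }
  assert (Hlim_a : forall s, in_lattice w (Ci * v)%C (s - a)%C -> forall eps, 0 < eps ->
    exists d, 0 < d /\ forall z, ~ S z -> Cmod (z - s)%C < d -> Cmod (f z) < eps).
  { intros s [m [n Es]] eps He. fold (lpt w v m n) in Es.
    destruct (zeta_diff_limit_a w v a Hw Hv Ha H2a eps He) as [d [Hd L]].
    exists d. split; auto. intros y Hy Hys.
    destruct (Hred _ m n (eq_refl _) y Hy) as [R1 ->]. rewrite <- Es in *.
    replace (y - (s - a))%C with (a + (y - s))%C in * by ring.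
    apply L; auto. intros E0. apply R1. right; left. rewrite E0.
    replace (a + 0 - a)%C with (RtoC 0) by ring. apply zero_in_lattice. }
  assert (F0 : f z = 0%C).
  2:{ unfold f in F0. replace (zeta_diff w v a z * (eis w v 2 z - eis w v 2 a))%C with
       ((zeta_diff w v a z * (eis w v 2 z - eis w v 2 a) + 2 * eis w v 3 a) - 2 * eis w v 3 a)%C by ring.
      rewrite F0. ring. }
  apply (liouville_torus (2 * w) (2 * v) f
    (fun z => g1 z * (eis w v 2 z - eis w v 2 a) + zeta_diff w v a z * (-2 * eis w v 3 z))%C
    (fun z => (g2 z * (eis w v 2 z - eis w v 2 a) + g1 z * (-2 * eis w v 3 z)) +
       (g1 z * (-2 * eis w v 3 z) + zeta_diff w v a z * (-2 * (-3 * eis w v 4 z))))%C S); try lra.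
  - intros y. apply HS. left; auto.
  - intros y. apply HS. right; auto.
  - intros y. apply HfP. left; auto.
  - intros y. apply HfP. right; auto.
  - intros y Hy. unfold S in Hy.
    destruct (zeta_diff_cderiv w v a y Hw Hv ltac:(tauto) ltac:(tauto)) as [Z1 Z2].
    assert (D2 : cderiv (fun z => eis w v 2 z - eis w v 2 a)%C y (-2 * eis w v 3 y)%C).
    { eapply cderiv_eq. apply (cderiv_minus (eis w v 2) (fun _ => eis w v 2 a)). apply eis_cderiv; auto.
      apply cderiv_const. inr_ring. }
    assert (D3 : cderiv (fun z => -2 * eis w v 3 z)%C y (-2 * (-3 * eis w v 4 y))%C).
    { apply cderiv_scal. apply eis_cderiv'; auto. inr_ring. }
    split.
    + unfold f. eapply cderiv_eq.
      apply (cderiv_plus (fun z => zeta_diff w v a z * (eis w v 2 z - eis w v 2 a))%C (fun _ => 2 * eis w v 3 a)%C).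
      apply (cderiv_mult (zeta_diff w v a) (fun z => eis w v 2 z - eis w v 2 a)%C). apply Z1. apply D2.
      apply cderiv_const. unfold g1. ring.
    + apply (cderiv_plus (fun z => g1 z * (eis w v 2 z - eis w v 2 a))%C (fun z => zeta_diff w v a z * (-2 * eis w v 3 z))%C).
      apply (cderiv_mult g1 (fun z => eis w v 2 z - eis w v 2 a)%C); auto.
      apply (cderiv_mult (zeta_diff w v a) (fun z => -2 * eis w v 3 z)%C); auto.
  - exists 0%C. left. apply zero_in_lattice.
  - intros y Hy. unfold S in Hy.
    destruct (notin_open w v y Hw Hv ltac:(tauto)) as [d1 [Hd1 O1]].
    destruct (notin_open w v (y - a)%C Hw Hv ltac:(tauto)) as [d2 [Hd2 O2]].
    destruct (notin_open w v (y + a)%C Hw Hv ltac:(tauto)) as [d3 [Hd3 O3]].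
    exists (Rmin d1 (Rmin d2 d3)). split. repeat apply Rmin_pos; auto.
    intros y' Hy'. pose proof (Rmin_l d1 (Rmin d2 d3)). pose proof (Rmin_r d1 (Rmin d2 d3)).
    pose proof (Rmin_l d2 d3). pose proof (Rmin_r d2 d3). intros [K|[K|K]].
    + revert K. apply O1. lra.
    + revert K. apply O2. replace (y' - a - (y - a))%C with (y' - y)%C by ring. lra.
    + revert K. apply O3. replace (y' + a - (y + a))%C with (y' - y)%C by ring. lra.
  - intros s Hs eps He. destruct Hs as [[m [n Es]]|[Hs|Hs]].
    + fold (lpt w v m n) in Es. destruct (zeta_diff_limit_0 w v a Hw Hv Ha eps He) as [d [Hd L]].
      exists d. split; auto. intros y Hy Hys.
      destruct (Hred _ m n (eq_refl _) y Hy) as [R1 ->]. rewrite <- Es in *.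
      apply L; auto. intros E0. apply R1. left. rewrite E0. apply zero_in_lattice.
    + apply Hlim_a; auto.
    + rewrite <- in_lattice_opp in Hs. replace (- (s + a))%C with (- s - a)%C in Hs by ring.
      destruct (Hlim_a _ Hs eps He) as [d [Hd L]]. exists d. split; auto.
      intros y Hy Hys. destruct (Heven y Hy) as [E1 <-]. apply L; auto.
      rewrite Cmod_minus_sym. replace (- s - - y)%C with (y - s)%C by ring. auto.
  - unfold S. tauto.
Qed.

(** The increment of zeta is the same everywhere, so it is read off between - w and w, where oddness
    gives 2 zeta(w). *)
Lemma eis1_period_w (w v : R) z : 0 < w -> 0 < v -> ~ in_lattice w (Ci * v)%C z ->
  (eis w v 1 (z + RtoC (2 * w)) - eis w v 1 z = 2 * eis w v 1 w)%C.
Proof.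
  intros Hw Hv Hz.
  assert (N : ~ in_lattice w (Ci * v)%C w).
  { intros [m [n E]]. fold (lpt w v m n) in E. rewrite lpt_eq in E.
    apply (f_equal Re) in E. simpl in E.
    assert (H : (2 * IZR m - 1) * w = 0) by lra. apply Rmult_integral in H. destruct H; [|lra].
    assert (IZR (2 * m) = 1) by (rewrite mult_IZR; lra). apply eq_IZR in H0. lia. }
  assert (N' : ~ in_lattice w (Ci * v)%C (- w)%C) by (rewrite in_lattice_opp; auto).
  rewrite (eis1_quasi_period w v _ z (- w)%C); auto; [|left; auto].
  replace (- w + RtoC (2 * w))%C with (RtoC w) by (rewrite RtoC_mult; ring).
  rewrite eis1_odd by auto. ring.
Qed.

(* Moving the line along [t d], the [t]-derivative of the integrand is again a
   derivative in [s], so its integral is an increment of [zeta] over a period. *)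
Lemma zeta_line_integral (w v : R) (kap d : C) : 0 < w -> 0 < v -> Rabs (Im d) < v ->
  RInt (fun s : R => Re (kap * eis w v 1 (s - Ci * v + d))%C) 0 (2 * w)
  - RInt (fun s : R => Re (kap * eis w v 1 (s - Ci * v))%C) 0 (2 * w)
  = Re (kap * d * (2 * eis w v 1 w))%C.
Proof.
  intros Hw Hv Hd. apply Rabs_def2 in Hd.
  (* The open strip between two neighbouring rows of lattice points; with |Im d| < v all the moved
     lines stay inside it. *)
  pose (D := fun z : C => - (2 * v) < Im z < 0).
  assert (DN : forall z, D z -> ~ in_lattice w (Ci * v)%C z).
  { intros z [H1 H2]. apply notin_Im; auto. rewrite Rabs_left; lra. }
  pose (f := fun z => (kap * eis w v 1 z)%C). pose (f' := fun z => (kap * (-1 * eis w v 2 z))%C).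
  assert (Hf : forall z, D z -> cderiv f z (f' z) /\ ccontinuous f' z).
  { intros z Hz. apply DN in Hz. split.
    - apply cderiv_scal. apply eis_cderiv'; auto. inr_ring.
    - apply ccontinuous_scal, ccontinuous_scal. eapply cderiv_ccontinuous. apply eis_cderiv; auto. }
  pose (x := fun t s : R => s + t * Re d). pose (y := fun t s : R => - v + t * Im d).
  assert (Exy : forall t s, ((x t s, y t s) : C) = (s - Ci * v + t * d)%C).
  { intros. unfold x, y. destruct d. unfold Cminus, Copp, Cplus, Cmult, Ci, RtoC; simpl. f_equal; ring. }
  assert (Cx : forall t s, continuity_2d_pt x t s).
  { intros. unfold x. apply continuity_2d_pt_plus. apply continuity_2d_pt_id2.
    apply continuity_2d_pt_mult. apply continuity_2d_pt_id1. apply continuity_2d_pt_const. }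
  assert (Cy : forall t s, continuity_2d_pt y t s).
  { intros. unfold y. apply continuity_2d_pt_plus. apply continuity_2d_pt_const.
    apply continuity_2d_pt_mult. apply continuity_2d_pt_id1. apply continuity_2d_pt_const. }
  assert (HDxy : forall t s, Rabs t * Rabs (Im d) < v -> D (x t s, y t s)).
  { intros t s Ht. unfold D, y. simpl. rewrite <- Rabs_mult in Ht. apply Rabs_def2 in Ht. lra. }
  assert (Hab : Rabs (Im d) < v) by (apply Rabs_def1; lra).
  pose proof (Rabs_pos (Im d)) as Hap.
  pose (M := fun t => RInt (fun s => Re (f (x t s, y t s))) 0 (2 * w)).
  assert (HM : forall t, 0 <= t <= 1 -> is_derive M t (Re (kap * d * (2 * eis w v 1 w))%C)).
  { intros t Ht.
    assert (HDt : forall s, D (x t s, y t s)).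
    { intros s. apply HDxy. rewrite (Rabs_pos_eq t) by lra. nra. }
    replace (Re (kap * d * (2 * eis w v 1 w))%C)
      with (RInt (fun s => Re (f' (x t s, y t s) * (Re d, Im d))%C) 0 (2 * w)).
    - apply (is_derive_RInt_holomorphic f f' D x y (fun _ _ => Re d) (fun _ _ => Im d)); auto.
      + intros; apply continuity_2d_pt_const.
      + intros; apply continuity_2d_pt_const.
      + intros t' s. unfold x. auto_derive; auto. ring.
      + intros t' s. unfold y. auto_derive; auto. ring.
      + exists ((v - Rabs (Im d)) / (Rabs (Im d) + 1)). split. apply Rdiv_lt_0_compat; lra.
        intros t' s Ht'. apply HDxy. apply Rlt_div_r in Ht'; [|lra].
        assert (Rabs t' <= 1 + Rabs (t' - t)).
        { replace t' with (t + (t' - t)) at 1 by ring. eapply Rle_trans. apply Rabs_triang.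
          rewrite (Rabs_pos_eq t); lra. }
        pose proof (Rabs_pos (t' - t)). nra.
    - apply is_RInt_unique.
      pose (h := fun s => Re (d * f (x t s, y t s))%C).
      replace (Re (kap * d * (2 * eis w v 1 w))%C) with (minus (h (2 * w)) (h 0)).
      2:{ unfold h, f. rewrite !Exy.
          rewrite <- (eis1_period_w w v (0%R - Ci * v + t * d)%C); auto.
          2:{ rewrite <- Exy. apply DN, HDt. }
          rewrite minus_Re. f_equal.
          replace ((2 * w)%R - Ci * v + t * d)%C with (0%R - Ci * v + t * d + (2 * w)%R)%C by ring. ring. }
      assert (Dg : forall s g g', (forall z, D z -> cderiv g z (g' z)) ->
         is_derive (fun s => Re (g (x t s, y t s))) s (Re (g' (x t s, y t s)))).
      { intros s g g' Hg. apply (path_deriv_Re (fun s => g (x t s, y t s))).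
        replace (g' (x t s, y t s)) with (g' (x t s, y t s) * (1, 0))%C by (change (1, 0) with (RtoC 1); ring).
        apply (path_deriv_comp g (fun s => (x t s, y t s))). apply Hg; auto.
        apply path_deriv_of_components. unfold x. auto_derive; auto; ring. unfold y. auto_derive; auto; ring. }
      replace (Re d, Im d) with d by (destruct d; auto).
      apply (is_RInt_derive h).
      + intros s _. unfold h. apply (Dg s (fun z => d * f z)%C (fun z => f' z * d)%C); auto.
        intros z Hz. eapply cderiv_eq. apply cderiv_scal. apply Hf; auto. ring.
      + intros s _. apply (ex_derive_continuous (fun s => Re (f' (x t s, y t s) * d)%C)). eexists.
        apply (Dg s (fun z => f' z * d)%C (fun z => d * (kap * (-1 * (- INR 2 * eis w v 3 z))))%C); auto.
        intros z Hz. apply (cderiv_ext (fun z => d * f' z)%C). intros; ring.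
        apply cderiv_scal. unfold f'. apply (cderiv_scal kap (fun z => -1 * eis w v 2 z)%C). apply cderiv_scal. apply eis_cderiv; auto. }
  (* The derivative does not depend on [t], so the mean value theorem gives the exact increment. *)
  destruct (MVT_gen M 0 1 (fun _ => Re (kap * d * (2 * eis w v 1 w))%C)) as [c [Hc E]].
  - rewrite Rmin_left, Rmax_right by lra. intros t Ht. apply HM. lra.
  - rewrite Rmin_left, Rmax_right by lra. intros t Ht. apply continuity_pt_filterlim.
    apply (ex_derive_continuous M). eexists. apply HM. lra.
  - transitivity (M 1 - M 0).
    + f_equal; [|f_equal]; apply RInt_ext; intros s _; unfold f; rewrite Exy; do 3 f_equal; ring.
    + lra.
Qed.

(** The integrals over the lines shifted by - a and by a are each compared with the one over Im z =
    - v, which cancels: the shifts contribute - 4 a eta and the constant 2 zeta(a) contributes 4 w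
    zeta(a). The free factor [kap] later recovers both components of the complex identity. *)
Lemma zeta_diff_integral (w v : R) (kap a : C) : 0 < w -> 0 < v -> Rabs (Im a) < v ->
  RInt (fun s : R => Re (kap * zeta_diff w v a (s - Ci * v))%C) 0 (2 * w)
  = Re (kap * (4 * w * eis w v 1 a - 4 * a * eis w v 1 w))%C.
Proof.
  intros Hw Hv Ha.
  assert (Ha' : Rabs (Im (- a)%C) < v) by (rewrite im_opp, Rabs_Ropp; auto).
  pose proof (zeta_line_integral w v kap a Hw Hv Ha) as E1.
  pose proof (zeta_line_integral w v kap (- a)%C Hw Hv Ha') as E2.
  assert (Cc : forall d : C, Rabs (Im d) < v -> forall s, continuous (fun s : R => Re (kap * eis w v 1 (s - Ci * v + d))%C) s).
  { intros d Hd s. apply (ex_derive_continuous (fun s : R => Re (kap * eis w v 1 (s - Ci * v + d))%C)). eexists.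
    apply (path_deriv_Re (fun s : R => (kap * eis w v 1 (s - Ci * v + d))%C)).
    apply (path_deriv_comp (fun z => kap * eis w v 1 z)%C (fun s : R => (s - Ci * v + d)%C) s
      (kap * (- INR 1 * eis w v 2 ((s : R) - Ci * v + d)))%C 1%C).
    - apply cderiv_scal. apply eis_cderiv; auto. apply notin_Im; auto.
      replace (Im (s - Ci * v + d)%C) with (- v + Im d).
      2:{ destruct d. unfold Cminus, Copp, Cplus, Cmult, Ci, RtoC; simpl. ring. }
      apply Rabs_def2 in Hd. rewrite Rabs_left; lra.
    - intros eps He. exists 1. split. lra. intros h _.
      rewrite RtoC_plus. replace (s + h - Ci * v + d - (s - Ci * v + d) - 1 * h)%C with (RtoC 0) by ring.
      rewrite Cmod_0. apply Rmult_le_pos. lra. apply Rabs_pos. }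
  assert (Ce : forall d : C, Rabs (Im d) < v -> ex_RInt (fun s : R => Re (kap * eis w v 1 (s - Ci * v + d))%C) 0 (2 * w)).
  { intros d Hd. apply (ex_RInt_continuous (V := R_CompleteNormedModule)). intros s _. apply Cc; auto. }
  pose proof (Ce _ Ha) as X1. pose proof (Ce _ Ha') as X2.
  transitivity (RInt (fun s : R => plus (minus (Re (kap * eis w v 1 (s - Ci * v + - a))%C) (Re (kap * eis w v 1 (s - Ci * v + a))%C))
     (Re (kap * (2 * eis w v 1 a))%C)) 0 (2 * w)).
  { apply RInt_ext. intros s _. rewrite minus_Re, plus_Re. f_equal. unfold zeta_diff, Cminus. ring. }
  rewrite (RInt_plus (V := R_CompleteNormedModule) (fun s : R => minus (Re (kap * eis w v 1 (s - Ci * v + - a))%C) (Re (kap * eis w v 1 (s - Ci * v + a))%C))).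
  rewrite (RInt_minus (V := R_CompleteNormedModule) (fun s : R => Re (kap * eis w v 1 (s - Ci * v + - a))%C)); auto.
  rewrite (RInt_const (V := R_CompleteNormedModule)).
  - transitivity (RInt (fun s : R => Re (kap * eis w v 1 (s - Ci * v + - a))%C) 0 (2 * w)
       - RInt (fun s : R => Re (kap * eis w v 1 (s - Ci * v + a))%C) 0 (2 * w)
       + (2 * w - 0) * Re (kap * (2 * eis w v 1 a))%C). reflexivity.
    replace (RInt (fun s : R => Re (kap * eis w v 1 (s - Ci * v + - a))%C) 0 (2 * w)
       - RInt (fun s : R => Re (kap * eis w v 1 (s - Ci * v + a))%C) 0 (2 * w))
      with (Re (kap * - a * (2 * eis w v 1 w))%C - Re (kap * a * (2 * eis w v 1 w))%C)
      by (rewrite <- E1, <- E2; ring).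
    rewrite Rminus_0_r. unfold Rminus. rewrite <- re_scal_l, <- re_opp, <- !re_plus.
    f_equal. rewrite RtoC_mult. ring.
  - apply (ex_RInt_minus (V := R_NormedModule) (fun s : R => Re (kap * eis w v 1 (s - Ci * v + - a))%C)); auto.
  - apply (ex_RInt_const (V := R_NormedModule)).
Qed.

(** * Period integrals *)

(** Differences of two equations are divided by differences of roots. The leading coefficient is
    left free because the lemma serves the Weierstrass cubic, k = 4, and the cubic of the [d j], k =
    1. *)
Lemma cubic_vieta (k g2 g a b c : R) : k <> 0 ->
  a <> b -> b <> c -> a <> c ->
  k * a ^ 3 - g2 * a - g = 0 -> k * b ^ 3 - g2 * b - g = 0 -> k * c ^ 3 - g2 * c - g = 0 ->
  c = - a - b /\ g2 = k * (a ^ 2 + a * b + b ^ 2) /\ g = k * (a * b * c).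
Proof.
  intros Hk Hab Hbc Hac Ha Hb Hc.
  assert (E1 : g2 = k * (a ^ 2 + a * b + b ^ 2)).
  { apply Rmult_eq_reg_l with (a - b); [|lra]. lra. }
  assert (E2 : g2 = k * (a ^ 2 + a * c + c ^ 2)).
  { apply Rmult_eq_reg_l with (a - c); [|lra]. lra. }
  assert (E3 : c = - a - b).
  { assert (k * (b - c) * (a + b + c) = 0) by lra.
    apply Rmult_integral in H. destruct H; [|lra]. apply Rmult_integral in H. lra. }
  split; [auto|split; [auto|]]. subst c. rewrite E1 in Ha. lra.
Qed.

Lemma cubic_ordered_roots (g2 g : R) (e : nat -> R) :
  e 1%nat > e 2%nat -> e 2%nat > e 3%nat ->
  (forall j, idx j -> 4 * e j ^ 3 - g2 * e j - g = 0) -> ordered_roots g2 g e.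
Proof.
  intros H12 H23 He. split; [auto|split; [auto|]].
  destruct (cubic_vieta 4 g2 g (e 1%nat) (e 2%nat) (e 3%nat)) as [E1 [E2 E3]]; try lra;
    try (apply He; unfold idx; lia).
  intros t.
  assert (F : (4 * t ^ 3 - g2 * t - g = 4 * ((t - e 1%nat) * ((t - e 2%nat) * (t - e 3%nat))))%C).
  { rewrite E2, E3, E1, !RtoC_mult, !RtoC_plus, !RtoC_minus, !RtoC_opp, !RtoC_pow, !RtoC_mult. ring. }
  rewrite F. split.
  - intros Z.
    destruct (Ceq_dec t (e 1%nat)) as [->|N1]. exists 1%nat; split; auto; unfold idx; lia.
    destruct (Ceq_dec t (e 2%nat)) as [->|N2]. exists 2%nat; split; auto; unfold idx; lia.
    destruct (Ceq_dec t (e 3%nat)) as [->|N3]. exists 3%nat; split; auto; unfold idx; lia.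
    exfalso. revert Z. repeat apply Cmult_neq_0; try (apply Cminus_eq_contra; auto).
    intros E; apply RtoC_inj in E; lra.
  - intros [j [Hj ->]]. destruct j as [|[|[|[|j]]]]; unfold idx in Hj; try lia; ring.
Qed.

Lemma ordered_roots_eq (g2 g : R) e j : ordered_roots g2 g e -> idx j ->
  4 * e j ^ 3 - g2 * e j - g = 0.
Proof.
  intros [_ [_ H]] Hj. apply RtoC_inj.
  rewrite !RtoC_minus, !RtoC_mult, RtoC_pow. apply H. exists j; auto.
Qed.

Lemma ordered_roots_factor (g2 g : R) e : ordered_roots g2 g e ->
  forall t : R, 4 * t ^ 3 - g2 * t - g = 4 * ((t - e 1%nat) * (t - e 2%nat) * (t - e 3%nat)).
Proof.
  intros H t. assert (K : forall j, idx j -> 4 * e j ^ 3 - g2 * e j - g = 0)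
    by (intros; apply ordered_roots_eq; auto).
  destruct H as [H12 [H23 _]].
  destruct (cubic_vieta 4 g2 g (e 1%nat) (e 2%nat) (e 3%nat)) as [E1 [E2 E3]]; try lra;
    try (apply K; unfold idx; lia).
  rewrite E2, E3, E1. ring.
Qed.

(** The critical points of the cubic are - beta / 3 and beta / 3. The local maximum 16 / 27 beta^3 -
    16 a^2 is positive by the bound on [a], and the local minimum - 16 a^2 is negative because a <>
    0. The outer points - 2 beta / 3 and 2 beta complete three sign changes. *)
Lemma modified_roots_exist (beta a : R) : 0 < beta -> a <> 0 -> 27 * a ^ 2 < beta ^ 3 ->
  exists et, ordered_roots (4 / 3 * beta ^ 2) (16 * a ^ 2 - 8 / 27 * beta ^ 3) et.
Proof.
  intros Hb Ha Hab.
  assert (Ha2 : 0 < a ^ 2) by (simpl; rewrite Rmult_1_r; apply Rsqr_pos_lt; auto).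
  pose (f := fun t => 4 * t ^ 3 - 4 / 3 * beta ^ 2 * t - (16 * a ^ 2 - 8 / 27 * beta ^ 3)).
  assert (Cf : continuity f) by (unfold f; reg).
  assert (Cg : continuity (fun t => - f t)) by (unfold f; reg).
  assert (Hb3 : 0 < beta ^ 3) by (apply pow_lt; auto).
  assert (V1 : f (- (2 * beta / 3)) < 0).
  { replace (f (- (2 * beta / 3))) with (- (16 * a ^ 2)) by (unfold f; field). lra. }
  assert (V2 : 0 < f (- (beta / 3))).
  { replace (f (- (beta / 3))) with (16 / 27 * beta ^ 3 - 16 * a ^ 2) by (unfold f; field). lra. }
  assert (V3 : f (beta / 3) < 0).
  { replace (f (beta / 3)) with (- (16 * a ^ 2)) by (unfold f; field). lra. }
  assert (V4 : 0 < f (2 * beta)).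
  { replace (f (2 * beta)) with ((32 - 8 / 3 + 8 / 27) * beta ^ 3 - 16 * a ^ 2) by (unfold f; field). lra. }
  destruct (IVT f (- (2 * beta / 3)) (- (beta / 3)) Cf ltac:(lra) V1 V2) as [r3 [R3 Z3]].
  destruct (IVT (fun t => - f t) (- (beta / 3)) (beta / 3) Cg ltac:(lra) ltac:(lra) ltac:(lra)) as [r2 [R2 Z2]].
  destruct (IVT f (beta / 3) (2 * beta) Cf ltac:(lra) V3 V4) as [r1 [R1 Z1]].
  assert (Z2' : f r2 = 0) by lra.
  assert (r3 <> - (beta / 3)) by (intros E; rewrite E in Z3; lra).
  assert (r1 <> beta / 3) by (intros E; rewrite E in Z1; lra).
  exists (fun j => match j with 1%nat => r1 | 2%nat => r2 | _ => r3 end).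
  apply cubic_ordered_roots; try lra.
  intros j Hj. destruct j as [|[|[|[|j]]]]; unfold idx in Hj; try lia; assumption.
Qed.

Lemma RInt_odd_reflection (k : R -> R) T : (forall s, continuous k s) ->
  (forall s, k (T - s) = - k s) -> RInt k 0 T = 0.
Proof.
  intros Hc Ho.
  assert (E : RInt (fun y => scal (-1) (k (T - y))) 0 T = RInt k (T - 0) (T - T)).
  { apply (RInt_comp (V := R_CompleteNormedModule) k (fun y => T - y) (fun _ => -1)).
    - intros; apply Hc.
    - intros x _. split. auto_derive; auto; ring. apply continuous_const. }
  rewrite (RInt_ext _ k) in E.
  2:{ intros x _. rewrite Ho. unfold scal; simpl; unfold mult; simpl. ring. }
  replace (T - 0) with T in E by ring. replace (T - T) with 0 in E by ring.
  assert (Sw : opp (RInt k 0 T) = RInt k T 0).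
  { apply (opp_RInt_swap (V := R_CompleteNormedModule) k).
    apply (ex_RInt_continuous (V := R_CompleteNormedModule)). intros; apply Hc. }
  rewrite <- Sw in E. change (RInt k 0 T = - RInt k 0 T) in E. lra.
Qed.

(** Conjugation inverts [lambda] on the unit circle. Consequently the denominator of beta1 and beta2
    has constant imaginary part - 2 Im (hopf psi lambda). *)
Lemma conj_hopf psi lambda : Cmod lambda = 1 -> (lambda ^ 3 * Cconj psi = Cconj (hopf psi lambda))%C.
Proof.
  intros H.
  assert (N : lambda <> 0%C) by (intros ->; rewrite Cmod_0 in H; lra).
  assert (Nc : Cconj lambda <> 0%C).
  { intros E. apply N. rewrite <- (Cconj_conj lambda), E. unfold Cconj, RtoC; simpl. f_equal; ring. }
  assert (E : (lambda * Cconj lambda = 1)%C).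
  { pose proof (Cmod2_conj lambda) as E. rewrite H in E. rewrite <- E. f_equal. ring. }
  unfold hopf. rewrite Cmult_conj, Cinv_conj, Cpow_conj by (apply Cpow_nz; auto). f_equal.
  replace lambda with (/ Cconj lambda)%C at 1.
  rewrite Cpow_inv; auto.
  replace lambda with (lambda * Cconj lambda * / Cconj lambda)%C at 2 by (field; auto).
  rewrite E. ring.
Qed.

Lemma Cmod_hopf psi lambda : Cmod lambda = 1 -> Cmod (hopf psi lambda) = Cmod psi.
Proof.
  intros H. assert (N : lambda <> 0%C) by (intros ->; rewrite Cmod_0 in H; lra).
  unfold hopf. rewrite Cmod_mult, Cmod_inv, Cmod_pow, H by (apply Cpow_nz; auto). field.
Qed.

(** * Integrals of 1 / (wp - t) along the line Im z = - v *)

Section PeriodIntegrals.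

Variables (w v : R) (p : R -> R).
Hypotheses (Hw : 0 < w) (Hv : 0 < v).
Hypothesis Hp : forall s : R, RtoC (p s) = eis w v 2 (s - Ci * v)%C.

Lemma line_notin (s : R) : ~ in_lattice w (Ci * v)%C (s - Ci * v)%C.
Proof.
  apply notin_Im; auto. unfold Cminus. rewrite im_plus, im_opp. simpl.
  replace (0 + - (0 * 0 + 1 * v)) with (- v) by ring. rewrite Rabs_Ropp, Rabs_pos_eq; lra.
Qed.

Definition pprime (s : R) : R := Re (-2 * eis w v 3 (s - Ci * v))%C.

Lemma path_deriv_line_wp (s : R) : path_deriv (fun s : R => RtoC (p s)) s (-2 * eis w v 3 (s - Ci * v))%C.
Proof.
  intros eps He.
  assert (K : path_deriv (fun s : R => eis w v 2 (s - Ci * v)%C) s ((-2 * eis w v 3 (s - Ci * v)) * 1)%C).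
  { apply (path_deriv_comp (eis w v 2) (fun s : R => s - Ci * v)%C).
    - apply eis_cderiv'; auto. apply line_notin. inr_ring.
    - intros e' He'. exists 1. split. lra. intros h _.
      rewrite RtoC_plus. replace (s + h - Ci * v - (s - Ci * v) - 1 * h)%C with (RtoC 0) by ring.
      rewrite Cmod_0. apply Rmult_le_pos. lra. apply Rabs_pos. }
  destruct (K eps He) as [d [Hd H]]. exists d. split; auto. intros h Hh.
  specialize (H h Hh). rewrite !Hp. rewrite Cmult_1_r in H. auto.
Qed.

Lemma is_derive_p s : is_derive p s (pprime s).
Proof. apply (path_deriv_Re (fun s => RtoC (p s))). apply path_deriv_line_wp. Qed.

(** Since wp takes the real values [p s] on the line, the imaginary part of its derivative along the
    line vanishes. *)
Lemma pprime_C (s : R) : RtoC (pprime s) = (-2 * eis w v 3 (s - Ci * v))%C.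
Proof.
  pose proof (path_deriv_Im _ _ _ (path_deriv_line_wp s)) as D.
  apply (is_derive_unique (fun _ : R => 0)) in D. rewrite Derive_const in D.
  unfold pprime. set (x := (-2 * eis w v 3 (s - Ci * v))%C) in *. destruct x as [a b].
  simpl in *. rewrite <- D. reflexivity.
Qed.

Lemma continuous_pprime (s : R) : continuous pprime s.
Proof.
  apply (ex_derive_continuous pprime). eexists. unfold pprime.
  apply (path_deriv_Re (fun s : R => -2 * eis w v 3 (s - Ci * v))%C).
  apply (path_deriv_comp (fun z => -2 * eis w v 3 z)%C (fun s : R => s - Ci * v)%C s
    (-2 * (- INR 3 * eis w v 4 (s - Ci * v)))%C 1%C).
  - apply cderiv_scal. apply eis_cderiv; auto. apply line_notin.
  - intros e' He'. exists 1. split. lra. intros h _.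
    rewrite RtoC_plus. replace (s + h - Ci * v - (s - Ci * v) - 1 * h)%C with (RtoC 0) by ring.
    rewrite Cmod_0. apply Rmult_le_pos. lra. apply Rabs_pos.
Qed.

(** The points 2 w - s - i v and - (s - i v) differ by the lattice vector 2 w - 2 i v; this turns
    the parity of wp and wp' into symmetry about s = w. *)
Lemma eis_reflect k (s : R) : (2 <= k)%nat ->
  eis w v k ((2 * w - s)%R - Ci * v)%C = eis w v k (- (s - Ci * v))%C.
Proof.
  intros Hk2.
  assert (N : ~ in_lattice w (Ci * v)%C (- (s - Ci * v))%C) by (rewrite in_lattice_opp; apply line_notin).
  rewrite <- (eis_period w v k (RtoC (2 * v) * Ci)%C ((2 * w - s)%R - Ci * v)%C); auto.
  2:{ right; auto. }
  2:{ apply line_notin. }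
  rewrite <- (eis_period w v k (RtoC (2 * w))%C (- (s - Ci * v))%C); auto.
  2:{ left; auto. }
  f_equal. rewrite RtoC_minus, !RtoC_mult. ring.
Qed.

Lemma p_reflect s : p (2 * w - s) = p s.
Proof.
  apply RtoC_inj. rewrite !Hp, eis_reflect by lia. apply eis2_even; auto. apply line_notin.
Qed.

Lemma pprime_reflect s : pprime (2 * w - s) = - pprime s.
Proof.
  unfold pprime. rewrite eis_reflect, eis3_odd by (auto; apply line_notin).
  rewrite <- re_opp. f_equal. ring.
Qed.

Lemma pprime_sq (g2 g3 e3 : R) s :
  inv_g2 w (Ci * v)%C = g2 -> wp w (Ci * v)%C (Ci * v)%C = e3 -> 4 * e3 ^ 3 - g2 * e3 - g3 = 0 ->
  pprime s ^ 2 = 4 * p s ^ 3 - g2 * p s - g3.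
Proof.
  intros H1 H2 H3. apply RtoC_inj.
  transitivity ((-2 * eis w v 3 (s - Ci * v)) ^ 2)%C.
  { rewrite RtoC_pow, pprime_C. reflexivity. }
  rewrite (wp_first_order w v g2 g3 e3 (s - Ci * v)%C); auto.
  - rewrite !RtoC_minus, !RtoC_mult, !RtoC_pow, Hp. reflexivity.
  - apply line_notin.
  - unfold Cminus. rewrite im_plus, im_opp. simpl.
    replace (0 + - (0 * 0 + 1 * v)) with (- v) by ring. rewrite Rabs_Ropp, Rabs_pos_eq; lra.
Qed.

Lemma continuous_inv_p t s : (forall s, p s <> t) -> continuous (fun s => / (p s - t)) s.
Proof.
  intros Ht. apply (ex_derive_continuous (fun s => / (p s - t))).
  eexists. apply (is_derive_inv (fun s => p s - t)).
  apply (is_derive_minus p (fun _ => t)). apply is_derive_p. apply is_derive_const.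
  specialize (Ht s). lra.
Qed.

(** On the line the addition formula reads zeta_diff = wp'(a) / (p - t), and the left side has a
    known integral. *)
Lemma period_integral (a : C) (t : R) :
  ~ in_lattice w (Ci * v)%C a -> Rabs (Im a) < v -> eis w v 2 a = t -> eis w v 3 a <> 0%C ->
  (forall s, p s <> t) ->
  (RtoC (RInt (fun s => / (p s - t)) 0 (2 * w))%R * (-2 * eis w v 3 a) = period_term w (Ci * v) a)%C.
Proof.
  intros Ha Hia Hat H3 Hpt.
  assert (Na : forall s : R, ~ in_lattice w (Ci * v)%C (s - Ci * v - a)%C /\ ~ in_lattice w (Ci * v)%C (s - Ci * v + a)%C).
  { intros s. apply Rabs_def2 in Hia.
    assert (E1 : Im (s - Ci * v - a)%C = - v - Im a) by (destruct a; unfold Cminus, Copp, Cplus, Cmult, Ci, RtoC; simpl; ring).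
    assert (E2 : Im (s - Ci * v + a)%C = - v + Im a) by (destruct a; unfold Cminus, Copp, Cplus, Cmult, Ci, RtoC; simpl; ring).
    split; apply notin_Im; auto; rewrite ?E1, ?E2, Rabs_left; lra. }
  assert (K : forall kap : C, Re (kap * (-2 * eis w v 3 a))%C * RInt (fun s => / (p s - t)) 0 (2 * w)
     = Re (kap * (4 * w * eis w v 1 a - 4 * a * eis w v 1 w))%C).
  { intros kap. rewrite <- (zeta_diff_integral w v kap a); auto.
    change (scal (Re (kap * (-2 * eis w v 3 a))%C) (RInt (fun s => / (p s - t)) 0 (2 * w)) =
      RInt (fun s : R => Re (kap * zeta_diff w v a (s - Ci * v))%C) 0 (2 * w)).
    rewrite <- (RInt_scal (V := R_CompleteNormedModule)).
    2:{ apply (ex_RInt_continuous (V := R_CompleteNormedModule)). intros; apply continuous_inv_p; auto. }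
    apply RInt_ext. intros s _.
    change (Re (kap * (-2 * eis w v 3 a))%C * / (p s - t) = Re (kap * zeta_diff w v a (s - Ci * v))%C).
    destruct (Na s) as [N1 N2].
    pose proof (zeta_addition w v a (s - Ci * v)%C Hw Hv Ha H3 (line_notin s) N1 N2) as Z.
    rewrite <- Hp, Hat, <- RtoC_minus in Z.
    assert (Hn : p s - t <> 0) by (specialize (Hpt s); lra).
    replace (zeta_diff w v a (s - Ci * v))%C with ((-2 * eis w v 3 a) * RtoC (/ (p s - t)))%C.
    - rewrite <- re_scal_r. f_equal. ring.
    - rewrite <- Z, RtoC_inv by auto. field. intros E. apply RtoC_inj in E. auto. }
  unfold period_term. rewrite !wzeta_eis.
  (* [kap = 1] gives the real parts and [kap = - i] the imaginary parts. *)
  set (I := RInt _ _ _) in *. pose proof (K 1%C) as K1. pose proof (K (- Ci)%C) as K2.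
  rewrite <- !Im_as_Re in K2. rewrite !Cmult_1_l in K1.
  set (A := (-2 * eis w v 3 a)%C) in *.
  set (B := (4 * w * eis w v 1 a - 4 * a * eis w v 1 w)%C) in *.
  apply injective_projections; [change (Re (I * A)%C = Re B)|change (Im (I * A)%C = Im B)].
  rewrite re_scal_l; lra. rewrite im_scal_l; lra.
Qed.

End PeriodIntegrals.

Lemma RInt_lin3 (f1 f2 f3 : R -> R) (c1 c2 c3 a b : R) :
  (forall s, continuous f1 s) -> (forall s, continuous f2 s) -> (forall s, continuous f3 s) ->
  RInt (fun s => c1 * f1 s + c2 * f2 s + c3 * f3 s) a b
  = c1 * RInt f1 a b + c2 * RInt f2 a b + c3 * RInt f3 a b.
Proof.
  intros H1 H2 H3. apply is_RInt_unique.
  assert (K : forall (f : R -> R) (c : R), (forall s : R, continuous f s) -> is_RInt (fun s => scal c (f s)) a b (scal c (RInt f a b))).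
  { intros f c H. apply (is_RInt_scal (V := R_NormedModule)). apply (RInt_correct (V := R_CompleteNormedModule)).
    apply (ex_RInt_continuous (V := R_CompleteNormedModule)). intros; apply H. }
  apply (is_RInt_plus (V := R_NormedModule) (fun s => plus (scal c1 (f1 s)) (scal c2 (f2 s))) (fun s => scal c3 (f3 s))
    a b (plus (scal c1 (RInt f1 a b)) (scal c2 (RInt f2 a b))) (scal c3 (RInt f3 a b))); auto.
  apply (is_RInt_plus (V := R_NormedModule) (fun s => scal c1 (f1 s))); auto.
Qed.

Lemma C_RInt_pair (f : R -> C) (f1 f2 : R -> R) (T l1 l2 : R) :
  (forall s, f s = (f1 s, f2 s)) ->
  (forall s, continuous f1 s) -> (forall s, continuous f2 s) ->
  RInt f1 0 T = l1 -> RInt f2 0 T = l2 ->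
  RInt (V := C_R_CompleteNormedModule) f 0 T = (l1, l2).
Proof.
  intros Hf H1 H2 <- <-. apply (is_RInt_unique (V := C_R_CompleteNormedModule)).
  apply (is_RInt_ext (V := C_R_NormedModule) (fun s => (f1 s, f2 s) : C)).
  { intros s _. symmetry; apply Hf. }
  apply (is_RInt_fct_extend_pair (U := R_NormedModule) (V := R_NormedModule) (fun s => (f1 s, f2 s)));
  apply (RInt_correct (V := R_CompleteNormedModule));
  apply (ex_RInt_continuous (V := R_CompleteNormedModule)); intros; [apply H1 | apply H2].
Qed.

Lemma partial_fractions (x a b c : R) : a <> b -> b <> c -> a <> c -> x <> a -> x <> b -> x <> c ->
  / ((x - a) * (x - b) * (x - c)) =
  / ((a - b) * (a - c)) * / (x - a) + / ((b - a) * (b - c)) * / (x - b) + / ((c - a) * (c - b)) * / (x - c).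
Proof. intros. field. repeat split; lra. Qed.

(** The numerator is e^u as a function of wp, with m = beta / 3. *)
Lemma partial_fractions_affine (m x a b c : R) : a <> b -> b <> c -> a <> c -> x <> a -> x <> b -> x <> c ->
  (m - x) / 2 * / ((x - a) * (x - b) * (x - c)) =
  (m - a) / 2 / ((a - b) * (a - c)) * / (x - a) + (m - b) / 2 / ((b - a) * (b - c)) * / (x - b)
  + (m - c) / 2 / ((c - a) * (c - b)) * / (x - c).
Proof. intros. field. repeat split; lra. Qed.

(** * The integrals beta1, beta2 and G_j over a period *)

Section Surface.

Variables (w v : R) (p u : R -> R) (beta : R).
Hypotheses (Hw : 0 < w) (Hv : 0 < v).
Hypothesis Hp : forall s : R, RtoC (p s) = eis w v 2 (s - Ci * v)%C.
Hypothesis Hu : forall s, exp (u s) = (beta / 3 - p s) / 2.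

(** Differentiability of [u] comes from writing it as the logarithm of (beta / 3 - p) / 2, which is
    positive because it is an exponential. *)
Lemma exp_u_Derive s : exp (u s) * Derive u s = - pprime w v s / 2.
Proof.
  pose proof (exp_pos (u s)) as He.
  assert (D : is_derive u s (- pprime w v s / 2 / exp (u s))).
  { apply (is_derive_ext (fun s => ln ((beta / 3 - p s) / 2))).
    { intros t. rewrite <- Hu. apply ln_exp. }
    pose proof (is_derive_p w v p Hw Hv Hp s) as Dp.
    auto_derive.
    - split. eexists; exact Dp. split; auto. rewrite Hu in He. unfold Rdiv, Rminus in He. lra.
    - change (Derive (fun x : R => p x) s) with (Derive p s). rewrite (is_derive_unique _ _ _ Dp). rewrite !Hu. rewrite Hu in He. field. lra. }
  rewrite (is_derive_unique _ _ _ D). field. lra.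
Qed.

Lemma continuous_exp_u (s : R) : continuous (fun s => exp (u s)) s.
Proof.
  apply (continuous_ext (fun s => (beta / 3 - p s) / 2)). intros; symmetry; apply Hu.
  pose proof (is_derive_p w v p Hw Hv Hp s) as Dp.
  apply (ex_derive_continuous (fun s => (beta / 3 - p s) / 2)). auto_derive. eexists; exact Dp.
Qed.

Lemma exp_u_reflect s : exp (u (2 * w - s)) = exp (u s).
Proof. rewrite !Hu, (p_reflect w v p Hw Hv Hp). reflexivity. Qed.

Variable b : R.
Hypothesis Hb : b <> 0.

Definition eu_slope s := - pprime w v s / 2.
(** The squared modulus of [denom], that is, the real denominator obtained on multiplying by the
    conjugate. *)
Definition eu_den s := eu_slope s ^ 2 + 4 * b ^ 2.

Lemma eu_den_pos s : 0 < eu_den s.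
Proof. unfold eu_den. pose proof (pow2_ge_0 (eu_slope s)). assert (0 < b ^ 2) by (simpl; rewrite Rmult_1_r; apply Rsqr_pos_lt; auto). lra. Qed.

Lemma continuous_eu_slope s : continuous eu_slope s.
Proof.
  apply (continuous_ext (fun s => scal (- / 2) (pprime w v s))).
  { intros t. unfold eu_slope, scal; simpl; unfold mult; simpl. field. }
  apply (continuous_scal_r (V := R_NormedModule)). apply (continuous_pprime w v Hw Hv).
Qed.

Lemma continuous_inv_eu_den s : continuous (fun s => / eu_den s) s.
Proof.
  apply (continuous_comp eu_den Rinv).
  - unfold eu_den. apply (continuous_plus (V := R_NormedModule) (fun s => eu_slope s ^ 2) (fun _ => 4 * b ^ 2)).
    + simpl. apply (continuous_mult (K := R_AbsRing) eu_slope (fun s => eu_slope s * 1)). apply continuous_eu_slope.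
      apply (continuous_mult (K := R_AbsRing) eu_slope (fun _ => 1)). apply continuous_eu_slope. apply continuous_const.
    + apply continuous_const.
  - apply continuous_Rinv. pose proof (eu_den_pos s). lra.
Qed.

Lemma eu_slope_reflect s : eu_slope (2 * w - s) = - eu_slope s.
Proof. unfold eu_slope. rewrite (pprime_reflect w v Hw Hv). field. Qed.

Lemma eu_den_reflect s : eu_den (2 * w - s) = eu_den s.
Proof. unfold eu_den. rewrite eu_slope_reflect. ring. Qed.

Variables (psi lambda : C) (a : R).
Hypothesis Hlam : Cmod lambda = 1.
Hypothesis Hh : hopf psi lambda = (a, b).

Lemma denom_eq s : denom psi lambda u s = (- eu_slope s, - (2 * b)).
Proof.
  unfold denom. rewrite (conj_hopf psi lambda Hlam), Hh, exp_u_Derive. fold (eu_slope s).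
  unfold Cconj, Cminus, Copp, Cplus, RtoC; simpl. f_equal; ring.
Qed.

(** Multiplied by the conjugate of the denominator, the integrand becomes - 4 a b / eu_den + i (1 -
    2 a eu_slope / eu_den). The last term is odd under s |-> 2 w - s and integrates to 0, which
    leaves 2 w for the imaginary part. *)
Lemma beta1_period : beta1 psi lambda u (2 * w)
  = (- (4 * b * a) * RInt (fun s => / eu_den s) 0 (2 * w), 2 * w).
Proof.
  unfold beta1.
  apply (C_RInt_pair _ (fun s => scal (- (4 * b * a)) (/ eu_den s)) (fun s => plus 1 (scal (- (2 * a)) (eu_slope s * / eu_den s)))).
  - intros s. rewrite <- Cmult_assoc, (conj_hopf psi lambda Hlam), Hh, denom_eq.
    replace (Derive u s * exp (u s)) with (eu_slope s) by (unfold eu_slope; rewrite <- exp_u_Derive; ring).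
    pose proof (eu_den_pos s) as HQ.
    unfold Cdiv, Cinv, Cconj, Cminus, Copp, Cplus, Cmult, Ci, RtoC, scal, plus; simpl; unfold mult; simpl.
    unfold eu_den in *. f_equal; field; simpl in HQ; lra.
  - intros s. apply (continuous_scal_r (V := R_NormedModule)). apply continuous_inv_eu_den.
  - intros s. apply (continuous_plus (V := R_NormedModule)). apply continuous_const.
    apply (continuous_scal_r (V := R_NormedModule)).
    apply (continuous_mult (K := R_AbsRing)). apply continuous_eu_slope. apply continuous_inv_eu_den.
  - rewrite (RInt_scal (V := R_CompleteNormedModule)). reflexivity.
    apply (ex_RInt_continuous (V := R_CompleteNormedModule)). intros; apply continuous_inv_eu_den.
  - assert (Cx : forall s, continuous (fun s => eu_slope s * / eu_den s) s).
    { intros s. apply (continuous_mult (K := R_AbsRing)). apply continuous_eu_slope. apply continuous_inv_eu_den. }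
    assert (Ex : ex_RInt (fun s => eu_slope s * / eu_den s) 0 (2 * w)).
    { apply (ex_RInt_continuous (V := R_CompleteNormedModule)). intros; apply Cx. }
    rewrite (RInt_plus (V := R_CompleteNormedModule) (fun _ => 1)).
    + rewrite (RInt_scal (V := R_CompleteNormedModule)); auto.
      rewrite (RInt_odd_reflection (fun s => eu_slope s * / eu_den s)); auto.
      * rewrite (RInt_const (V := R_CompleteNormedModule)). unfold plus, scal; simpl; unfold mult; simpl. ring.
      * intros s. rewrite eu_slope_reflect, eu_den_reflect. ring.
    + apply (ex_RInt_const (V := R_NormedModule)).
    + apply (ex_RInt_scal (V := R_NormedModule)). auto.
Qed.

(** The real part of the integrand is odd about s = w, since it carries one factor [eu_slope]. *)
Lemma beta2_period : beta2 psi lambda u (2 * w)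
  = (0, 4 * b * RInt (fun s => exp (u s) * / eu_den s) 0 (2 * w)).
Proof.
  unfold beta2.
  assert (Cx : forall s, continuous (fun s => -2 * (exp (u s) * (eu_slope s * / eu_den s))) s).
  { intros s. apply (continuous_scal_r (V := R_NormedModule) (-2) (fun s => exp (u s) * (eu_slope s * / eu_den s))).
    apply (continuous_mult (K := R_AbsRing) (fun s => exp (u s))). apply continuous_exp_u.
    apply (continuous_mult (K := R_AbsRing) eu_slope (fun s => / eu_den s)). apply continuous_eu_slope. apply continuous_inv_eu_den. }
  assert (Cy : forall s, continuous (fun s => exp (u s) * / eu_den s) s).
  { intros s. apply (continuous_mult (K := R_AbsRing) (fun s => exp (u s))). apply continuous_exp_u. apply continuous_inv_eu_den. }
  apply (C_RInt_pair _ (fun s => -2 * (exp (u s) * (eu_slope s * / eu_den s))) (fun s => scal (4 * b) (exp (u s) * / eu_den s))); auto.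
  - intros s. rewrite denom_eq. pose proof (eu_den_pos s) as HQ.
    unfold Cdiv, Cinv, Cconj, Cminus, Copp, Cplus, Cmult, Ci, RtoC, scal, plus; simpl; unfold mult; simpl.
    unfold eu_den in *. f_equal; field; simpl in HQ; lra.
  - intros s. apply (continuous_scal_r (V := R_NormedModule)). auto.
  - apply RInt_odd_reflection; auto.
    intros s. rewrite eu_slope_reflect, eu_den_reflect, exp_u_reflect. ring.
  - rewrite (RInt_scal (V := R_CompleteNormedModule)). reflexivity.
    apply (ex_RInt_continuous (V := R_CompleteNormedModule)). intros; apply Cy.
Qed.

Variables (g2 g3 e3 gt3 : R).
Hypothesis Hg2 : inv_g2 w (Ci * v)%C = g2.
Hypothesis He3 : wp w (Ci * v)%C (Ci * v)%C = e3.
Hypothesis Hcub : 4 * e3 ^ 3 - g2 * e3 - g3 = 0.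
Hypothesis Hgt3 : gt3 = g3 - 16 * b ^ 2.
Variable et : nat -> R.
Hypothesis Het : ordered_roots g2 gt3 et.

(** Four times [eu_den] is wp'^2 + 16 b^2, so in the cubic for wp'^2 the constant g3 is replaced by
    g3 - 16 b^2: this is the origin of the modified invariant [gt3]. *)
Lemma eu_den_factor s : eu_den s = (p s - et 1%nat) * (p s - et 2%nat) * (p s - et 3%nat).
Proof.
  pose proof (ordered_roots_factor g2 gt3 et Het (p s)) as F.
  pose proof (pprime_sq w v p Hw Hv Hp g2 g3 e3 s Hg2 He3 Hcub) as S.
  unfold eu_den, eu_slope. replace ((- pprime w v s / 2) ^ 2) with (pprime w v s ^ 2 / 4) by field.
  rewrite S. lra.
Qed.

Lemma p_neq_et j s : idx j -> p s <> et j.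
Proof.
  intros Hj E. pose proof (eu_den_pos s) as HQ. rewrite eu_den_factor in HQ.
  destruct j as [|[|[|[|j]]]]; unfold idx in Hj; try lia; rewrite E in HQ; lra.
Qed.

Variable Hsq : nat -> R.
Hypothesis HHsq : forall i j k, distinct3 i j k -> Hsq i = (et i - et j) * (et i - et k).

Definition recip_integral j := RInt (fun s => / (p s - et j)) 0 (2 * w).

Lemma RInt_inv_eu_den : RInt (fun s => / eu_den s) 0 (2 * w)
  = / Hsq 1%nat * recip_integral 1 + / Hsq 2%nat * recip_integral 2 + / Hsq 3%nat * recip_integral 3.
Proof.
  pose proof Het as [H12 [H23 _]].
  assert (Hc : forall j, idx j -> forall s, continuous (fun s => / (p s - et j)) s).
  { intros j Hj s. apply (continuous_inv_p w v p Hw Hv Hp). intros; apply p_neq_et; auto. }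
  unfold recip_integral. rewrite <- RInt_lin3 by (apply Hc; unfold idx; lia).
  apply RInt_ext. intros s _. rewrite eu_den_factor.
  rewrite (HHsq 1 2 3), (HHsq 2 1 3), (HHsq 3 1 2) by (unfold distinct3, idx; lia).
  apply partial_fractions; try lra; apply p_neq_et; unfold idx; lia.
Qed.

Lemma RInt_exp_u_eu_den : RInt (fun s => exp (u s) * / eu_den s) 0 (2 * w)
  = (beta / 3 - et 1%nat) / 2 / Hsq 1%nat * recip_integral 1 + (beta / 3 - et 2%nat) / 2 / Hsq 2%nat * recip_integral 2
    + (beta / 3 - et 3%nat) / 2 / Hsq 3%nat * recip_integral 3.
Proof.
  pose proof Het as [H12 [H23 _]].
  assert (Hc : forall j, idx j -> forall s, continuous (fun s => / (p s - et j)) s).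
  { intros j Hj s. apply (continuous_inv_p w v p Hw Hv Hp). intros; apply p_neq_et; auto. }
  unfold recip_integral. rewrite <- RInt_lin3 by (apply Hc; unfold idx; lia).
  apply RInt_ext. intros s _. rewrite eu_den_factor, Hu.
  rewrite (HHsq 1 2 3), (HHsq 2 1 3), (HHsq 3 1 2) by (unfold distinct3, idx; lia).
  apply partial_fractions_affine; try lra; apply p_neq_et; unfold idx; lia.
Qed.

(** At [alpha] the two cubics give wp'^2 = gt3 - g3 = - 16 b^2, hence wp' is not 0 there and
    [period_integral] can be solved for the integral. *)
Lemma recip_integral_period_term j alpha : idx j -> wp_preimage w (Ci * v)%C (et j) alpha ->
  wp' w (Ci * v)%C alpha <> 0%C /\
  RtoC (recip_integral j) = (/ wp' w (Ci * v) alpha * period_term w (Ci * v) alpha)%C.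
Proof.
  intros Hj [Hna [Him Hwp]].
  assert (Ev : Im (Ci * v)%C = v) by (simpl; ring). rewrite Ev in Him. rewrite wp_eis in Hwp.
  assert (Ed : wp' w (Ci * v)%C alpha = (-2 * eis w v 3 alpha)%C).
  { unfold wp'. apply cderiv_C_derive. apply (cderiv_ext (eis w v 2)). reflexivity.
    apply eis_cderiv'; auto. inr_ring. }
  assert (Nd : wp' w (Ci * v)%C alpha <> 0%C).
  { rewrite Ed. intros E.
    pose proof (wp_first_order w v g2 g3 e3 alpha Hw Hv Hg2 He3 Hcub Hna ltac:(lra)) as W.
    rewrite E, Hwp in W.
    assert (W' : 4 * et j ^ 3 - g2 * et j - g3 = 0).
    { apply RtoC_inj. rewrite !RtoC_minus, !RtoC_mult, RtoC_pow, <- W. ring. }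
    pose proof (ordered_roots_eq g2 gt3 et j Het Hj).
    assert (0 < b ^ 2) by (simpl; rewrite Rmult_1_r; apply Rsqr_pos_lt; auto). lra. }
  split; auto.
  assert (N3 : eis w v 3 alpha <> 0%C).
  { intros E. apply Nd. rewrite Ed, E. ring. }
  rewrite <- (period_integral w v p Hw Hv Hp alpha (et j)); auto.
  2:{ intros; apply p_neq_et; auto. }
  rewrite <- Ed. fold (recip_integral j). field. auto.
Qed.

(** By Vieta the sum of the d's is 0 and the sum of their pairwise products is - beta, so d k * d l
    = d j ^ 2 - beta. *)
Lemma labelled_root_eq d j : labelled_roots beta psi lambda et d -> idx j ->
  et j = d j ^ 2 - 2 * beta / 3 /\ d j ^ 3 - beta * d j + 2 * a = 0.
Proof.
  intros [Hd He] Hj. pose proof Het as [H12 [H23 _]]. rewrite Hh in Hd. simpl Re in Hd.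
  assert (K : forall i, idx i -> d i ^ 3 - beta * d i + 2 * a = 0).
  { intros i Hi. apply Hd. exists i; auto. }
  split; [|auto].
  assert (L : forall i k l, distinct3 i k l -> et i = d i ^ 2 - 2 * beta / 3).
  { intros i k l Hikl. pose proof Hikl as [Hi [Hk [Hl [N1 [N2 N3]]]]].
    pose proof (He i k l Hikl) as E1.
    pose proof (He k i l ltac:(unfold distinct3 in *; intuition congruence)) as E2.
    pose proof (He l i k ltac:(unfold distinct3 in *; intuition congruence)) as E3.
    assert (Net : forall i k, idx i -> idx k -> i <> k -> et i <> et k).
    { intros x y Hx Hy Nxy. destruct x as [|[|[|[|x]]]], y as [|[|[|[|y]]]]; unfold idx in *; try lia; lra. }
    pose proof (Net i k Hi Hk N1). pose proof (Net k l Hk Hl N2). pose proof (Net i l Hi Hl N3).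
    (* Two equal d's would give two equal products with the third one, hence two equal [et]. *)
    assert (D1 : d i <> d k) by (intros E; rewrite E in *; lra).
    assert (D2 : d k <> d l) by (intros E; rewrite E in *; lra).
    assert (D3 : d i <> d l) by (intros E; rewrite E in *; lra).
    destruct (cubic_vieta 1 beta (- (2 * a)) (d i) (d k) (d l)) as [V1 [V2 V3]]; auto; try lra;
      try (pose proof (K i Hi); pose proof (K k Hk); pose proof (K l Hl); lra).
    rewrite E1, V1. replace (2 * beta / 3) with (beta - beta / 3) by field. rewrite V2 at 2. ring. }
  destruct j as [|[|[|[|j]]]]; unfold idx in Hj; try lia.
  - apply (L 1 2 3)%nat. unfold distinct3, idx; lia.
  - apply (L 2 1 3)%nat. unfold distinct3, idx; lia.
  - apply (L 3 1 2)%nat. unfold distinct3, idx; lia.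
Qed.

(** The cubic for d gives a = (beta d - d^3) / 2, and then d e^u - a = - (d / 2) (p - et j): the
    denominator of G_j is a single linear factor. Here d <> 0 because a <> 0. *)
Lemma Gint_period d j : a <> 0 -> labelled_roots beta psi lambda et d -> idx j ->
  Gint psi lambda u (d j) (2 * w) = -2 * b * recip_integral j.
Proof.
  intros Ha Hd Hj. destruct (labelled_root_eq d j Hd Hj) as [E1 E2].
  assert (Hc : forall s, continuous (fun s => / (p s - et j)) s).
  { intros s. apply (continuous_inv_p w v p Hw Hv Hp). intros; apply p_neq_et; auto. }
  unfold Gint, recip_integral. change (-2 * b * RInt (fun s => / (p s - et j)) 0 (2 * w))
    with (scal (-2 * b) (RInt (fun s => / (p s - et j)) 0 (2 * w))).
  rewrite <- (RInt_scal (V := R_CompleteNormedModule)).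
  2:{ apply (ex_RInt_continuous (V := R_CompleteNormedModule)). intros; apply Hc. }
  apply RInt_ext. intros s _. rewrite Hh. simpl Re. simpl Im.
  change (d j * b / (d j * exp (u s) - a) = -2 * b * / (p s - et j)).
  pose proof (p_neq_et j s Hj) as Np. rewrite E1 in *.
  assert (Nd : d j <> 0) by (intros E; rewrite E in E2; lra).
  rewrite Hu. replace a with (- (d j ^ 3 - beta * d j) / 2) by lra.
  replace (d j * ((beta / 3 - p s) / 2) - - (d j ^ 3 - beta * d j) / 2)
    with (- (d j / 2) * (p s - (d j ^ 2 - 2 * beta / 3))) by field.
  field. split; lra.
Qed.

End Surface.

(** * The closed formulas *)

Open Scope C_scope.

Theorem mainTheorem11
  (psi : C) (beta g2 g3 : R)
  (hpsi : psi <> 0) (hbeta : (0 < beta)%R)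
  (hbeta3 : (beta ^ 3 > 27 * Cmod psi ^ 2)%R)
  (hg2 : g2 = (4 / 3 * beta ^ 2)%R)
  (hg3 : g3 = (16 * Cmod psi ^ 2 - 8 / 27 * beta ^ 3)%R)
  (e : nat -> R) (he : ordered_roots g2 g3 e)
  (omega : R) (omega' : C) (homega : half_periods g2 g3 e omega omega')
  (u : R -> R)
  (hu : forall y : R,
      RtoC (exp (u y)) = beta / 6 - wp omega omega' (y - omega') / 2)
  (lambda : C) (hlambda : Cmod lambda = 1%R)
  (hre : Re (hopf psi lambda) <> 0%R)
  (gt3 : R) (hgt3 : gt3 = (g3 - 16 * Im (hopf psi lambda) ^ 2)%R) :
  (exists et : nat -> R, ordered_roots g2 gt3 et) /\
  forall et : nat -> R, ordered_roots g2 gt3 et ->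
  forall Hsq : nat -> R,
  (forall i j k, distinct3 i j k -> Hsq i = ((et i - et j) * (et i - et k))%R) ->
  (Im (hopf psi lambda) <> 0%R ->
   forall alpha : nat -> C,
   (forall j, idx j -> wp_preimage omega omega' (et j) (alpha j)) ->
   beta1 psi lambda u (2 * omega) =
     2 * omega * Ci
     - 4 * Im (hopf psi lambda) * Re (hopf psi lambda) *
       sum_n_m (fun j => / Hsq j * / wp' omega omega' (alpha j)
                         * period_term omega omega' (alpha j)) 1 3
   /\
   beta2 psi lambda u (2 * omega) =
     Ci * Im (hopf psi lambda) *
       sum_n_m (fun j => 2 * (beta / 3 - et j) / Hsq j
                         * / wp' omega omega' (alpha j)
                         * period_term omega omega' (alpha j)) 1 3
   /\
   forall d : nat -> R, labelled_roots beta psi lambda et d ->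
   forall j, idx j ->
   RtoC (Gint psi lambda u (d j) (2 * omega)) =
     - 2 * Im (hopf psi lambda) *
       (period_term omega omega' (alpha j) / wp' omega omega' (alpha j)))
  /\
  (Im (hopf psi lambda) = 0%R ->
   beta1_reduced psi lambda u omega = 2 * omega * Ci /\
   beta2_reduced psi lambda u omega = 0 /\
   forall d : nat -> R, labelled_roots beta psi lambda et d ->
   forall j, idx j -> Gint psi lambda u (d j) (2 * omega) = 0%R).
Proof.
  destruct (hopf psi lambda) as [a b] eqn:Hh. simpl Re in *. simpl Im in *.
  assert (Hmod : (Cmod psi ^ 2 = a ^ 2 + b ^ 2)%R).
  { rewrite <- (Cmod_hopf psi lambda hlambda), Hh, Cmod2_alt. reflexivity. }
  split.
  { replace g2 with (4 / 3 * beta ^ 2)%R.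
    replace gt3 with (16 * a ^ 2 - 8 / 27 * beta ^ 3)%R by (rewrite hgt3, hg3, Hmod; ring).
    apply modified_roots_exist; auto. pose proof (pow2_ge_0 b). lra. }
  intros et Het Hsq HHsq. split.
  - intros Hb alpha Halpha.
    destruct homega as [Hw [_ [[v [_ ->]] [Hg2 [_ [_ He3]]]]]].
    (* The sign of [v] is read off the strip condition: the strip contains [alpha 1], so its width
       is positive. *)
    assert (Hv : (0 < v)%R).
    { destruct (Halpha 1%nat) as [_ [Him _]]. unfold idx; lia.
      replace (Im (Ci * v)) with v in Him by (simpl; ring).
      pose proof (Rabs_pos (Im (alpha 1%nat))). lra. }
    (* The formula for e^u is solved for wp, which exhibits the values of wp on the line as real
       numbers. *)
    pose (p := fun s : R => (beta / 3 - 2 * exp (u s))%R).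
    assert (Hp : forall s : R, RtoC (p s) = eis omega v 2 (s - Ci * v)).
    { intros s. rewrite <- wp_eis. unfold p.
      rewrite RtoC_minus, RtoC_mult, hu, RtoC_div by lra. field. }
    assert (Hu : forall s, (exp (u s) = (beta / 3 - p s) / 2)%R) by (intros; unfold p; field).
    assert (Hcub : (4 * e 3%nat ^ 3 - g2 * e 3%nat - g3 = 0)%R).
    { apply (ordered_roots_eq g2 g3 e); auto. unfold idx; lia. }
    assert (HI : forall j, idx j -> wp' omega (Ci * v) (alpha j) <> 0 /\
      RtoC (recip_integral omega p et j) = / wp' omega (Ci * v) (alpha j) * period_term omega (Ci * v) (alpha j)).
    { intros j Hj. eapply (recip_integral_period_term omega v p); eauto. }
    assert (Hsq_nz : forall j, idx j -> Hsq j <> 0%R).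
    { pose proof Het as [H12 [H23 _]].
      intros j Hj. destruct j as [|[|[|[|j]]]]; unfold idx in Hj; try lia.
      - rewrite (HHsq 1 2 3)%nat by (unfold distinct3, idx; lia). apply Rmult_integral_contrapositive; lra.
      - rewrite (HHsq 2 1 3)%nat by (unfold distinct3, idx; lia). apply Rmult_integral_contrapositive; lra.
      - rewrite (HHsq 3 1 2)%nat by (unfold distinct3, idx; lia). apply Rmult_integral_contrapositive; lra. }
    assert (Hsum : forall f : nat -> C, sum_n_m f 1 3 = f 1%nat + (f 2%nat + f 3%nat)).
    { intros f. rewrite sum_Sn_m, sum_Sn_m, sum_n_n by lia. reflexivity. }
    assert (I1 : idx 1) by (unfold idx; lia). assert (I2 : idx 2) by (unfold idx; lia).
    assert (I3 : idx 3) by (unfold idx; lia).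
    destruct (HI 1%nat I1) as [_ T1]. destruct (HI 2%nat I2) as [_ T2]. destruct (HI 3%nat I3) as [_ T3].
    split; [|split].
    + rewrite (beta1_period omega v p u beta Hw Hv Hp Hu b Hb psi lambda a hlambda Hh).
      rewrite (RInt_inv_eu_den omega v p Hw Hv Hp b Hb g2 g3 (e 3%nat) gt3 Hg2 He3 Hcub hgt3 et Het Hsq HHsq).
      rewrite Hsum, <- !Cmult_assoc, <- T1, <- T2, <- T3.
      rewrite <- !RtoC_inv by auto.
      unfold Cminus, Copp, Cplus, Cmult, Ci, RtoC; simpl. f_equal; ring.
    + rewrite (beta2_period omega v p u beta Hw Hv Hp Hu b Hb psi lambda a hlambda Hh).
      rewrite (RInt_exp_u_eu_den omega v p u beta Hw Hv Hp Hu b Hb g2 g3 (e 3%nat) gt3 Hg2 He3 Hcub hgt3 et Het Hsq HHsq).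
      (* Grouping 1 / wp' with the period term turns each summand into a real coefficient times a
         real integral, so only real algebra remains. *)
      rewrite Hsum, <- !(Cmult_assoc _ (/ wp' _ _ _)), <- T1, <- T2, <- T3.
      rewrite <- !RtoC_div, <- !RtoC_minus, <- !RtoC_mult by lra.
      rewrite <- !RtoC_div by auto.
      unfold Cminus, Copp, Cplus, Cmult, Ci, RtoC; simpl. f_equal; field; auto.
    + intros d Hd j Hj.
      rewrite (Gint_period omega v p u beta Hw Hv Hp Hu b Hb psi lambda a Hh g2 g3 (e 3%nat) gt3 Hg2 He3 Hcub hgt3 et Het d j hre Hd Hj).
      destruct (HI j Hj) as [N T]. rewrite !RtoC_mult, T. field. auto.
  - intros Hb. unfold beta1_reduced, beta2_reduced. rewrite Hh. simpl Im. simpl Re. rewrite Hb.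
    split; [|split].
    + rewrite !Rmult_0_r, !Rmult_0_l. ring.
    + rewrite Rmult_0_l. ring.
    + intros d _ j _. unfold Gint. rewrite Hh. simpl Im. rewrite Hb.
      (* The numerator is 0 and division is total, so the integrand is 0 even where the denominator
         vanishes. *)
      rewrite (RInt_ext _ (fun _ => 0%R)).
      * rewrite RInt_const. unfold scal; simpl; unfold mult; simpl. ring.
      * intros s _. unfold Rdiv. rewrite Rmult_0_r, Rmult_0_l. reflexivity.
Qed.
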